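(* Let $s\in(0,1)$, let $N\ge 1$ be an integer with $N\ge 4s$, let $2^*_s=\frac{2N}{N-2s}$ and $m>0$. Let $W:\mathbb{R}^N\to\mathbb{R}$ be continuous and $2\pi$-periodic in each variable, with $\min_{[-\pi,\pi]^N}W>0$, $W(0)=\max_{[-\pi,\pi]^N}W$ and $W(x)=W(0)+O(|x|^{2s})$ as $|x|\to 0$. Let $f:\mathbb{R}^N\times\mathbb{R}\to\mathbb{R}$ be continuous and satisfy, with $F(x,t)=\int_0^t f(x,\tau)\,d\tau$: (1) $f(x+2\pi e_i,t)=f(x,t)$ for all $x\in\mathbb{R}^N$, $t\in\mathbb{R}$, $i=1,\dots,N$; (2) $f(x,t)=o(t)$ as $t\to0$, uniformly in $x\in\mathbb{R}^N$; (3) there exist $2<p<2^*_s$ and $C>0$ such that $|f(x,t)|\le C(1+|t|^{p-1})$ for all $x\in\mathbb{R}^N$, $t\in\mathbb{R}$; (4) there exists $\mu>2$ such that $0<\mu F(x,t)\le t f(x,t)$ for all $x\in\mathbb{R}^N$, $t\in\mathbb{R}\setminus\{0\}$; (5) there exist a nonempty open set $\mathcal{A}$ in $[-\pi,\pi]^N$ and a function $\bar f$ such that $f(x,t)\ge\bar f(t)$ for a.e. $x\in\mathcal{A}$ and all $t\ge0$, and the function $\bar F(t)=\int_0^t\bar f(\tau)\,d\tau$ satisfies $$\lim_{\varepsilon\to0^+}\varepsilon^{\min\left\{\frac{N+2s}{2},\frac{p(N-2s)}{2}\right\}}\int_0^{\varepsilon^{-1}}\bar F\left[\left(\frac{\varepsilon^{-1}}{1+t^2}\right)^{\frac{N-2s}{2}}\right]t^{N-1}\,dt=\infty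 ,$$ with $p$ as in (3). Let $v\in\mathbb{X}^s_m$ be a weak solution of $$\begin{cases}-\operatorname{div}(\xi^{1-2s}\nabla v)+m^2\xi^{1-2s}v=0&\text{in }\mathcal{S}_{2\pi},\\ v\ \text{is }2\pi\text{-periodic in each }x_i,\\ -\lim_{\xi\to0}\xi^{1-2s}\frac{\partial v}{\partial\xi}=\kappa_s\big[m^{2s}v+W(x)|v|^{2^*_s-2}v+f(x,v)\big]&\text{on }\partial^0\mathcal{S}_{2\pi}.\end{cases}$$ Then $\mathrm{Tr}(v)\in C^{0,\alpha}([-\pi,\pi]^N)$ for some $\alpha\in(0,1)$.
   Context: All functions are real-valued; $(e_i)$ is the canonical basis of $\mathbb{R}^N$. Let $\mathcal{S}_{2\pi}=(-\pi,\pi)^N\times(0,\infty)$, with points $(x,\xi)$, $\partial^0\mathcal{S}_{2\pi}=(-\pi,\pi)^N\times\{0\}$, $\kappa_s=2^{1-2s}\frac{\Gamma(1-s)}{\Gamma(s)}$. $\mathbb{X}^s_m$ is the completion of the set of functions $v\in C^\infty(\overline{\mathbb{R}^{N+1}_+})$ that are $2\pi$-periodic in each $x_i$ (and of finite norm) under $\|v\|^2_{\mathbb{X}^s_m}=\iint_{\mathcal{S}_{2\pi}}\xi^{1-2s}(|\nabla v|^2+m^2v^2)\,dx\,d\xi$. $\mathrm{Tr}$ is the bounded linear trace operator on $\mathbb{X}^s_m$ extending $v\mapsto v(\cdot,0)$; it maps $\mathbb{X}^s_m$ continuously into $L^q(-\pi,\pi)^N$ for $1\le q\le2^*_s$. Weak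 solution means: for all $\phi\in\mathbb{X}^s_m$, $$\iint_{\mathcal{S}_{2\pi}}\xi^{1-2s}(\nabla v\cdot\nabla\phi+m^2v\phi)\,dx\,d\xi=\kappa_s\int_{\partial^0\mathcal{S}_{2\pi}}\big[m^{2s}\mathrm{Tr}(v)+W(x)|\mathrm{Tr}(v)|^{2^*_s-2}\mathrm{Tr}(v)+f(x,\mathrm{Tr}(v))\big]\mathrm{Tr}(\phi)\,dx.$$ *)

(* Defs.v *)
From HB Require Import structures.
From mathcomp Require Import all_boot all_order all_algebra.
From mathcomp Require Import all_classical all_reals all_analysis.
Import Order.TTheory GRing.Theory Num.Theory.
Import numFieldNormedType.Exports.

Set Implicit Arguments.
Unset Strict Implicit.
Unset Printing Implicit Defensive.

Local Open Scope classical_set_scope.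
Local Open Scope ring_scope.

Definition measure_mx_display : measure_display.
Proof. exact: default_measure_display. Qed.

(* The sigma-algebra generated by the coordinates; for a real matrix type it
   is the Borel one. *)
Section measurable_mx.
Context {R : realType} (m n : nat).

Definition mx_cylinders : set (set 'M[R]_(m, n)) :=
  [set B | exists i j (A : set R),
     measurable A /\ B = (fun M : 'M[R]_(m, n) => M i j) @^-1` A].

HB.instance Definition _ := @isMeasurable.Build measure_mx_display
  'M[R]_(m, n) <<s mx_cylinders >> (@sigma_algebra0 _ setT mx_cylinders)
  (@sigma_algebraC _ mx_cylinders)
  (@sigma_algebra_bigcup _ setT mx_cylinders).

End measurable_mx.

Section row_cons.
Context {R : realType} (n : nat).

Definition row_cons (p : measurableTypeR R * 'rV[R]_n) : 'rV[R]_n.+1 :=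
  \row_i oapp (fun j => p.2 ord0 j) p.1 (unlift ord0 i).

Lemma measurable_mx_coord (m k : nat) (i : 'I_m) (j : 'I_k) :
  measurable_fun [set: 'M[R]_(m, k)] (fun M => M i j).
Proof.
move=> _ A mA; rewrite setTI; apply: sub_sigma_algebra.
by exists i, j, A.
Qed.

Lemma measurable_to_mx d (T : measurableType d) (m k : nat)
    (f : T -> 'M[R]_(m, k)) :
  (forall i j, measurable_fun [set: T] (fun t => f t i j)) ->
  measurable_fun [set: T] f.
Proof.
move=> mf _ B mB.
suff : <<s @mx_cylinders R m k >> `<=` image_set_system setT f measurable.
  by apply.
apply: smallest_sub; first exact/sigma_algebra_image/sigma_algebra_measurable.
move=> _ [i [j [A [mA ->]]]]; rewrite /image_set_system/=.
exact: mf.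
Qed.

Lemma measurable_row_cons :
  measurable_fun [set: measurableTypeR R * 'rV[R]_n] row_cons.
Proof.
apply: measurable_to_mx => i j.
under eq_fun do rewrite mxE.
case: (unlift ord0 j) => [k|] /=; last exact: measurable_fst.
exact: (measurableT_comp (measurable_mx_coord _ _) measurable_snd).
Qed.

Definition row_uncons (v : 'rV[R]_n.+1) : measurableTypeR R * 'rV[R]_n :=
  (v ord0 ord0, \row_j v ord0 (lift ord0 j)).

Lemma row_consK : cancel row_cons row_uncons.
Proof.
move=> [x v]; rewrite /row_uncons /row_cons !mxE unlift_none/=; congr pair.
by apply/rowP => j; rewrite !mxE liftK.
Qed.

Lemma measurable_row_uncons : measurable_fun [set: 'rV[R]_n.+1] row_uncons.
Proof.
apply/measurable_fun_pair; first exact: measurable_mx_coord.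
apply: measurable_to_mx => i j.
under eq_fun do rewrite mxE.
exact: measurable_mx_coord.
Qed.

Variable mu : {sigma_finite_measure set 'rV[R]_n -> \bar R}.

Definition leb_step (A : set 'rV[R]_n.+1) : \bar R :=
  (lebesgue_measure \x mu)%E (row_cons @^-1` A).

Let row_cons_preimage A : measurable A -> measurable (row_cons @^-1` A).
Proof.
by move=> mA; rewrite -[X in measurable X]setTI; exact: measurable_row_cons.
Qed.

Let leb_step0 : leb_step set0 = 0%E.
Proof. by rewrite /leb_step preimage_set0 measure0. Qed.

Let leb_step_ge0 A : (0 <= leb_step A)%E.
Proof. exact: measure_ge0. Qed.

Let leb_step_sigma_additive : semi_sigma_additive leb_step.
Proof.
move=> F mF tF mUF; rewrite /leb_step preimage_bigcup.
apply: measure_semi_sigma_additive.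
- by move=> k; exact: row_cons_preimage.
- apply/trivIsetP => /= i j _ _ ij; rewrite -preimage_setI.
  by move/trivIsetP : tF => /(_ _ _ _ _ ij) ->//; rewrite preimage_set0.
- by rewrite -preimage_bigcup; exact: row_cons_preimage.
Qed.

HB.instance Definition _ := isMeasure.Build _ _ _ leb_step
  leb_step0 leb_step_ge0 leb_step_sigma_additive.

Let leb_step_sigma_finite : sigma_finite setT leb_step.
Proof.
have /sigma_finiteP[F [TF ndF Foo]] := sigma_finiteT (@lebesgue_measure R).
have /sigma_finiteP[G [TG ndG Goo]] := sigma_finiteT mu.
exists (fun k => row_uncons @^-1` (F k `*` G k)).
  apply/seteqP; split => // v _ /=.
  have : [set: measurableTypeR R] (row_uncons v).1 by [].
  have : [set: 'rV[R]_n] (row_uncons v).2 by [].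
  rewrite TF TG => -[j _ Gj] [i _ Fi]; exists (maxn i j) => //; split.
    by move: Fi; exact/subsetPset/ndF/leq_maxl.
  by move: Gj; exact/subsetPset/ndG/leq_maxr.
move=> k; have [mF Fk] := Foo k; have [mG Gk] := Goo k; split.
  rewrite -[X in measurable X]setTI.
  by apply: measurable_row_uncons => //; exact: measurableX.
rewrite /leb_step (_ : _ @^-1` _ = F k `*` G k); last first.
  by apply/funext => x; rewrite /preimage /mkset row_consK.
by rewrite product_measure1E// lte_mul_pinfty// ge0_fin_numE.
Qed.

HB.instance Definition _ := Measure_isSigmaFinite.Build _ _ _ leb_step
  leb_step_sigma_finite.

End row_cons.

Fixpoint lebesgue_row {R : realType} (n : nat) :
    {sigma_finite_measure set 'rV[R]_n -> \bar R} :=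
  match n with
  | 0 => dirac (0 : 'rV[R]_0)
  | n'.+1 => leb_step (lebesgue_row n')
  end.

Section constants.
Context {R : realType}.
Implicit Types (s t : R) (N : nat).

Definition Gamma s : R :=
  \int[lebesgue_measure]_(t in `]0, +oo[) (t `^ (s - 1) * expR (- t)).

Definition kappa s : R := 2 `^ (1 - 2 * s) * (Gamma (1 - s) / Gamma s).

Definition crit_exp N s : R := 2 * N%:R / (N%:R - 2 * s).

Definition primitive0 (g : R -> R) t : R :=
  if 0 <= t then \int[lebesgue_measure]_(tau in `[0, t]) g tau
  else - \int[lebesgue_measure]_(tau in `[t, 0]) g tau.

End constants.

Section geometry.
Context {R : realType} {N : nat}.

(* Euclidean norm; the library norm of a row vector is the sup norm. *)
Definition enorm (x : 'rV[R]_N) : R := Num.sqrt (\sum_i x ord0 i ^+ 2).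

Definition open_cube : set 'rV[R]_N :=
  [set x | forall i, - pi < x ord0 i < pi].

Definition closed_cube : set 'rV[R]_N :=
  [set x | forall i, - pi <= x ord0 i <= pi].

Definition period (i : 'I_N) : 'rV[R]_N := (2 * pi) *: delta_mx ord0 i.

Definition half_space : set ('rV[R]_N * R) := [set z | 0 < z.2].

Definition closed_half_space : set ('rV[R]_N * R) := [set z | 0 <= z.2].

Definition half_cylinder : set ('rV[R]_N * R) :=
  [set z | open_cube z.1 /\ 0 < z.2].

Definition lebesgue_cyl :
    {measure set ('rV[R]_N * measurableTypeR R) -> \bar R} :=
  (lebesgue_row N \x @lebesgue_measure R)%E.

(* The N + 1 coordinate directions of R^N x R: [Some i] is the direction of
   x_i and [None] that of xi. *)
Definition direction (k : option 'I_N) : 'rV[R]_N * R :=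
  if k is Some i then (delta_mx ord0 i, 0) else (0, 1).

Definition gradient (u : 'rV[R]_N * R -> R) (k : option 'I_N)
    (z : 'rV[R]_N * R) : R := 'D_(direction k) u z.

(* [u] is C^infty up to the boundary: every iterated partial derivative
   [D l] of [u] exists in the open half-space and extends continuously to the
   closed one. Values at xi < 0 are irrelevant. *)
Definition smooth_up_to_boundary (u : 'rV[R]_N * R -> R) : Prop :=
  exists D : seq (option 'I_N) -> 'rV[R]_N * R -> R,
    [/\ forall z, closed_half_space z -> D [::] z = u z,
        forall l, {within closed_half_space, continuous (D l)} &
        forall l k z, half_space z ->
          is_derive z (direction k) (D l) (D (k :: l) z)].

Definition periodic_half_space (u : 'rV[R]_N * R -> R) : Prop :=
  forall i x xi, 0 <= xi -> u (x + period i, xi) = u (x, xi).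

End geometry.

Section space.
Context {R : realType} {N : nat} (s m : R).
Implicit Types (u w : 'rV[R]_N * R -> R).
Implicit Types (G : option 'I_N -> 'rV[R]_N * R -> R).

(* The squared norm of the pair (function, gradient) = (w, G). *)
Definition energy w G : \bar R :=
  (\int[lebesgue_cyl]_(z in half_cylinder)
    (z.2 `^ (1 - 2 * s) *
      (\sum_k G k z ^+ 2 + m ^+ 2 * w z ^+ 2))%:E)%E.

Definition test_function u : Prop :=
  [/\ smooth_up_to_boundary u, periodic_half_space u &
      (energy u (gradient u) < +oo)%E].

Definition approximates (u_ : nat -> 'rV[R]_N * R -> R) w G : Prop :=
  (forall n, test_function (u_ n)) /\
  energy (fun z => u_ n z - w z) (fun k z => gradient (u_ n) k z - G k z)
    @[n --> \oo] --> 0%E.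

(* The completion of the test functions, realised as the closure of
   {(u, grad u)} in the weighted L^2 space of pairs (function, vector field)
   on the half-cylinder, into which it embeds isometrically (m != 0). An
   element of this type is a representative: two of them are the same point of
   the completion when they agree almost everywhere on the half-cylinder. *)
Record Xspace := {
  Xfun : 'rV[R]_N * R -> R ;
  Xgrad : option 'I_N -> 'rV[R]_N * R -> R ;
  Xfun_measurable :
    measurable_fun (half_cylinder : set ('rV[R]_N * measurableTypeR R)) Xfun ;
  Xgrad_measurable : forall k,
    measurable_fun (half_cylinder : set ('rV[R]_N * measurableTypeR R))
      (Xgrad k) ;
  X_approximable : exists u_ : nat -> 'rV[R]_N * R -> R,
    approximates u_ Xfun Xgrad
}.

(* [T] represents the trace of [v]: along every sequence of test functions
   converging to [v], the restrictions to xi = 0 converge to [T] in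
   L^{2^*_s}((-pi, pi)^N). *)
Definition is_trace (v : Xspace) (T : 'rV[R]_N -> R) : Prop :=
  measurable_fun open_cube T /\
  forall u_ : nat -> 'rV[R]_N * R -> R, approximates u_ (Xfun v) (Xgrad v) ->
    (\int[lebesgue_row N]_(x in open_cube)
      (`|u_ n (x, 0) - T x| `^ crit_exp N s)%:E)%E @[n --> \oo] --> 0%E.

(* A representative of the trace, which exists for 0 < s < 1, 2 s < N and
   m > 0 by the trace theorem and is unique up to a null set. *)
Definition Tr (v : Xspace) : 'rV[R]_N -> R := xget (cst 0) (is_trace v).

Definition weak_solution (W : 'rV[R]_N -> R) (f : 'rV[R]_N -> R -> R)
    (v : Xspace) : Prop :=
  forall phi : Xspace,
    \int[lebesgue_cyl]_(z in half_cylinder)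
      (z.2 `^ (1 - 2 * s) *
        (\sum_k Xgrad v k z * Xgrad phi k z
         + m ^+ 2 * Xfun v z * Xfun phi z)) =
    kappa s * \int[lebesgue_row N]_(x in open_cube)
      ((m `^ (2 * s) * Tr v x
        + W x * `|Tr v x| `^ (crit_exp N s - 2) * Tr v x
        + f x (Tr v x)) * Tr phi x).

End space.

(* The almost-everywhere class of [w] on the cube has a representative in
   C^{0,alpha}([-pi, pi]^N). *)
Definition holder_class {R : realType} {N : nat} (alpha : R)
    (w : 'rV[R]_N -> R) : Prop :=
  exists g : 'rV[R]_N -> R,
    (exists C : R, forall x y, closed_cube x -> closed_cube y ->
       `|g x - g y| <= C * enorm (x - y) `^ alpha) /\
    {ae lebesgue_row N, forall x, open_cube x -> w x = g x}.

(* Main.v *)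
(* Write T for the trace of v, p for the critical exponent and g(x) for the
   right-hand side evaluated at T. The test functions
   D*(D w |D w|^b), where D w(x) = w(x + h) - e w(x) and D* is its adjoint,
   inserted (after truncation) in the weak equation give, by the trace
   inequality and with a constant independent of h,
     int |D T|^((1 + b/2) p) <= K (int |D g| |D T|^(1 + b))^(p/2).
   For h = 0 and e = 0, i.e. D = id, this is the Brezis-Kato argument: T, hence
   g, belongs to every L^q. For e = 1 it improves a bound
   int |T(x + h) - T(x)|^q <= C |h|^a into one with a replaced by a sqrt(p/2)
   (and another q), because the increments of g are bounded in every L^q. The
   energy gives such a bound with q = 1 and a = s, so after finitely many steps
   a > N, and then averages over cubes of side r differ by O(r^((a - N)/q)):
   T is Hoelder continuous by Campanato's argument.

   The trace inequality itself comes for free: the trace of v exists only if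
   restriction to xi = 0 is continuous on test functions; and if v has no trace
   then Tr v is the default value 0. *)

Require Import Defs.
From mathcomp Require Import all_boot all_order all_algebra.
From mathcomp Require Import all_classical all_reals all_analysis.
From mathcomp Require Import measurable_realfun ring lra.
Import Order.TTheory GRing.Theory Num.Theory.
Import numFieldNormedType.Exports.

Set Implicit Arguments.
Unset Strict Implicit.
Unset Printing Implicit Defensive.

Local Open Scope classical_set_scope.
Local Open Scope ring_scope.

(** * Translation invariance of the integral over R^n and over a period *)

(** The equation has [v] itself on the left, while the chain rule and the truncated powers are
    available only for test functions. With the truncation parameter fixed, the map from [u] to the
    test function built from it is Lipschitz in L^p on the boundary and bounded in energy, so [v]
    can be traded for an approximating test function with an error that vanishes along the sequence.
    Bounds that blow up with the truncation enter only through this error; hence the final constant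
    does not see them, and Fatou's lemma removes the truncation afterwards.

    The factor th = sqrt(p/2) is a balance. The trace inequality raises the right-hand side to the
    power p/2 = th^2, while splitting int |D g| |D T|^(1 + q) with the exponents th and th/(th - 1)
    keeps only the power a/th of |h|; the product is a th.

    Hoelder's inequality is replaced throughout by Young's inequality with a free weight, chosen at
    the place of use. Passing to the adjoint of D requires integrals over a period to be translation
    invariant, which is why boundary data are extended periodically and why translation comes
    first. *)

Section line_translation.
Context {R : realType}.
Local Notation leb := (@lebesgue_measure R).
Local Notation sh a := (fun x : measurableTypeR R => (x : R) + a : measurableTypeR R).

Lemma measurable_shiftr (a : R) : measurable_fun [set: measurableTypeR R] (sh a).
Proof. by apply: measurable_funD => //; exact: measurable_cst. Qed.

Lemma lebesgue_measure_shift (a : R) (A : set R) : measurable A ->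
  pushforward leb (sh a) A = leb A.
Proof.
move=> mA; apply/esym; apply: (@lebesgue_measure_unique R) => //.
  exact: measurable_shiftr.
move=> ? _ [[b c]] _ <- /=; rewrite /pushforward.
rewrite (_ : _ @^-1` _ = `]b - a, c - a]%classic); last first.
  by apply/seteqP; split => x /=; rewrite !in_itv/= ltrBlDr lerBrDr.
rewrite !lebesgue_measure_itv/= !lte_fin ltrD2r; case: ifPn => // _.
by rewrite -!EFinB; congr (_%:E); ring.
Qed.

Lemma integral_shift (a : R) (D : set R) (f : R -> \bar R) : measurable D ->
  measurable_fun D f -> (forall x, D x -> (0 <= f x)%E) ->
  (\int[leb]_(x in (fun x => x + a)%R @^-1` D) f (x + a)%R = \int[leb]_(x in D) f x)%E.
Proof.
move=> mD mf f0.
rewrite -(@ge0_integral_pushforward _ _ _ _ _ _ (measurable_shiftr a) leb D f)//; last first.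
  by move=> y /set_mem; exact: f0.
apply: eq_measure_integral => [|A mA AS]; first exact: measurable_shiftr.
by move=> ?; exact: lebesgue_measure_shift.
Qed.

End line_translation.

Section rows.
Context {R : realType}.
Local Notation leb := (@lebesgue_measure R).

Lemma row_cons0 n (p : measurableTypeR R * 'rV[R]_n) : row_cons p ord0 ord0 = p.1.
Proof. by rewrite mxE unlift_none. Qed.

Lemma row_consS n (p : measurableTypeR R * 'rV[R]_n) j : row_cons p ord0 (lift ord0 j) = p.2 ord0 j.
Proof. by rewrite mxE liftK. Qed.

Lemma row_consD n (p q : measurableTypeR R * 'rV[R]_n) :
  row_cons p + row_cons q = row_cons ((p.1 : R) + (q.1 : R), p.2 + q.2).
Proof.
apply/rowP => i; rewrite !mxE; case: (unlift ord0 i) => [j|]//=.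
by rewrite mxE.
Qed.

Lemma row_unconsK n : cancel (@row_uncons R n) (@row_cons R n).
Proof.
move=> x; apply/rowP => i; rewrite mxE.
by case: unliftP => [j ->|->] //=; rewrite mxE.
Qed.

Lemma integral_lebesgue_rowS n (f : 'rV[R]_n.+1 -> \bar R) :
  measurable_fun [set: 'rV[R]_n.+1] f -> (forall x, (0 <= f x)%E) ->
  (\int[lebesgue_row n.+1]_x f x =
   \int[leb]_t \int[lebesgue_row n]_x f (row_cons (t, x)))%E.
Proof.
move=> mf f0.
(* By computation, [lebesgue_row n.+1] is the image of a product measure under [row_cons], so
   Tonelli applies after a change of variables. *)
rewrite (_ : (\int[lebesgue_row n.+1]_x f x)%E =
  (\int[pushforward (leb \x lebesgue_row n)%E (@row_cons R n)]_x f x)%E)//.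
rewrite (ge0_integral_pushforward (@measurable_row_cons R n))//.
rewrite preimage_setT fubini_tonelli1//; last by move=> z; exact: f0.
exact: (measurableT_comp mf (@measurable_row_cons R n)).
Qed.

Lemma measurable_addrow n (h : 'rV[R]_n) : measurable_fun [set: 'rV[R]_n] (fun x => x + h).
Proof.
apply: measurable_to_mx => i j; under eq_fun do rewrite mxE.
apply: measurable_funD; [exact: measurable_mx_coord|exact: measurable_cst].
Qed.

(** A power of one set of reals, so that the whole space, the period cell and the small cubes of the
    averaging argument share one induction on the dimension. *)
Definition box n (I : set R) : set 'rV[R]_n := [set x | forall i, I (x ord0 i)].

Lemma measurable_box n (I : set R) : measurable I -> measurable (@box n I).
Proof.
move=> mI; rewrite (_ : @box n I = \bigcap_(i in [set: 'I_n]) ((fun x : 'rV[R]_n => x ord0 i) @^-1` I)).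
  apply: fin_bigcap_measurable => // i _.
  by rewrite -[X in measurable X]setTI; apply: measurable_mx_coord.
by apply/seteqP; split => x /= H i; [move=> _|]; exact: H.
Qed.

Lemma row_cons_box n (I : set R) t (x : 'rV[R]_n) :
  @box n.+1 I (row_cons (t, x)) <-> I t /\ box I x.
Proof.
split=> [H|[It Ix] i].
  split; first by have := H ord0; rewrite row_cons0.
  by move=> i; have := H (lift ord0 i); rewrite row_consS.
by case: (unliftP ord0 i) => [j ->|->]; rewrite ?row_consS ?row_cons0.
Qed.

Lemma lebesgue_row_box n (I : set R) : measurable I ->
  lebesgue_row n (box I) = (leb I ^+ n)%E.
Proof.
move=> mI; elim: n => [|n IH].
  rewrite expe0 /= diracE mem_set//; by case.
rewrite [LHS]/= /leb_step (_ : _ @^-1` _ = I `*` @box n I); last first.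
  by apply/seteqP; split => [[t x]|[t x]] /= /row_cons_box.
rewrite product_measure1E//; last exact: measurable_box.
by rewrite IH expeS.
Qed.

Lemma integral_lebesgue_rowS_box n (I : set R) (f : 'rV[R]_n.+1 -> \bar R) : measurable I ->
  measurable_fun [set: 'rV[R]_n.+1] f -> (forall x, (0 <= f x)%E) ->
  (\int[lebesgue_row n.+1]_(x in box I) f x =
   \int[leb]_(t in I) \int[lebesgue_row n]_(x in box I) f (row_cons (t, x)))%E.
Proof.
move=> mI mf f0; have mB k := @measurable_box k _ mI.
rewrite integral_mkcond integral_lebesgue_rowS; last 2 first.
- apply: (iffLR (measurable_restrictT _ (mB n.+1))); exact: measurable_funTS mf.
- by move=> x; apply: erestrict_ge0.
rewrite [RHS]integral_mkcond; apply: eq_integral => t _.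
rewrite /patch; case: ifPn => [/set_mem It|/negP nIt].
  rewrite [RHS]integral_mkcond; apply: eq_integral => x _.
  rewrite /patch; case: ifPn => [/set_mem/row_cons_box[_ /mem_set ->]//|/negP nB].
  by case: ifPn => // /set_mem Ix; exfalso; apply: nB; apply/mem_set/row_cons_box.
apply: integral0_eq => x _; case: ifPn => // /set_mem/row_cons_box[/mem_set It].
by [].
Qed.

Lemma measurable_integral_row n (F : measurableTypeR R * 'rV[R]_n -> \bar R) :
  (forall z, (0 <= F z)%E) -> measurable_fun [set: measurableTypeR R * 'rV[R]_n] F ->
  measurable_fun [set: measurableTypeR R] (fun t => \int[lebesgue_row n]_x F (t, x))%E.
Proof.
move=> F0 mF.
have H := @measurable_fun_fubini_tonelli_F _ _ _ _ _ (lebesgue_row n) F mF F0.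
exact: H.
Qed.

(* [I] is the whole line, or one period when [f] is periodic. *)
Lemma integral_box_shift (I : set R) (per : R -> Prop) (J : set R) n (f : 'rV[R]_n -> \bar R) (h : 'rV[R]_n) :
  measurable I ->
  (forall (phi : measurableTypeR R -> \bar R) a, J a -> measurable_fun [set: measurableTypeR R] phi -> (forall t, (0 <= phi t)%E) ->
     (forall b (t : R), per b -> phi (t + b) = phi t) ->
     (\int[leb]_(t in I) phi ((t : R) + a)%R = \int[leb]_(t in I) phi t)%E) ->
  (forall i, J (h ord0 i)) ->
  measurable_fun [set: 'rV[R]_n] f -> (forall x, (0 <= f x)%E) ->
  (forall i b x, per b -> f (x + b *: delta_mx ord0 i) = f x) ->
  (\int[lebesgue_row n]_(x in box I) f (x + h)%R = \int[lebesgue_row n]_(x in box I) f x)%E.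
Proof.
move=> mI shift1; elim: n f h => [|n IH] f h Jh mf f0 perf.
  by apply: eq_integral => x _; congr f; rewrite [x + h]thinmx0 thinmx0.
have mB k := @measurable_box k _ mI.
have mfh := measurableT_comp mf (measurable_addrow h).
rewrite (integral_lebesgue_rowS_box mI mfh) 1?(integral_lebesgue_rowS_box mI mf f0); last by move=> x; exact: f0.
pose h0 := h ord0 ord0; pose h' := (row_uncons h).2.
have fE t x : f (row_cons (t, x) + h) = f (row_cons (t + h0 , x + h')).
  by congr f; rewrite -[h in LHS]row_unconsK row_consD.
have mrc t : measurable_fun [set: 'rV[R]_n] (fun x => f (row_cons (t, x))).
  apply: (measurableT_comp mf).
  exact: (measurableT_comp (@measurable_row_cons R n) (pair1_measurable _)).
have perS i b (t : R) (x : 'rV[R]_n) : row_cons (t, x) + b *: delta_mx ord0 (lift ord0 i) =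
    row_cons (t, x + b *: delta_mx ord0 i).
  apply/rowP => j; rewrite !mxE.
  case: unliftP => [k ->|->] /=; rewrite ?mxE ?eqxx/=.
    by rewrite (inj_eq lift_inj).
  by rewrite mulr0 addr0.
(* The trailing coordinates are translated first, by induction for each fixed head; the head then
   falls under the one-dimensional hypothesis, applied to the partial integral [phi]. *)
transitivity (\int[leb]_(t in I) \int[lebesgue_row n]_(x in box I) f (row_cons ((t + h0)%R, x)))%E.
  apply: eq_integral => t _.
  transitivity (\int[lebesgue_row n]_(x in box I) f (row_cons ((t + h0)%R, (x + h')%R)))%E.
    by apply: eq_integral => x _; rewrite /= fE.
  apply: (IH (fun x => f (row_cons (t + h0, x))) h') => //.
  - by move=> i; rewrite mxE.
  - by move=> i b x pb; rewrite -perS perf.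
pose phi (t : measurableTypeR R) := (\int[lebesgue_row n]_(x in box I) f (row_cons (t, x)))%E.
apply: (shift1 phi h0) => //; first exact: Jh.
- have mf2 : measurable_fun [set: measurableTypeR R * 'rV[R]_n]
     (fun z => (f \o @row_cons R n) z * (\1_(box I) z.2)%:E)%E.
    apply: emeasurable_funM.
      exact: (measurableT_comp mf (@measurable_row_cons R n)).
    apply/measurable_EFinP; apply: measurableT_comp => //; exact: measurable_indic (mB n).
  rewrite (_ : phi = fubini_F (lebesgue_row n) (fun z => (f \o @row_cons R n) z * (\1_(box I) z.2)%:E)%E).
    have f20 (z : measurableTypeR R * 'rV[R]_n) : (0 <= (f \o @row_cons R n) z * (\1_(box I) z.2)%:E)%E.
      by apply: mule_ge0; [exact: f0|rewrite lee_fin].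
    exact: measurable_integral_row f20 mf2.
  apply/funext => t; rewrite /fubini_F /phi [LHS]integral_mkcond; apply: eq_integral => x _ /=.
  by rewrite /patch indicE; case: ifPn => _; rewrite (mule1, mule0).
- by move=> t; apply: integral_ge0.
- move=> b t pb; apply: eq_integral => x _.
  rewrite -[RHS](perf ord0 b _ pb); congr f.
  apply/rowP => j; rewrite !mxE.
  case: unliftP => [k ->|->] /=; rewrite ?mxE ?eqxx/=.
    by rewrite mulr0 addr0.
  by rewrite mulr1.
Qed.

Lemma integral_row_shift n (f : 'rV[R]_n -> \bar R) (h : 'rV[R]_n) :
  measurable_fun [set: 'rV[R]_n] f -> (forall x, (0 <= f x)%E) ->
  (\int[lebesgue_row n]_x f (x + h)%R = \int[lebesgue_row n]_x f x)%E.
Proof.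
move=> mf f0.
rewrite (_ : [set: 'rV[R]_n] = box setT); last by apply/seteqP; split.
apply: (@integral_box_shift setT (fun _ => False) setT) => // phi a _ mphi phi0 _.
by have := @integral_shift R a setT phi measurableT mphi; rewrite preimage_setT; exact.
Qed.

(** For a shift b in [0, 2 pi] the moved window loses [-pi, -pi + b[ and gains [pi, pi + b[, which
    is the former moved by one period. A negative shift is undone by applying this to the translated
    function. *)
Lemma integral_period_shift (f : R -> \bar R) (a : R) :
  `|a| <= 2 * pi -> measurable_fun [set: R] f -> (forall t, (0 <= f t)%E) ->
  (forall t, f (t + 2 * pi) = f t) ->
  (\int[leb]_(t in `](- pi)%R, pi[) f (t + a)%R = \int[leb]_(t in `](- pi)%R, pi[) f t)%E.
Proof.
have pi0 := pi_gt0 R.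
have pos (g : R -> \bar R) b : 0 <= b <= 2 * pi -> measurable_fun [set: R] g -> (forall t, (0 <= g t)%E) ->
  (forall t, g (t + 2 * pi) = g t) ->
  (\int[leb]_(t in `](- pi)%R, pi[) g (t + b)%R = \int[leb]_(t in `](- pi)%R, pi[) g t)%E.
  move=> /andP[b0 b1] mg g0 perg.
  have mS D : measurable_fun D g by exact: measurable_funTS.
  rewrite (_ : `]- pi, pi[%classic = (fun x => x + b)%R @^-1` `]-pi + b, pi + b[%classic); last first.
    by apply/seteqP; split => x /=; rewrite !in_itv/= !ltrD2r.
  rewrite (@integral_shift _ b)//.
  rewrite (_ : _ @^-1` _ = `]-pi, pi[%classic); last first.
    by apply/seteqP; split => x /=; rewrite !in_itv/= !ltrD2r.
  rewrite -[LHS](@integral_itv_bndoo _ _ _ _ true true)//.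
  rewrite -[RHS](@integral_itv_bndoo _ _ _ _ true true)//.
  rewrite (_ : `[-pi + b, pi + b[%classic = `[-pi + b, pi[%classic `|` `[pi, pi + b[%classic); last first.
    apply/seteqP; split => x /=; rewrite !in_itv/=.
      by move=> /andP[-> ->]; rewrite andbT; case: ltP => ?; [left|right].
    by move=> [|] /andP[? ?]; apply/andP; split; lra.
  rewrite (_ : `[-pi, pi[%classic = `[-pi + b, pi[%classic `|` `[-pi, -pi + b[%classic); last first.
    apply/seteqP; split => x /=; rewrite !in_itv/=.
      by move=> /andP[-> ->]; rewrite andbT; case: ltP => ?; [right|left].
    by move=> [|] /andP[? ?]; apply/andP; split; lra.
  rewrite !ge0_integral_setU//; try by apply: mS.
  2,3: apply/disj_set2P; apply/seteqP; split => // x /= []; rewrite !in_itv/= => /andP[? ?] /andP[? ?]; lra.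

  congr (_ + _)%E.
  rewrite -(@integral_shift _ (2 * pi))//.
  rewrite (_ : _ @^-1` _ = `[-pi, -pi + b[%classic); last first.
    by apply/seteqP; split => x /=; rewrite !in_itv/= => /andP[? ?]; apply/andP; split; lra.
  by apply: eq_integral => t _; rewrite perg.
move=> aN mf f0 perf; case: (leP 0 a) => [a0|a0].
  by apply: pos => //; rewrite a0 (le_trans (ler_norm a)).
have -> : (\int[leb]_(t in `](- pi)%R, pi[) f t = \int[leb]_(t in `](- pi)%R, pi[) f ((t - a) + a)%R)%E.
  by apply: eq_integral => t _; rewrite subrK.
symmetry; apply: (pos (fun t => f (t + a)%R)) => //.
- by rewrite oppr_ge0 ltW//= -ltr0_norm.
- exact: (measurableT_comp mf (measurable_shiftr a)).
- by move=> t; rewrite addrAC perf.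
Qed.

Lemma open_cubeE n : @open_cube R n = box `]- pi, pi[%classic.
Proof. by apply/seteqP; split => x H i; have := H i; rewrite /= in_itv. Qed.

Lemma measurable_open_cube n : measurable (@open_cube R n).
Proof. by rewrite open_cubeE; exact: measurable_box. Qed.

Lemma lebesgue_row_open_cube n : lebesgue_row n (@open_cube R n) = ((2 * pi) ^+ n)%:E.
Proof.
rewrite open_cubeE lebesgue_row_box// lebesgue_measure_itv/= lte_fin.
have pi0 := pi_gt0 R.
rewrite ifT; last by lra.
by rewrite -EFinD -EFin_expe; congr (_ ^+ _)%:E; ring.
Qed.

Lemma integral_cube_shift n (f : 'rV[R]_n -> \bar R) (h : 'rV[R]_n) :
  (forall i, `|h ord0 i| <= 2 * pi) ->
  measurable_fun [set: 'rV[R]_n] f -> (forall x, (0 <= f x)%E) ->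
  (forall i x, f (x + period i) = f x) ->
  (\int[lebesgue_row n]_(x in open_cube) f (x + h)%R = \int[lebesgue_row n]_(x in open_cube) f x)%E.
Proof.
move=> hb mf f0 perf; rewrite open_cubeE.
apply: (@integral_box_shift _ (fun b => b = 2 * pi) [set a | `|a| <= 2 * pi]) => //.
  move=> phi a Ja mphi phi0 perphi; apply: integral_period_shift => // t.
  exact: perphi.
by move=> i b x ->; exact: perf.
Qed.

(** The sigma-algebra on rows is generated by coordinates and that of the product by rectangles, so
    an open set must be written as a countable union: the boxes with rational centres and radius
    1/(k + 1) contained in [U] exhaust it. *)
Lemma open_measurable_row_line n (U : set ('rV[R]_n * R)) : open U ->
  measurable (U : set ('rV[R]_n * measurableTypeR R)).
Proof.
move=> oU.
pose Q (q : {ffun 'I_n -> rat} * rat * nat) : set ('rV[R]_n * measurableTypeR R) :=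
  (\bigcap_(i in [set: 'I_n]) ((fun x : 'rV[R]_n => x ord0 i) @^-1` ball (ratr (q.1.1 i) : R) (q.2.+1%:R)^-1))
    `*` (ball (ratr q.1.2 : R) (q.2.+1%:R)^-1 : set (measurableTypeR R)).
have mQ q : measurable (Q q).
  apply: measurableX; last exact: measurable_ball.
  apply: fin_bigcap_measurable => // i _.
  rewrite -[X in measurable X]setTI.
  by apply: (@measurable_mx_coord R 1 n ord0 i) => //; exact: measurable_ball.
rewrite (_ : U = \bigcup_q (if `[< Q q `<=` U >] then Q q else set0)); last first.
  apply/seteqP; split; last by move=> z [q _]; case: asboolP => // qU /qU.
  move=> [x t] Uxt; have /nbhs_ballP[e /= e0 eU] : nbhs (x, t) U by exact: open_nbhs_nbhs.
  have e20 : 0 < e / 2 by rewrite divr_gt0.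
  have [k _ /(_ k (leqnn k)) /= ke] := near_infty_natSinv_lt (PosNum e20).
  have rat1 (y : R) : exists q : rat, ball (ratr q : R) (k.+1%:R)^-1 y.
    have : y - (k.+1%:R)^-1 < y + (k.+1%:R)^-1.
      by rewrite ltrD2l gtrN// invr_gt0.
    move=> /rat_in_itvoo[q]; rewrite in_itv/= => /andP[q1 q2]; exists q.
    by rewrite /ball/= ltr_distl q1 q2.
  have near2 (a b c : R) : ball a (k.+1%:R)^-1 b -> ball a (k.+1%:R)^-1 c -> ball b e c.
    rewrite /ball/= => ab ac; rewrite (splitr e).
    apply: le_lt_trans (ler_distD a b c) _.
    by apply: ltrD; [rewrite distrC|]; [exact: lt_trans ab ke|exact: lt_trans ac ke].
  have /choice[qx qxP] := fun i => rat1 (x ord0 i).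
  have [qt qtP] := rat1 t.
  exists ([ffun i => qx i], qt, k) => //; case: asboolP => [_|].
    by split => //= i _ /=; rewrite ffunE.
  case => -[y u] [/= yP uP]; apply: eU; split => /=.
    split=> // i j; rewrite ord1; have := yP j Logic.I; rewrite ffunE /= => yj.
    exact: near2 (qxP j) yj.
  exact: near2 qtP uP.
apply: countable_bigcupT_measurable; first exact: countableP.
by move=> q; case: asboolP.
Qed.

Lemma open_continuous_measurable_row_line n (U : set ('rV[R]_n * R)) (f : 'rV[R]_n * R -> R) :
  open U -> {in U, continuous f} ->
  measurable_fun (U : set ('rV[R]_n * measurableTypeR R)) f.
Proof.
move=> oU cf mU; apply: (measurability _ (RGenOpens.measurableE R)) => // _ [_ [a [b ->] <-]].
apply: open_measurable_row_line.
rewrite openE => z [Uz fz].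
apply: filterI; first exact: open_nbhs_nbhs.
by apply: (cf z (mem_set Uz)); apply: open_nbhs_nbhs; split => //; exact: interval_open.
Qed.

(** The function is lifted to the product with a line, where continuity already gives measurability,
    and recovered by freezing the extra coordinate. *)
Lemma continuous_measurable_row n (f : 'rV[R]_n -> R) : continuous f -> measurable_fun [set: 'rV[R]_n] f.
Proof.
move=> cf.
have : measurable_fun ([set: 'rV[R]_n * measurableTypeR R]) (f \o fst).
  apply: open_continuous_measurable_row_line; first exact: openT.
  move=> z _; apply: continuous_comp; [exact: cvg_fst|exact: cf].
move=> H.
exact: (measurableT_comp H (pair2_measurable (0 : measurableTypeR R))).
Qed.

End rows.

(** * Truncated powers and the algebra of smooth functions *)

Section directional.
Context {R : realType} {V : normedModType R}.

(** Reduces directional derivatives to one variable, where the chain rule lives; translating a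
    function then changes nothing but the name of a function of [t]. *)
Lemma is_derive_lineP (f : V -> R) (x v : V) (l : R) :
  is_derive x v f l <-> is_derive (0 : R) 1 (fun t => f (t *: v + x)) l.
Proof.
have E : (fun h : R => h^-1 *: ((f \o shift x) (h *: v) - f x)) =
    (fun h : R => h^-1 *: (((fun t : R => f (t *: v + x)) \o shift 0) (h *: 1) - (fun t : R => f (t *: v + x)) 0)).
  apply/funext => h /=; rewrite addr0 scale0r add0r.
  by rewrite [h *: 1]mulr1.
split=> -[d1 d2]; split.
- by move: d1; rewrite /derivable E.
- by rewrite -d2 /derive E.
- by move: d1; rewrite /derivable E.
- by rewrite -d2 /derive E.
Qed.

Lemma is_derive_comp1 (f : R -> R) (g : V -> R) (x v : V) (a b : R) :
  is_derive (g x) 1 f a -> is_derive x v g b -> is_derive x v (f \o g) (a * b).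
Proof.
move=> df /is_derive_lineP dg; apply/is_derive_lineP.
apply: (@is_derive1_comp _ f (fun t => g (t *: v + x)) 0 a b) => //.
by rewrite scale0r add0r.
Qed.

End directional.

Section power_profile.
Context {R : realType}.
Implicit Types b e g t : R.

(* [tprof e g] is a smooth truncation of [t |t|^(2 g)] with bounded derivative;
   being made of powers of positive quantities, it maps test functions to test
   functions. *)
Definition prof e g t : R := (e + 1 * t ^+ 2) `^ g * (1 + e * t ^+ 2) `^ (- g).

Definition tprof e g t : R := t * prof e g t.

(** The quotient [t * prof' / prof] is [2 * g] times the fraction named [pfrac] below, which lies in
    [0, 1] for [e <= 1]; all bounds on the derivative come from that. *)
Definition dprof e g t : R :=
  prof e g t * (1 + 2 * g * (t ^+ 2 * (1 - e * e) / ((e + t ^+ 2) * (1 + e * t ^+ 2)))).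

Lemma powR_subr1 (x g : R) : 0 < x -> x `^ (g - 1) = x `^ g / x.
Proof.
move=> x0; rewrite powRB ?powRr1 ?ltW//.
by apply/implyP => _; rewrite gt_eqF.
Qed.

Lemma is_derive_affsq (c e t : R) : is_derive t 1 (fun t => c + e * t ^+ 2) (2 * e * t).
Proof.
apply: is_derive_eq.
rewrite /GRing.scale/= !(expr1, mulr1, scaler0, addr0, add0r); ring.
Qed.

Lemma is_derive_powaff (c e g t : R) : 0 < c + e * t ^+ 2 ->
  is_derive t 1 (fun t => (c + e * t ^+ 2) `^ g) (g * (c + e * t ^+ 2) `^ (g - 1) * (2 * e * t)).
Proof.
move=> c0; apply: (@is_derive1_comp _ (fun y => y `^ g) (fun t => c + e * t ^+ 2)).
  exact: is_derive1_powR.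
exact: is_derive_affsq.
Qed.

Lemma is_derive_tprof e g t : 0 < e -> is_derive t 1 (tprof e g) (dprof e g t).
Proof.
move=> e0.
have p1 : 0 < e + 1 * t ^+ 2 by rewrite ltr_wpDr// mulr_ge0// sqr_ge0.
have p2 : 0 < 1 + e * t ^+ 2 by rewrite ltr_wpDr// mulr_ge0 ?sqr_ge0// ltW.
have d1 := is_derive_powaff g p1.
have d2 := is_derive_powaff (- g) p2.
have d3 := is_deriveM d1 d2.
have d4 := is_deriveM (is_derive_id t (1 : R)) d3.
apply: (@is_derive_eq _ _ _ _ _ _ _ _ d4).
rewrite /dprof /prof /GRing.scale/=.
rewrite (powR_subr1 g p1) (powR_subr1 (- g) p2).
rewrite -![((fun t => _) * (fun t => _)) t]/(_ * _) mul1r; rewrite mul1r in p1.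
by field; rewrite !gt_eqF.
Qed.

Lemma prof_gt0 e g t : 0 < e -> 0 < prof e g t.
Proof.
move=> e0; apply: mulr_gt0; apply: powR_gt0.
  by rewrite ltr_wpDr// mulr_ge0// sqr_ge0.
by rewrite ltr_wpDr// mulr_ge0 ?sqr_ge0// ltW.
Qed.

Lemma profE e g t : 0 < e -> prof e g t = ((e + t ^+ 2) / (1 + e * t ^+ 2)) `^ g.
Proof.
move=> e0; have p1 : 0 < e + t ^+ 2 by rewrite ltr_wpDr// sqr_ge0.
have p2 : 0 < 1 + e * t ^+ 2 by rewrite ltr_wpDr// mulr_ge0 ?sqr_ge0// ltW.
by rewrite /prof mul1r powRM ?invr_ge0 ?ltW// -powR_inv1 ?ltW// -powRrM mulN1r.
Qed.

Lemma prof_double e g t : 0 < e -> prof e (2 * g) t = prof e g t ^+ 2.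
Proof.
by move=> e0; rewrite !profE// [2 * g]mulrC powRrM (@powR_mulrn _ _ 2) ?powR_ge0.
Qed.

(** This bound degenerates as [e] tends to 0 and serves only while [e] is fixed; [prof_ub1] and
    [prof_ub2] are the bounds that survive the limit. *)
Lemma prof_ub e g t : 0 < e <= 1 -> 0 <= g -> prof e g t <= e^-1 `^ g.
Proof.
move=> /andP[e0 e1] g0.
have p2 : 0 < 1 + e * t ^+ 2 by rewrite ltr_wpDr// mulr_ge0 ?sqr_ge0// ltW.
rewrite profE// ge0_ler_powR// ?nnegrE ?invr_ge0 ?(ltW e0)//.
  by rewrite divr_ge0 ?ltW// ltr_wpDr// sqr_ge0.
rewrite ler_pdivrMr// mulrC ler_pdivlMr//.
have := sqr_ge0 t; nra.
Qed.

Lemma prof_ub1 e g t : 0 < e <= 1 -> 0 <= g -> prof e g t <= (1 + t ^+ 2) `^ g.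
Proof.
move=> /andP[e0 e1] g0.
have t0 := sqr_ge0 t.
have p2 : 0 < 1 + e * t ^+ 2 by rewrite ltr_wpDr// mulr_ge0 ?sqr_ge0// ltW.
rewrite profE// ge0_ler_powR// ?nnegrE.
- by rewrite divr_ge0 ?ltW// ltr_wpDr// sqr_ge0.
- by rewrite addr_ge0.
rewrite ler_pdivrMr//.
have eT : 0 <= e * t ^+ 2 by rewrite mulr_ge0// ltW.
have eTT : 0 <= e * t ^+ 2 * t ^+ 2 by rewrite mulr_ge0.
rewrite mulrDl mul1r mulrDr mulr1; lra.
Qed.

Definition pfrac e t : R := t ^+ 2 * (1 - e * e) / ((e + t ^+ 2) * (1 + e * t ^+ 2)).

Lemma pfrac01 e t : 0 < e <= 1 -> 0 <= pfrac e t <= 1.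
Proof.
move=> /andP[e0 e1]; have t0 := sqr_ge0 t.
have p1 : 0 < e + t ^+ 2 by rewrite ltr_wpDr// sqr_ge0.
have p2 : 0 < 1 + e * t ^+ 2 by rewrite ltr_wpDr// mulr_ge0 ?sqr_ge0// ltW.
have e2 : e * e <= 1 by rewrite mulr_ile1// ltW.
have e20 : 0 <= e * e by rewrite mulr_ge0 ?ltW.
apply/andP; split.
  apply: divr_ge0; apply: mulr_ge0; rewrite ?subr_ge0 ?(ltW p1) ?(ltW p2)//.
rewrite /pfrac ler_pdivrMr ?mulr_gt0// mul1r.
have eT : 0 <= e * (t ^+ 2 * t ^+ 2) by apply: mulr_ge0; [exact: ltW|exact: mulr_ge0].
have eeT : 0 <= e * e * t ^+ 2 by rewrite mulr_ge0.
rewrite mulrDr mulr1 mulrDl mulrDr mulr1; lra.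
Qed.

Lemma dprof_ge0 e g t : 0 < e <= 1 -> 0 <= g -> 0 <= dprof e g t.
Proof.
move=> e01 g0; have /andP[f0 f1] := pfrac01 t e01; have /andP[e0 e1] := e01.
rewrite /dprof -/(pfrac e t) mulr_ge0 ?(ltW (prof_gt0 _ _ e0))//.
by have : 0 <= g * pfrac e t; [rewrite mulr_ge0|lra].
Qed.

Lemma dprof_ub e g t : 0 < e <= 1 -> 0 <= g -> dprof e g t <= e^-1 `^ g * (1 + 2 * g).
Proof.
move=> e01 g0; have /andP[f0 f1] := pfrac01 t e01; have /andP[e0 e1] := e01.
have gf : 0 <= g * pfrac e t by rewrite mulr_ge0.
have gf1 : g * pfrac e t <= g by rewrite ler_piMr.
rewrite /dprof -/(pfrac e t); apply: ler_pM; [exact: ltW (prof_gt0 _ _ e0)|lra|exact: prof_ub|lra].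
Qed.

(** The pointwise reason why testing with the power [b] controls the gradient of the power [b / 2].
    Since [prof e b] is the square of [prof e (b / 2)], what remains is (1 + b f)^2 <= (1 + b)(1 + 2
    b f) for [f] in [0, 1]. *)
Lemma dprof_sqr e b t : 0 < e <= 1 -> 0 <= b ->
  dprof e (b / 2) t ^+ 2 <= (1 + b) * dprof e b t.
Proof.
move=> e01 b0; have /andP[f0 f1] := pfrac01 t e01; have /andP[e0 e1] := e01.
have b2 : 2 * (b / 2) = b by field.
rewrite /dprof -!/(pfrac e t) exprMn -prof_double// b2.
rewrite [X in _ <= X]mulrCA; apply: ler_wpM2l; first exact: ltW (prof_gt0 _ _ e0).
set f := pfrac e t in f0 f1 *.
have F1 : 0 <= b * b * f by apply: mulr_ge0 => //; exact: mulr_ge0.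
have F2 : b * b * (f * f) <= b * b * f by apply: ler_wpM2l; rewrite ?mulr_ge0// ler_piMr.
rewrite expr2; lra.
Qed.

Lemma tprof_lip e g (x y : R) : 0 < e <= 1 -> 0 <= g ->
  `|tprof e g x - tprof e g y| <= e^-1 `^ g * (1 + 2 * g) * `|x - y|.
Proof.
move=> e01 g0; have /andP[e0 e1] := e01.
wlog xy : x y / y <= x.
  by move=> H; case: (leP y x) => xy; [exact: H|rewrite distrC [X in _ <= _ * X]distrC; apply: H; exact: ltW].
have cts : {within `[y, x], continuous (tprof e g)}.
  apply: continuous_subspaceT => z; apply: differentiable_continuous.
  apply/derivable1_diffP; exact: (@ex_derive _ _ _ _ _ _ _ (is_derive_tprof g z e0)).
have [c _ ->] := MVT_segment xy (fun z _ => is_derive_tprof g z e0) cts.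
by rewrite normrM ler_wpM2r// ger0_norm ?dprof_ge0// dprof_ub.
Qed.

Lemma tprof0 e g : tprof e g 0 = 0. Proof. by rewrite /tprof mul0r. Qed.

Lemma tprof_bound e g t : 0 < e <= 1 -> 0 <= g -> `|tprof e g t| <= e^-1 `^ g * `|t|.
Proof.
move=> e01 g0; have /andP[e0 e1] := e01.
rewrite /tprof normrM mulrC ler_wpM2r// ger0_norm ?(ltW (prof_gt0 _ _ e0))//.
exact: prof_ub.
Qed.

Lemma tprof_sqr e b t : 0 < e -> tprof e (b / 2) t ^+ 2 = t * tprof e b t.
Proof.
move=> e0; have b2 : 2 * (b / 2) = b by field.
rewrite /tprof exprMn -prof_double// b2.
by rewrite mulrA expr2.
Qed.

(** For [t != 0] both bases have positive limits, where powers are continuous; at [t = 0] the factor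
    [t] of [tprof] will settle the limit. *)
Lemma cvg_prof g (t : R) : t != 0 -> 0 <= g ->
  prof (n.+1%:R^-1) g t @[n --> \oo] --> `|t| `^ (2 * g).
Proof.
move=> t0 g0.
have t2 : 0 < t ^+ 2 by rewrite exprn_even_gt0.
rewrite (_ : (fun n => _) = (fun n => (n.+1%:R^-1 + 1 * t ^+ 2) `^ g * (1 + n.+1%:R^-1 * t ^+ 2) `^ (- g)))//.
rewrite (_ : `|t| `^ (2 * g) = (0 + 1 * t ^+ 2) `^ g * (1 + 0 * t ^+ 2) `^ (- g)); last first.
  rewrite mul0r addr0 powR1 mulr1 add0r mul1r powRrM (@powR_mulrn _ _ 2)//.
  by rewrite real_normK// num_real.
have inv0 : (fun n : nat => n.+1%:R^-1 : R) @ \oo --> (0 : R).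
  exact: cvg_harmonic.
have ctspow (y c : R) : 0 < y -> {for y, continuous (fun y => y `^ c)}.
  move=> y0; apply: differentiable_continuous; apply/derivable1_diffP.
  by apply: ex_derive; exact: is_derive1_powR.
have c1 : (n.+1%:R^-1 + 1 * t ^+ 2) @[n --> \oo] --> 0 + 1 * t ^+ 2.
  by apply: cvgD => //; exact: cvg_cst.
have c2 : (1 + n.+1%:R^-1 * t ^+ 2) @[n --> \oo] --> 1 + 0 * t ^+ 2.
  by apply: cvgD; [exact: cvg_cst|apply: cvgM => //; exact: cvg_cst].
apply: cvgM.
  have p1 : 0 < 0 + 1 * t ^+ 2 by rewrite add0r mul1r.
  exact: (cvg_comp _ _ c1 (ctspow _ g p1)).
have p2 : 0 < 1 + 0 * t ^+ 2 by rewrite mul0r addr0.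
exact: (cvg_comp _ _ c2 (ctspow _ (- g) p2)).
Qed.

End power_profile.

Section smooth_algebra.
Context {R : realType} {N : nat}.
Local Notation E := ('rV[R]_N * R)%type.
Local Notation Hc := (@closed_half_space R N).
Local Notation Ho := (@half_space R N).
Implicit Types (u w : E -> R) (z : E) (k : option 'I_N).

(* Closed under composition with the profiles above and under
   differentiation; this is what makes truncated powers of test functions
   test functions again. *)
Inductive smooth_alg : (E -> R) -> Prop :=
| sa_base u of smooth_up_to_boundary u : smooth_alg u
| sa_cst c : smooth_alg (cst c)
| sa_add u w of smooth_alg u & smooth_alg w : smooth_alg (fun z => u z + w z)
| sa_mul u w of smooth_alg u & smooth_alg w : smooth_alg (fun z => u z * w z)
| sa_pow c e g u of 0 < c & 0 <= e & smooth_alg u :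
    smooth_alg (fun z => (c + e * u z ^+ 2) `^ g).

Lemma open_half_space : open Ho.
Proof.
rewrite (_ : Ho = snd @^-1` [set t : R | 0 < t])//.
by apply: open_comp; [move=> z _; exact: cvg_snd|exact: open_gt].
Qed.

Lemma half_space_closed z : Ho z -> Hc z.
Proof. exact: ltW. Qed.

Lemma smooth_alg_cont u : smooth_alg u -> {within Hc, continuous u}.
Proof.
elim=> {u} [u [D [D0 Dc _]]|c|u w _ cu _ cw|u w _ cu _ cw|c e g u c0 e0 _ cu].
- have E : {in Hc, D [::] =1 u} by move=> z /set_mem; exact: D0.
  exact: (subspace_eq_continuous E (Dc [::])).
- by apply/subspace_continuousP => z Hz; exact: cvg_cst.
- apply/subspace_continuousP => z Hz.
  by apply: cvgD; [move/subspace_continuousP : cu; exact|move/subspace_continuousP : cw; exact].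
- apply/subspace_continuousP => z Hz.
  by apply: cvgM; [move/subspace_continuousP : cu; exact|move/subspace_continuousP : cw; exact].
- apply/subspace_continuousP => z Hz.
  have p0 : 0 < c + e * u z ^+ 2 by rewrite ltr_wpDr// mulr_ge0// sqr_ge0.
  have cz : {for u z, continuous (fun t : R => (c + e * t ^+ 2) `^ g)}.
    apply: differentiable_continuous; apply/derivable1_diffP.
    by apply: ex_derive; exact: is_derive_powaff.
  by move/subspace_continuousP : cu => /(_ z Hz) H; exact: (cvg_comp _ _ H cz).
Qed.

(** The derivative family of the [k]-th derivative is that of [u] with [k] appended at the end of
    the word, the derivative taken first. *)
Lemma smooth_base_deriv u : smooth_up_to_boundary u -> forall k, exists w,
  smooth_up_to_boundary w /\ forall z, Ho z -> is_derive z (direction k) u (w z).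
Proof.
move=> [D [D0 Dc Dd]] k; exists (D [:: k]); split.
  exists (fun l => D (l ++ [:: k])); split => //.
  by move=> l j z Hz; exact: Dd.
move=> z Hz; apply: (near_eq_is_derive (f := D [::])); last exact: Dd.
  near=> y; apply: D0; apply: half_space_closed; near: y.
  by apply: open_nbhs_nbhs; split => //; exact: open_half_space.
Unshelve. all: by end_near. Qed.

Lemma smooth_alg_deriv u : smooth_alg u -> forall k, exists w,
  smooth_alg w /\ forall z, Ho z -> is_derive z (direction k) u (w z).
Proof.
elim=> {u} [u su|c|u w su IHu sw IHw|u w su IHu sw IHw|c e g u c0 e0 su IHu] k.
- by have [w [sw dw]] := smooth_base_deriv su k; exists w; split => //; exact: sa_base.
- exists (cst 0); split; first exact: sa_cst.
  by move=> z _; exact: is_derive_cst.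
- have [u' [su' du]] := IHu k; have [w' [sw' dw]] := IHw k.
  exists (fun z => u' z + w' z); split; first exact: sa_add.
  by move=> z Hz; apply: is_deriveD; [exact: du|exact: dw].
- have [u' [su' du]] := IHu k; have [w' [sw' dw]] := IHw k.
  exists (fun z => u z * w' z + w z * u' z); split.
    by apply: sa_add; apply: sa_mul.
  by move=> z Hz; apply: is_deriveM; [exact: du|exact: dw].
- have [u' [su' du]] := IHu k.
  exists (fun z => g * (c + e * u z ^+ 2) `^ (g - 1) * (2 * e * u z) * u' z); split.
    apply: sa_mul => //; apply: sa_mul; last first.
      by apply: sa_mul => //; exact: sa_cst.
    by apply: sa_mul; [exact: sa_cst|exact: sa_pow].
  move=> z Hz; apply: (is_derive_comp1 (f := fun t => (c + e * t ^+ 2) `^ g)); last exact: du.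
  by apply: is_derive_powaff; rewrite ltr_wpDr// mulr_ge0// sqr_ge0.
Qed.

(** Smoothness asks for all iterated derivatives at once. The algebra being closed under one
    derivative in each direction, a choice function [d] picks one for every element, and folding [d]
    along a word gives the family; its members stay in the algebra and are therefore continuous up
    to the boundary. *)
Lemma smooth_alg_smooth u : smooth_alg u -> smooth_up_to_boundary u.
Proof.
move=> su.
have : forall p : option 'I_N * (E -> R), exists w, smooth_alg p.2 ->
    smooth_alg w /\ forall z, Ho z -> is_derive z (direction p.1) p.2 (w z).
  move=> [k w]; case: (pselect (smooth_alg w)) => [sw|nsw]; last by exists (cst 0).
  by have [w' H] := smooth_alg_deriv sw k; exists w'.
move=> /choice[d dP].
pose D (l : seq (option 'I_N)) : E -> R := foldr (fun k w => d (k, w)) u l.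
have DS l : smooth_alg (D l).
  by elim: l => //= k l IH; have [] := dP (k, D l) IH.
exists D; split => //.
- by move=> l; apply: smooth_alg_cont.
- by move=> l k z Hz; have [_] := dP (k, D l) (DS l); exact.
Qed.

Lemma smooth_add u w : smooth_up_to_boundary u -> smooth_up_to_boundary w ->
  smooth_up_to_boundary (fun z => u z + w z).
Proof. by move=> su sw; apply/smooth_alg_smooth/sa_add; exact: sa_base. Qed.

Lemma smooth_scale c u : smooth_up_to_boundary u -> smooth_up_to_boundary (fun z => c * u z).
Proof. by move=> su; apply/smooth_alg_smooth/(@sa_mul (cst c)); [exact: sa_cst|exact: sa_base]. Qed.

Lemma smooth_tprof e g u : 0 < e -> smooth_up_to_boundary u ->
  smooth_up_to_boundary (fun z => tprof e g (u z)).
Proof.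
move=> e0 su; apply: smooth_alg_smooth; apply: sa_mul; first exact: sa_base.
by apply: sa_mul; apply: sa_pow => //; rewrite ?ltW//; exact: sa_base.
Qed.

Lemma smooth_translate (h : 'rV[R]_N) u : smooth_up_to_boundary u ->
  smooth_up_to_boundary (fun z => u (z.1 + h, z.2)).
Proof.
move=> [D [D0 Dc Dd]]; exists (fun l z => D l (z.1 + h, z.2)); split.
- by move=> z Hz; rewrite D0.
- move=> l; apply/subspace_continuousP => z Hz.
  have /subspace_continuousP/(_ (z.1 + h, z.2) Hz) H := Dc l.
  have ct : (fun y : E => (y.1 + h, y.2)) @ z --> (z.1 + h, z.2).
    apply: (@cvg_pair _ _ _ _ (nbhs (z.1 + h)) (nbhs z.2)); last exact: cvg_snd.
    by apply: cvgD; [exact: cvg_fst|exact: cvg_cst].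
  apply: (cvg_comp _ _ _ H) => P nP.
  exact: (ct (fun y => Hc y -> P y) nP).
- move=> l k z Hz; apply/is_derive_lineP.
  have /is_derive_lineP := Dd l k (z.1 + h, z.2) Hz.
  congr (is_derive _ _ _ _); apply/funext => t; congr (D l _).
  by case: k => [i|]; apply: injective_projections => //; exact: addrA.
Qed.

Lemma smooth_cont u : smooth_up_to_boundary u -> {within Hc, continuous u}.
Proof. by move/sa_base/smooth_alg_cont. Qed.

Lemma smooth_grad u k z : smooth_up_to_boundary u -> Ho z ->
  is_derive z (direction k) u (gradient u k z).
Proof.
move=> /smooth_base_deriv/(_ k)[w [_ dw]] Hz; have := dw z Hz.
by move=> d; apply: DeriveDef => //; exact: (@ex_derive _ _ _ _ _ _ _ d).
Qed.

Lemma gradient_translate (h : 'rV[R]_N) u k z : smooth_up_to_boundary u -> Ho z ->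
  gradient (fun z => u (z.1 + h, z.2)) k z = gradient u k (z.1 + h, z.2).
Proof.
move=> su Hz; have /is_derive_lineP H := smooth_grad k su (Hz : Ho (z.1 + h, z.2)).
apply: (@derive_val _ _ _ _ _ _ _ _); apply/is_derive_lineP; move: H.
congr (is_derive _ _ _ _); apply/funext => t; congr (u _).
by case: k => [i|]; apply: injective_projections => //; exact: addrA.
Qed.

Lemma smooth_grad_smooth u k : smooth_up_to_boundary u ->
  exists2 w, smooth_up_to_boundary w & forall z, Ho z -> gradient u k z = w z.
Proof.
move=> /smooth_base_deriv/(_ k)[w [sw dw]]; exists w => // z Hz.
exact: (@derive_val _ _ _ _ _ _ _ (dw z Hz)).
Qed.

Lemma within_half_continuous u : {within Hc, continuous u} -> {in Ho, continuous u}.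
Proof.
move=> /subspace_continuousP cu z /set_mem Hz.
have := cu z (half_space_closed Hz).
rewrite within_interior//; apply: (@filterS _ (nbhs z) _ Ho); first exact: half_space_closed.
by apply: open_nbhs_nbhs; split => //; exact: open_half_space.
Qed.

Local Notation Em := ('rV[R]_N * measurableTypeR R)%type.

Lemma measurable_half_cylinder : measurable (@half_cylinder R N : set Em).
Proof.
rewrite (_ : half_cylinder = open_cube `*` [set t : measurableTypeR R | 0 < (t : R)]).
  apply: measurableX; first exact: measurable_open_cube.
  rewrite (_ : [set _ | _] = `]0, +oo[%classic)//.
  by apply/seteqP; split => t /=; rewrite in_itv/= andbT.
by apply/seteqP; split.
Qed.

Lemma smooth_measurable u : smooth_up_to_boundary u ->
  measurable_fun (Ho : set Em) u.
Proof.
move=> /smooth_cont/within_half_continuous cu.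
apply: open_continuous_measurable_row_line => //; exact: open_half_space.
Qed.

Lemma smooth_gradient_measurable u k : smooth_up_to_boundary u ->
  measurable_fun (Ho : set Em) (gradient u k).
Proof.
move=> /(smooth_grad_smooth k)[w sw gw].
apply: (eq_measurable_fun w); last exact: smooth_measurable.
by move=> z /set_mem Hz; rewrite gw.
Qed.

Lemma smooth_boundary_continuous u : smooth_up_to_boundary u -> continuous (fun x => u (x, 0)).
Proof.
move=> /smooth_cont/subspace_continuousP cu x.
have H := cu (x, 0) (lexx 0).
have ct : (fun y : 'rV[R]_N => (y, 0 : R)) @ x --> ((x, 0) : E).
  have c1 : (fun y : 'rV[R]_N => y) @ nbhs (x : 'rV[R]_N) --> nbhs (x : 'rV[R]_N) by exact: cvg_id.
  have c2 : (fun _ : 'rV[R]_N => 0 : R) @ nbhs (x : 'rV[R]_N) --> nbhs (0 : R) by exact: cvg_cst.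
  exact: (cvg_pair c1 c2).
apply: (cvg_comp _ _ _ H) => P nP.
have := ct (fun y => Hc y -> P y) nP.
apply: (@filterS _ (nbhs (x : 'rV[R]_N)) (@nbhs_filter 'rV[R]_N x)) => y /=; apply; exact: lexx.
Qed.

Lemma smooth_line_continuous u x : smooth_up_to_boundary u ->
  {within [set t : R | 0 <= t], continuous (fun t => u (x, t))}.
Proof.
move=> /smooth_cont/subspace_continuousP cu; apply/subspace_continuousP => t t0.
have H := cu (x, t) t0.
have ct : (fun y : R => (x, y)) @ t --> ((x, t) : E).
  by apply: (@cvg_pair _ _ _ _ (nbhs x) (nbhs t)); [exact: cvg_cst|exact: cvg_id].
apply: (cvg_comp _ _ _ H) => P nP.
exact: (ct (fun y => Hc y -> P y) nP).
Qed.

Lemma gradient_lin u w (a b : R) k z : smooth_up_to_boundary u -> smooth_up_to_boundary w -> Ho z ->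
  gradient (fun z => a * u z + b * w z) k z = a * gradient u k z + b * gradient w k z.
Proof.
move=> su sw Hz; apply: (@derive_val _ _ _ _ _ _ _ _).
have du := smooth_grad k su Hz; have dw := smooth_grad k sw Hz.
exact: (is_deriveD (is_deriveZ a du) (is_deriveZ b dw)).
Qed.

Lemma gradient_tprof e g u k z : 0 < e -> smooth_up_to_boundary u -> Ho z ->
  gradient (fun z => tprof e g (u z)) k z = dprof e g (u z) * gradient u k z.
Proof.
move=> e0 su Hz; apply: (@derive_val _ _ _ _ _ _ _ _).
apply: (is_derive_comp1 (f := tprof e g)); last exact: smooth_grad.
exact: is_derive_tprof.
Qed.

End smooth_algebra.

(** * Inequalities and integrals on the half-cylinder *)

Section nonneg_integrals.
Context d (T : measurableType d) (R : realType) (mu : {measure set T -> \bar R}) (D : set T).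
Hypothesis mD : measurable D.
Implicit Types f g h : T -> R.

Lemma le_int f g : measurable_fun D f -> measurable_fun D g ->
  (forall x, D x -> 0 <= f x <= g x) ->
  (\int[mu]_(x in D) (f x)%:E <= \int[mu]_(x in D) (g x)%:E)%E.
Proof.
move=> mf mg fg; apply: ge0_le_integral => //.
- by move=> x Dx; rewrite lee_fin; have /andP[] := fg x Dx.
- exact/measurable_EFinP.
- exact/measurable_EFinP.
- by move=> x Dx; rewrite lee_fin; have /andP[] := fg x Dx.
Qed.

Lemma int_lin a b f g : measurable_fun D f -> measurable_fun D g ->
  (forall x, D x -> 0 <= f x) -> (forall x, D x -> 0 <= g x) -> 0 <= a -> 0 <= b ->
  (\int[mu]_(x in D) (a * f x + b * g x)%:E =
   a%:E * \int[mu]_(x in D) (f x)%:E + b%:E * \int[mu]_(x in D) (g x)%:E)%E.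
Proof.
move=> mf mg f0 g0 a0 b0.
under eq_integral do rewrite EFinD !EFinM.
have mf' : measurable_fun D (EFin \o f) by exact/measurable_EFinP.
have mg' : measurable_fun D (EFin \o g) by exact/measurable_EFinP.
rewrite ge0_integralD//.
- by rewrite !ge0_integralZl_EFin.
- by move=> x Dx; rewrite -EFinM lee_fin mulr_ge0// f0.
- exact: measurable_funeM.
- by move=> x Dx; rewrite -EFinM lee_fin mulr_ge0// g0.
- exact: measurable_funeM.
Qed.

Lemma int_lin_le a b f g h : measurable_fun D h -> measurable_fun D f -> measurable_fun D g ->
  (forall x, D x -> 0 <= f x) -> (forall x, D x -> 0 <= g x) -> 0 <= a -> 0 <= b ->
  (forall x, D x -> 0 <= h x <= a * f x + b * g x) ->
  (\int[mu]_(x in D) (h x)%:E <=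
   a%:E * \int[mu]_(x in D) (f x)%:E + b%:E * \int[mu]_(x in D) (g x)%:E)%E.
Proof.
move=> mh mf mg f0 g0 a0 b0 H; rewrite -int_lin//; apply: le_int => //.
by apply: measurable_funD; apply: measurable_funM => //; exact: measurable_cst.
Qed.

Lemma int_scale_le a f h : measurable_fun D h -> measurable_fun D f ->
  0 <= a -> (forall x, D x -> 0 <= f x) -> (forall x, D x -> 0 <= h x <= a * f x) ->
  (\int[mu]_(x in D) (h x)%:E <= a%:E * \int[mu]_(x in D) (f x)%:E)%E.
Proof.
move=> mh mf a0 f0 H.
have := @int_lin_le a 0 f f h mh mf mf f0 f0 a0 (lexx _).
rewrite mul0e adde0; apply => x Dx; by rewrite mul0r addr0 H.
Qed.

Lemma int_fin_integrable f : measurable_fun D f ->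
  (\int[mu]_(x in D) (`|f x|)%:E < +oo)%E -> mu.-integrable D (EFin \o f).
Proof. by move=> mf fin; apply/integrableP; split; [exact/measurable_EFinP|]. Qed.

End nonneg_integrals.

Section young.
Context {R : realType}.
Implicit Types x y l p q : R.

Lemma ge0_powR_le x y p : 0 <= x <= y -> 0 <= p -> x `^ p <= y `^ p.
Proof.
move=> /andP[x0 xy] p0; apply: ge0_ler_powR => //; rewrite nnegrE//; exact: le_trans xy.
Qed.

(** Young's inequality with a free weight and simple constants: according as y <= l x^(q - 1) or
    not, the first or the second term alone dominates the product. With [l] fitted to the data it
    does the work of Hoelder's inequality. *)
Lemma young_split l q x y p : 0 < l -> 0 <= x -> 0 <= y -> 1 < p -> q = p / (p - 1) ->
  x * y <= l * x `^ q + l `^ (1 - p) * y `^ p.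
Proof.
move=> l0 x0 y0 p1 qE.
have p10 : 0 < p - 1 by rewrite subr_gt0.
have A0 : 0 <= l * x `^ q by rewrite mulr_ge0 ?powR_ge0// ltW.
have B0 : 0 <= l `^ (1 - p) * y `^ p by rewrite mulr_ge0 ?powR_ge0.
have q1 : q - 1 = (p - 1)^-1 by rewrite qE; field; rewrite gt_eqF.
have [yl|ly] := leP y (l * x `^ (q - 1)).
  apply: le_trans (_ : l * x `^ q <= _); last by rewrite lerDl.
  apply: le_trans (ler_wpM2l x0 yl) _; rewrite mulrCA mulr_powRB1//.
  by rewrite qE divr_gt0// (lt_trans _ p1).
apply: le_trans (_ : l `^ (1 - p) * y `^ p <= _); last by rewrite lerDr.
have yl : (x `^ (q - 1)) `^ (p - 1) <= (y / l) `^ (p - 1).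
  apply: ge0_powR_le; last exact: ltW.
  by rewrite powR_ge0/= ler_pdivlMr// mulrC ltW.
rewrite -powRrM q1 mulVf ?gt_eqF// powRr1// in yl.
apply: le_trans (ler_wpM2r y0 yl) _.
rewrite powRM ?invr_ge0 ?(ltW l0)// -(@powR_inv1 _ l) ?(ltW l0)// -powRrM mulN1r opprB.
rewrite [_ * l `^ _]mulrC -mulrA [_ * y]mulrC mulr_powRB1//; exact: lt_trans p1.
Qed.

(** The same comparison against the constant 1: after integration over a set of finite measure it
    bounds an L^1 norm by an L^q norm, [l] being the size aimed at. *)
Lemma le_addpowR l q x : 0 < l -> 0 <= x -> 1 <= q -> x <= l + l `^ (1 - q) * x `^ q.
Proof.
move=> l0 x0 q1; have B0 : 0 <= l `^ (1 - q) * x `^ q by rewrite mulr_ge0 ?powR_ge0.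
have [xl|lx] := leP x l; first by rewrite ler_wpDr.
apply: le_trans (_ : l `^ (1 - q) * x `^ q <= _); last by rewrite lerDr ltW.
have x1 : 0 < x by exact: lt_trans lx.
rewrite -(@mulr_powRB1 _ x q) ?(lt_le_trans ltr01 q1)// mulrCA ler_peMr//.
rewrite -opprB powRN mulrC ler_pdivlMr ?powR_gt0// mul1r.
by apply: ge0_powR_le; rewrite ?subr_ge0// (ltW l0) ltW.
Qed.

Lemma powR_addle x y p : 0 <= x -> 0 <= y -> 0 <= p ->
  (x + y) `^ p <= 2 `^ p * (x `^ p + y `^ p).
Proof.
move=> x0 y0 p0.
wlog xy : x y x0 y0 / x <= y.
  move=> H; have [xy|yx] := leP x y; first exact: H.
  by rewrite addrC [x `^ p + _]addrC; apply: H => //; exact: ltW.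
apply: le_trans (_ : (2 * y) `^ p <= _).
  by apply: ge0_powR_le => //; rewrite addr_ge0//= mulr_natl mulr2n lerD2r.
by rewrite powRM// ler_wpM2l ?powR_ge0// lerDr powR_ge0.
Qed.

Lemma powR_mono_add x p q : 0 <= x -> 0 < p <= q -> x `^ p <= 1 + x `^ q.
Proof.
move=> x0 /andP[p0 pq]; have [x1|x1] := leP x 1.
  by rewrite ler_wpDr ?powR_ge0// (le_trans (ge0_powR_le (y := 1) _ (ltW p0))) ?x0// powR1.
rewrite ler_wpDl// ler_powR//; exact: ltW.
Qed.

End young.

Section cylinder_integrals.
Context {R : realType} {N : nat}.
Local Notation Em := ('rV[R]_N * measurableTypeR R)%type.
Local Notation Ho := (@half_space R N : set Em).
Local Notation HC := (@half_cylinder R N : set Em).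
Local Notation cyl := (@lebesgue_cyl R N).
Local Notation leb := (@lebesgue_measure R).
Local Notation pos := (`]0%R, +oo[%classic : set (measurableTypeR R)).

Lemma integral_cyl_tonelli (f : Em -> \bar R) :
  measurable_fun [set: Em] f -> (forall z, (0 <= f z)%E) ->
  (\int[cyl]_(z in HC) f z = \int[leb]_(t in pos) \int[lebesgue_row N]_(x in open_cube) f (x, t))%E.
Proof.
move=> mf f0.
rewrite integral_mkcond.
have mfH : measurable_fun [set: Em] (f \_ HC).
  by apply: (iffLR (measurable_restrictT _ measurable_half_cylinder)); exact: measurable_funTS mf.
have f0H z : (0 <= (f \_ HC) z)%E by apply: erestrict_ge0.
rewrite [LHS](@fubini_tonelli2 _ _ _ _ _ (lebesgue_row N) leb _ mfH f0H).
rewrite [RHS]integral_mkcond; apply: eq_integral => t _.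
rewrite /fubini_G /patch; case: ifPn => [/set_mem|/negP nt].
  rewrite /= in_itv/= andbT => t0.
  rewrite [RHS]integral_mkcond; apply: eq_integral => x _.
  rewrite /patch; case: ifPn => [/set_mem [/mem_set ->]//|/negP nB].
  by case: ifPn => // /set_mem Ix; exfalso; apply: nB; apply/mem_set.
apply: integral0_eq => x _; case: ifPn => // /set_mem [_ /= t0].
by exfalso; apply: nt; apply/mem_set; rewrite /= in_itv/= andbT.
Qed.

Lemma measurable_translate_cyl (h : 'rV[R]_N) :
  measurable_fun [set: Em] (fun z : Em => (z.1 + h, z.2) : Em).
Proof.
apply: measurable_fun_pair; last exact: measurable_snd.
exact: (measurableT_comp (measurable_addrow h) measurable_fst).
Qed.

Lemma measurable_Ho : measurable Ho.
Proof. by apply: open_measurable_row_line; exact: open_half_space. Qed.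

Lemma HC_Ho : HC `<=` Ho. Proof. by move=> z []. Qed.

(** Gradients are controlled only on the open half-space, so [f] is cut off to zero outside it
    before the periodic translation is applied on each horizontal slice. *)
Lemma ge0_integral_cyl_shift (f : Em -> \bar R) (h : 'rV[R]_N) :
  (forall i, `|h ord0 i| <= 2 * pi) ->
  measurable_fun Ho f -> (forall z, (0 <= f z)%E) ->
  (forall i z, Ho z -> f (z.1 + period i, z.2) = f z) ->
  (\int[cyl]_(z in HC) f (z.1 + h, z.2)%R = \int[cyl]_(z in HC) f z)%E.
Proof.
move=> hb mf f0 perf.
pose g := f \_ Ho.
have mg : measurable_fun [set: Em] g by exact: (iffLR (measurable_restrictT _ measurable_Ho)).
have g0 z : (0 <= g z)%E by apply: erestrict_ge0.
have gE z : Ho z -> g z = f z by move=> Hz; rewrite /g /patch mem_set.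
have perg i z : g (z.1 + period i, z.2) = g z.
  rewrite /g /patch; case: ifPn => [/set_mem Hz|/negP nz].
    by rewrite mem_set// perf.
  by rewrite memNset// => Hz; apply: nz; apply/mem_set.
transitivity (\int[cyl]_(z in HC) g (z.1 + h, z.2)%R)%E.
  by apply: eq_integral => z /set_mem [_ Hz]; rewrite gE.
transitivity (\int[cyl]_(z in HC) g z)%E; last first.
  by apply: eq_integral => z /set_mem [_ Hz]; rewrite gE.
have mgh := measurableT_comp mg (measurable_translate_cyl h).
rewrite (integral_cyl_tonelli mg g0) (integral_cyl_tonelli mgh (fun z => g0 _)).
apply: eq_integral => t _.
apply: (@integral_cube_shift _ _ (fun x => g (x, t))) => //.
  exact: (measurableT_comp mg (pair2_measurable (t : measurableTypeR R))).
by move=> i x; exact: (perg i (x, t)).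
Qed.

Lemma integral_cyl_shift (f : Em -> \bar R) (h : 'rV[R]_N) :
  (forall i, `|h ord0 i| <= 2 * pi) ->
  measurable_fun Ho f ->
  (forall i z, Ho z -> f (z.1 + period i, z.2) = f z) ->
  (\int[cyl]_(z in HC) f (z.1 + h, z.2)%R = \int[cyl]_(z in HC) f z)%E.
Proof.
move=> hb mf perf; pose tr (z : Em) : Em := (z.1 + h, z.2).
have pp i z : Ho z -> (f^\+)%E (z.1 + period i, z.2) = (f^\+)%E z.
  by move=> Hz; rewrite !funeposE perf.
have pn i z : Ho z -> (f^\-)%E (z.1 + period i, z.2) = (f^\-)%E z.
  by move=> Hz; rewrite !funenegE perf.
rewrite -[LHS]/(\int[cyl]_(z in HC) (f \o tr) z)%E.
rewrite integralE [RHS]integralE funepos_comp funeneg_comp.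
rewrite -(ge0_integral_cyl_shift hb (measurable_funepos mf) (funepos_ge0 f) pp).
by rewrite -(ge0_integral_cyl_shift hb (measurable_funeneg mf) (funeneg_ge0 f) pn).
Qed.

Lemma signed_integral_cube_shift (f : 'rV[R]_N -> \bar R) (h : 'rV[R]_N) :
  (forall i, `|h ord0 i| <= 2 * pi) ->
  measurable_fun [set: 'rV[R]_N] f ->
  (forall i x, f (x + period i) = f x) ->
  (\int[lebesgue_row N]_(x in open_cube) f (x + h)%R = \int[lebesgue_row N]_(x in open_cube) f x)%E.
Proof.
move=> hb mf perf; pose tr (x : 'rV[R]_N) := x + h.
have pp i x : (f^\+)%E (x + period i) = (f^\+)%E x by rewrite !funeposE perf.
have pn i x : (f^\-)%E (x + period i) = (f^\-)%E x by rewrite !funenegE perf.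
rewrite -[LHS]/(\int[lebesgue_row N]_(z in open_cube) (f \o tr) z)%E.
rewrite integralE [RHS]integralE funepos_comp funeneg_comp.
rewrite -(integral_cube_shift hb (measurable_funepos mf) (funepos_ge0 f) pp).
by rewrite -(integral_cube_shift hb (measurable_funeneg mf) (funeneg_ge0 f) pn).
Qed.

End cylinder_integrals.

(** * The energy and the trace inequality *)

Section energy_calculus.
Context {R : realType} {N : nat} (s m : R).
Local Notation E := ('rV[R]_N * R)%type.
Local Notation Em := ('rV[R]_N * measurableTypeR R)%type.
Local Notation Ho := (@half_space R N : set Em).
Local Notation HC := (@half_cylinder R N : set Em).
Local Notation cyl := (@lebesgue_cyl R N).
Implicit Types (u w : E -> R) (G : option 'I_N -> E -> R) (h : 'rV[R]_N) (a b e g l : R).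

Definition wt (z : E) : R := z.2 `^ (1 - 2 * s).

Definition dens w G (z : E) : R := wt z * (\sum_k G k z ^+ 2 + m ^+ 2 * w z ^+ 2).

Definition bil w G w' G' (z : E) : R :=
  wt z * (\sum_k G k z * G' k z + m ^+ 2 * w z * w' z).

Definition measurable_field w G :=
  measurable_fun HC w /\ forall k, measurable_fun HC (G k).

Lemma energyE w G : energy s m w G = (\int[cyl]_(z in HC) (dens w G z)%:E)%E.
Proof. by []. Qed.

Lemma wt_ge0 z : 0 <= wt z. Proof. exact: powR_ge0. Qed.

Lemma eq_dens w G w' G' z z' : z.2 = z'.2 -> w z = w' z' -> (forall k, G k z = G' k z') ->
  dens w G z = dens w' G' z'.
Proof. by move=> z2 wE GE; rewrite /dens /wt z2 wE; under eq_bigr do rewrite GE. Qed.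

Lemma eq_bil w1 G1 w2 G2 w1' G1' w2' G2' z z' : z.2 = z'.2 -> w1 z = w1' z' -> w2 z = w2' z' ->
  (forall k, G1 k z = G1' k z') -> (forall k, G2 k z = G2' k z') ->
  bil w1 G1 w2 G2 z = bil w1' G1' w2' G2' z'.
Proof.
by move=> z2 w1E w2E G1E G2E; rewrite /bil /wt z2 w1E w2E; under eq_bigr do rewrite G1E G2E.
Qed.

Lemma dens_ge0 w G z : 0 <= dens w G z.
Proof.
apply: mulr_ge0; first exact: wt_ge0.
apply: addr_ge0; first by apply: sumr_ge0 => k _; exact: sqr_ge0.
by apply: mulr_ge0; exact: sqr_ge0.
Qed.

Lemma energy_ge0 w G : (0 <= energy s m w G)%E.
Proof. by apply: integral_ge0 => z _; rewrite lee_fin dens_ge0. Qed.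

Lemma measurable_wt D : measurable_fun (D : set Em) wt.
Proof.
apply: measurable_funTS.
exact: (measurableT_comp (measurable_powR (1 - 2 * s)) measurable_snd).
Qed.

Lemma measurable_dens w G (D : set Em) : measurable_fun D w -> (forall k, measurable_fun D (G k)) ->
  measurable_fun D (dens w G).
Proof.
move=> mw mG; apply: measurable_funM; first exact: measurable_wt.
apply: measurable_funD.
  by apply: measurable_sum => k; apply: measurable_funX; exact: mG.
by apply: measurable_funM; [exact: measurable_cst|exact: measurable_funX].
Qed.

Lemma measurable_bil w G w' G' (D : set Em) : measurable_fun D w -> (forall k, measurable_fun D (G k)) ->
  measurable_fun D w' -> (forall k, measurable_fun D (G' k)) ->
  measurable_fun D (bil w G w' G').
Proof.
move=> mw mG mw' mG'; apply: measurable_funM; first exact: measurable_wt.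
apply: measurable_funD.
  by apply: measurable_sum => k; apply: measurable_funM; [exact: mG|exact: mG'].
by apply: measurable_funM => //; apply: measurable_funM => //; exact: measurable_cst.
Qed.

Lemma energy_lin_le a b w G w1 G1 w2 G2 :
  measurable_field w G -> measurable_field w1 G1 -> measurable_field w2 G2 ->
  (forall z, HC z -> w z = a * w1 z + b * w2 z) ->
  (forall k z, HC z -> G k z = a * G1 k z + b * G2 k z) ->
  (energy s m w G <= (2 * a ^+ 2)%:E * energy s m w1 G1 + (2 * b ^+ 2)%:E * energy s m w2 G2)%E.
Proof.
move=> [mw mG] [mw1 mG1] [mw2 mG2] wE GE; rewrite !energyE.
have sq2 c : 0 <= 2 * c ^+ 2 :> R by apply: mulr_ge0 => //; exact: sqr_ge0.
apply: int_lin_le => //.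
- exact: measurable_half_cylinder.
- exact: measurable_dens.
- exact: measurable_dens.
- exact: measurable_dens.
- by move=> z _; exact: dens_ge0.
- by move=> z _; exact: dens_ge0.
move=> z Hz; rewrite dens_ge0/= /dens.
have sq (x y : R) : (a * x + b * y) ^+ 2 <= 2 * a ^+ 2 * x ^+ 2 + 2 * b ^+ 2 * y ^+ 2.
  have := sqr_ge0 (a * x - b * y); nra.
rewrite !(mulrCA _ (wt z)) -mulrDr; apply: ler_wpM2l; first exact: wt_ge0.
rewrite !mulrDr addrACA; apply: lerD.
  rewrite !mulr_sumr -big_split; apply: ler_sum => k _ /=.
  by rewrite GE//; exact: sq.
rewrite wE// !(mulrCA _ (m ^+ 2)) -mulrDr; apply: ler_wpM2l; first exact: sqr_ge0.
exact: sq.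
Qed.

Lemma bil_young l w G w' G' z : 0 < l ->
  `|bil w G w' G' z| <= l * dens w G z + l^-1 * dens w' G' z.
Proof.
move=> l0; have l10 : 0 < l^-1 by rewrite invr_gt0.
have sq (x y : R) : `|x * y| <= l * x ^+ 2 + l^-1 * y ^+ 2.
  have sp : 0 <= (l * x ^+ 2 + l^-1 * y ^+ 2) - 2 * `|x * y|.
    rewrite normrM -[x ^+ 2]real_normK ?num_real// -[y ^+ 2]real_normK ?num_real//.
    set a := `|x|; set b := `|y|.
    rewrite (_ : _ - _ = l^-1 * (l * a - b) ^+ 2); last by field; rewrite gt_eqF.
    by rewrite mulr_ge0 ?sqr_ge0// ltW.
  have := normr_ge0 (x * y); lra.
rewrite /bil normrM ger0_norm ?wt_ge0// /dens.
rewrite !(mulrCA _ (wt z)) -mulrDr; apply: ler_wpM2l; first exact: wt_ge0.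
rewrite !mulrDr addrACA; apply: le_trans (ler_normD _ _) _; apply: lerD.
  rewrite !mulr_sumr -big_split; apply: le_trans (ler_norm_sum _ _ _) _.
  by apply: ler_sum => k _ /=; exact: sq.
rewrite -mulrA normrM ger0_norm ?sqr_ge0// !(mulrCA _ (m ^+ 2)) -mulrDr.
apply: ler_wpM2l; first exact: sqr_ge0.
exact: sq.
Qed.

Lemma int_bil_le l a b w G w' G' : 0 < l ->
  measurable_field w G -> measurable_field w' G' ->
  (energy s m w G <= a%:E)%E -> (energy s m w' G' <= b%:E)%E ->
  (\int[cyl]_(z in HC) (`|bil w G w' G' z|)%:E <= (l * a + l^-1 * b)%:E)%E.
Proof.
move=> l0 [mw mG] [mw' mG'] Ea Eb.
apply: (@le_trans _ _ (l%:E * energy s m w G + l^-1%:E * energy s m w' G')%E).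
  rewrite !energyE; apply: int_lin_le; rewrite ?invr_ge0 ?(ltW l0)//.
  - exact: measurable_half_cylinder.
  - by apply: measurableT_comp => //; exact: measurable_bil.
  - exact: measurable_dens.
  - exact: measurable_dens.
  - by move=> z _; exact: dens_ge0.
  - by move=> z _; exact: dens_ge0.
  - by move=> z _; rewrite normr_ge0 bil_young.
by rewrite EFinD !EFinM; apply: leeD; apply: lee_wpmul2l => //; rewrite lee_fin ?invr_ge0 ltW.
Qed.

Lemma integrable_bil w G w' G' :
  measurable_field w G -> measurable_field w' G' ->
  (energy s m w G < +oo)%E -> (energy s m w' G' < +oo)%E ->
  cyl.-integrable HC (EFin \o bil w G w' G').
Proof.
move=> mf mf' fa fb; have [[mw mG] [mw' mG']] := (mf, mf').
apply: int_fin_integrable; first exact: measurable_bil.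
have Ea : (energy s m w G <= (fine (energy s m w G))%:E)%E.
  by rewrite fineK// ge0_fin_numE ?energy_ge0.
have Eb : (energy s m w' G' <= (fine (energy s m w' G'))%:E)%E.
  by rewrite fineK// ge0_fin_numE ?energy_ge0.
exact: le_lt_trans (int_bil_le ltr01 mf mf' Ea Eb) (ltry _).
Qed.

Lemma smooth_field u : smooth_up_to_boundary u -> measurable_field u (gradient u).
Proof.
move=> su; split.
  by apply: measurable_funS (smooth_measurable su); [exact: measurable_Ho|exact: HC_Ho].
move=> k; apply: measurable_funS (smooth_gradient_measurable k su); [exact: measurable_Ho|exact: HC_Ho].
Qed.

Lemma gradient_periodic u k i z : smooth_up_to_boundary u -> periodic_half_space u -> Ho z ->
  gradient u k (z.1 + period i, z.2) = gradient u k z.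
Proof.
move=> su pu Hz; rewrite -gradient_translate// /gradient.
apply: near_eq_derive; near=> y.
have Hy : Ho y by near: y; apply: open_nbhs_nbhs; split => //; exact: open_half_space.
by rewrite pu; [rewrite -surjective_pairing|exact: ltW].
Unshelve. all: by end_near. Qed.

Lemma test_tprof e g u : 0 < e <= 1 -> 0 <= g -> test_function s m u ->
  test_function s m (fun z => tprof e g (u z)) /\
  (energy s m (fun z => tprof e g (u z)) (gradient (fun z => tprof e g (u z))) <=
    ((e^-1 `^ g * (1 + 2 * g)) ^+ 2)%:E * energy s m u (gradient u))%E.
Proof.
move=> e01 g0 [su pu fu]; have /andP[e0 e1] := e01.
have sG := smooth_tprof g e0 su.
have [mu mgu] := smooth_field su; have [mG mgG] := smooth_field sG.
set L := e^-1 `^ g * (1 + 2 * g).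
have ep0 : 0 <= e^-1 `^ g by exact: powR_ge0.
have L0 : 0 <= L by apply: mulr_ge0 => //; lra.
have L1 : e^-1 `^ g <= L by rewrite ler_peMr//; lra.
have EL : (energy s m (fun z => tprof e g (u z)) (gradient (fun z => tprof e g (u z))) <=
    (L ^+ 2)%:E * energy s m u (gradient u))%E.
  rewrite !energyE; apply: int_scale_le; rewrite ?sqr_ge0//.
  - exact: measurable_half_cylinder.
  - exact: measurable_dens.
  - exact: measurable_dens.
  - by move=> z _; exact: dens_ge0.
  move=> z Hz; rewrite dens_ge0/= /dens [X in _ <= X]mulrCA; apply: ler_wpM2l; first exact: wt_ge0.
  rewrite mulrDr; apply: lerD.
    rewrite mulr_sumr; apply: ler_sum => k _.
    rewrite gradient_tprof//; last exact: HC_Ho.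
    rewrite exprMn ler_wpM2r ?sqr_ge0// ler_sqr ?nnegrE ?dprof_ge0//.
    exact: dprof_ub.
  rewrite [X in _ <= X]mulrCA ler_wpM2l ?sqr_ge0// -exprMn.
  rewrite -[X in X <= _]real_normK ?num_real// -[X in _ <= X]real_normK ?num_real//.
  rewrite ler_sqr ?nnegrE// [X in _ <= X]normrM (ger0_norm L0).
  apply: le_trans (tprof_bound _ e01 g0) _; exact: ler_wpM2r.
split => //; split => //; first by move=> i x xi xi0; rewrite pu.
by apply: le_lt_trans EL _; rewrite lte_mul_pinfty ?lee_fin ?sqr_ge0.
Qed.

Lemma test_lin a b u w : test_function s m u -> test_function s m w ->
  test_function s m (fun z => a * u z + b * w z) /\
  (energy s m (fun z => a * u z + b * w z)%R (gradient (fun z => a * u z + b * w z)%R) <=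
    (2 * a ^+ 2)%:E * energy s m u (gradient u) + (2 * b ^+ 2)%:E * energy s m w (gradient w))%E.
Proof.
move=> [su pu fu] [sw pw fw].
have sl : smooth_up_to_boundary (fun z => a * u z + b * w z).
  exact: smooth_add (smooth_scale a su) (smooth_scale b sw).
have H := energy_lin_le (a := a) (b := b) (smooth_field sl) (smooth_field su) (smooth_field sw).
have {}H : (energy s m (fun z => a * u z + b * w z)%R (gradient (fun z => a * u z + b * w z)%R) <=
    (2 * a ^+ 2)%:E * energy s m u (gradient u) + (2 * b ^+ 2)%:E * energy s m w (gradient w))%E.
  by apply: H => // k z Hz; rewrite gradient_lin//; exact: HC_Ho.
have sq2 c : 0 <= 2 * c ^+ 2 :> R by apply: mulr_ge0 => //; exact: sqr_ge0.
split => //; split => //; first by move=> i x xi xi0; rewrite pu ?pw.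
by apply: le_lt_trans H _; rewrite lte_add_pinfty ?lte_mul_pinfty ?lee_fin.
Qed.

Lemma dens_periodic u i z : smooth_up_to_boundary u -> periodic_half_space u -> Ho z ->
  dens u (gradient u) (z.1 + period i, z.2) = dens u (gradient u) z.
Proof.
move=> su pu Hz; apply: eq_dens; [by []| |by move=> k; exact: gradient_periodic].
by rewrite pu ?(ltW Hz)// -surjective_pairing.
Qed.

Lemma test_translate h u : (forall i, `|h ord0 i| <= 2 * pi) -> test_function s m u ->
  test_function s m (fun z => u (z.1 + h, z.2)) /\
  energy s m (fun z => u (z.1 + h, z.2)) (gradient (fun z => u (z.1 + h, z.2))) =
    energy s m u (gradient u).
Proof.
move=> hb [su pu fu].
have st := smooth_translate h su.
have EE : energy s m (fun z => u (z.1 + h, z.2)) (gradient (fun z => u (z.1 + h, z.2))) =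
    energy s m u (gradient u).
  rewrite !energyE.
  transitivity (\int[cyl]_(z in HC) (dens u (gradient u) (z.1 + h, z.2))%:E)%E.
    apply: eq_integral => z /set_mem Hz; apply: (congr1 EFin); apply: eq_dens; [by []|by []|move=> k].
    by apply: gradient_translate su _; exact: HC_Ho.
  apply: (integral_cyl_shift (f := fun z => (dens u (gradient u) z)%:E)) => //.
    apply/measurable_EFinP; apply: measurable_dens; first exact: smooth_measurable.
    by move=> k; exact: smooth_gradient_measurable.
  by move=> i z Hz; rewrite dens_periodic.
split => //; split => //; last by rewrite EE.
by move=> i x xi xi0 /=; rewrite addrAC pu.
Qed.

(* The increment operator for [e = 1], the identity for [h = 0], [e = 0]; its
   adjoint is [shift_diff (- h) e]. *)
Definition shift_diff {T : Type} (h : 'rV[R]_N) (e : R) (u : 'rV[R]_N * T -> R) : 'rV[R]_N * T -> R :=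
  fun z => 1 * u (z.1 + h, z.2) + (- e) * u z.

Lemma test_shift_diff h e u : (forall i, `|h ord0 i| <= 2 * pi) -> `|e| <= 1 -> test_function s m u ->
  test_function s m (shift_diff h e u) /\
  (energy s m (shift_diff h e u) (gradient (shift_diff h e u)) <= 4%:E * energy s m u (gradient u))%E.
Proof.
move=> hb e1 tu; have [tt tE] := test_translate hb tu.
have [tl lE] := test_lin 1 (- e) tt tu; split => //.
have sq2 c : 0 <= 2 * c ^+ 2 :> R by apply: mulr_ge0 => //; exact: sqr_ge0.
apply: le_trans lE _; rewrite tE -ge0_muleDl ?lee_fin//.
apply: lee_wpmul2r; first exact: energy_ge0.
rewrite -EFinD lee_fin sqrrN expr1n -[e ^+ 2]real_normK ?num_real//.
have := normr_ge0 e; nra.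
Qed.

Lemma bil_lin_r a b u w1 w2 z : Ho z -> smooth_up_to_boundary w1 -> smooth_up_to_boundary w2 ->
  bil u (gradient u) (fun z => a * w1 z + b * w2 z) (gradient (fun z => a * w1 z + b * w2 z)) z =
  a * bil u (gradient u) w1 (gradient w1) z + b * bil u (gradient u) w2 (gradient w2) z.
Proof.
move=> Hz s1 s2; rewrite /bil.
under eq_bigr do rewrite gradient_lin// mulrDr.
rewrite big_split/=.
under eq_bigr do rewrite mulrCA.
under [X in _ * (_ + X + _)]eq_bigr do rewrite mulrCA.
rewrite -!mulr_sumr; ring.
Qed.

Lemma bil_lin_l a b u w1 w2 z : Ho z -> smooth_up_to_boundary w1 -> smooth_up_to_boundary w2 ->
  bil (fun z => a * w1 z + b * w2 z) (gradient (fun z => a * w1 z + b * w2 z)) u (gradient u) z =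
  a * bil w1 (gradient w1) u (gradient u) z + b * bil w2 (gradient w2) u (gradient u) z.
Proof.
move=> Hz s1 s2; rewrite /bil.
under eq_bigr do rewrite gradient_lin// mulrDl.
rewrite big_split/=.
under eq_bigr do rewrite -mulrA.
under [X in _ * (_ + X + _)]eq_bigr do rewrite -mulrA.
rewrite -!mulr_sumr; ring.
Qed.

Local Notation B u w := (\int[cyl]_(z in HC) (bil u (gradient u) w (gradient w) z)).

Lemma test_integrable_bil u w : test_function s m u -> test_function s m w ->
  cyl.-integrable HC (EFin \o bil u (gradient u) w (gradient w)).
Proof. by move=> [su _ fu] [sw _ fw]; apply: integrable_bil => //; exact: smooth_field. Qed.

Lemma bil_translate h u w : (forall i, `|h ord0 i| <= 2 * pi) -> test_function s m u -> test_function s m w ->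
  B u (fun z => w (z.1 - h, z.2)) = B (fun z => u (z.1 + h, z.2)) w.
Proof.
move=> hb [su pu fu] [sw pw fw]; rewrite /Rintegral; apply: (congr1 fine).
have nb i : `|(- h) ord0 i| <= 2 * pi by rewrite mxE normrN.
have st := smooth_translate h su.
rewrite -[RHS](@integral_cyl_shift _ _ _ (- h))//.
- apply: eq_integral => z /set_mem Hz; have Hoz := HC_Ho Hz; apply: (congr1 EFin).
  apply: eq_bil; [by []|by rewrite /= subrK -surjective_pairing|by []| |].
    move=> k; rewrite (gradient_translate h k su (z := (z.1 - h, z.2)) Hoz) /=.
    by rewrite subrK -surjective_pairing.
  by move=> k; apply: gradient_translate sw Hoz.
- apply/measurable_EFinP; apply: measurable_bil; try by apply: smooth_measurable.
  + by move=> k; exact: smooth_gradient_measurable.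
  + by move=> k; exact: smooth_gradient_measurable.
- move=> i z Hz; apply: (congr1 EFin); apply: eq_bil; [by []| | | |].
  + by rewrite /= addrAC pu ?(ltW Hz).
  + by rewrite /= pw ?(ltW Hz)// -surjective_pairing.
  + move=> k; rewrite (gradient_translate h k su (z := (z.1 + period i, z.2)) Hz).
    rewrite (gradient_translate h k su Hz) /= addrAC.
    exact: (gradient_periodic k i (z := (z.1 + h, z.2)) su pu Hz).
  + by move=> k; exact: (gradient_periodic k i sw pw Hz).
Qed.

Lemma bil_shift_diff h e u w : (forall i, `|h ord0 i| <= 2 * pi) ->
  test_function s m u -> test_function s m w ->
  B u (shift_diff (- h) e w) = B (shift_diff h e u) w.
Proof.
move=> hb tu tw; have nb i : `|(- h) ord0 i| <= 2 * pi by rewrite mxE normrN.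
have [[su _ _] [sw _ _]] := (tu, tw).
have [tuh _] := test_translate hb tu; have [twh _] := test_translate nb tw.
have mHC := @measurable_half_cylinder R N.
have iZ (c : R) (F : Em -> R) : cyl.-integrable HC (EFin \o F) -> cyl.-integrable HC (EFin \o (fun z => c * F z)).
  by move=> iF; exact: (integrableZl mHC c iF).
have I1 := test_integrable_bil tu twh; have I2 := test_integrable_bil tu tw.
have I3 := test_integrable_bil tuh tw.
have -> : B u (shift_diff (- h) e w) = 1 * B u (fun z => w (z.1 - h, z.2)) + (- e) * B u w.
  rewrite -!RintegralZl// -RintegralD//; try by apply: iZ.
  apply: eq_Rintegral => z /set_mem/HC_Ho Hz; apply: bil_lin_r => //; exact: smooth_translate.
have -> : B (shift_diff h e u) w = 1 * B (fun z => u (z.1 + h, z.2)) w + (- e) * B u w.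
  rewrite -!RintegralZl// -RintegralD//; try by apply: iZ.
  apply: eq_Rintegral => z /set_mem/HC_Ho Hz; apply: bil_lin_l => //; exact: smooth_translate.
by rewrite bil_translate.
Qed.

(** By the chain rule each squared partial derivative on the left is [dprof e (b / 2)] squared times
    that of [u], and [dprof_sqr] compares it with the form on the right. The zero-order parts agree
    exactly by [tprof_sqr], and [1 + b >= 1]. *)
Lemma energy_tprof_le e b u : 0 < e <= 1 -> 0 <= b -> test_function s m u ->
  (energy s m (fun z => tprof e (b / 2) (u z)) (gradient (fun z => tprof e (b / 2) (u z))) <=
  ((1 + b) * B u (fun z => tprof e b (u z)))%:E)%E.
Proof.
move=> e01 b0 tu; have /andP[e0 e1] := e01; have [su pu fu] := tu.
have b20 : 0 <= b / 2 by rewrite divr_ge0.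
have [tG _] := test_tprof e01 b0 tu; have [tH _] := test_tprof e01 b20 tu.
have [[sG _ _] [sH _ _]] := (tG, tH).
have mHC := @measurable_half_cylinder R N.
have I := test_integrable_bil tu tG.
rewrite -RintegralZl// /Rintegral fineK; last first.
  by apply: integrable_fin_num => //; exact: (integrableZl mHC (1 + b) I).
rewrite energyE.
have [mH mgH] := smooth_field sH; have [mG mgG] := smooth_field sG; have [mu mgu] := smooth_field su.
apply: le_int => //.
- exact: measurable_dens.
- by apply: measurable_funM; [exact: measurable_cst|exact: measurable_bil].
move=> z Hz; have Hoz := HC_Ho Hz; rewrite dens_ge0/= /dens /bil (mulrCA _ (wt z)).
apply: ler_wpM2l; first exact: wt_ge0.
rewrite mulrDr; apply: lerD.
  rewrite mulr_sumr; apply: ler_sum => k _.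
  rewrite !gradient_tprof//; set d := gradient u k z.
  rewrite exprMn.
  have -> : (1 + b) * (d * (dprof e b (u z) * d)) = (1 + b) * dprof e b (u z) * d ^+ 2 by ring.
  by apply: ler_wpM2r; [exact: sqr_ge0|exact: dprof_sqr].
have -> : (1 + b) * (m ^+ 2 * u z * tprof e b (u z)) = (1 + b) * (m ^+ 2 * tprof e (b / 2) (u z) ^+ 2).
  by rewrite tprof_sqr// -[m ^+ 2 * u z * _]mulrA.
have Q0 : 0 <= m ^+ 2 * tprof e (b / 2) (u z) ^+ 2 by apply: mulr_ge0; exact: sqr_ge0.
rewrite ler_peMl//; lra.
Qed.

End energy_calculus.

Section null_sequences.
Context {R : realType}.

Lemma ecvg0P (e_ : nat -> \bar R) : (forall n, (0 <= e_ n)%E) ->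
  e_ @ \oo --> 0%E <-> forall eps : R, 0 < eps -> \forall n \near \oo, (e_ n <= eps%:E)%E.
Proof.
move=> e0; split=> [/fine_cvgP[ff /cvgrPdist_lt fc] eps eps0|H].
  near=> n.
  have fn : e_ n \is a fin_num by near: n.
  have : `|0 - fine (e_ n)| < eps by near: n; exact: fc.
  rewrite sub0r normrN ger0_norm ?fine_ge0// => /ltW.
  by rewrite -lee_fin fineK.
apply/fine_cvgP; split.
  have := H 1 ltr01; apply: filterS => n en.
  by rewrite ge0_fin_numE//; exact: le_lt_trans en (ltry _).
apply/cvgrPdist_le => eps eps0; have := H eps eps0; apply: filterS => n en.
have fn : e_ n \is a fin_num by rewrite ge0_fin_numE//; exact: le_lt_trans en (ltry _).
by rewrite /= sub0r normrN ger0_norm ?fine_ge0// -lee_fin fineK.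
Unshelve. all: by end_near. Qed.

Lemma ecvg0_lin (e_ e1 e2 : nat -> \bar R) (a b : R) : 0 <= a -> 0 <= b ->
  (forall n, (0 <= e_ n)%E) -> (forall n, (0 <= e1 n)%E) -> (forall n, (0 <= e2 n)%E) ->
  (forall n, (e_ n <= a%:E * e1 n + b%:E * e2 n)%E) ->
  e1 @ \oo --> 0%E -> e2 @ \oo --> 0%E -> e_ @ \oo --> 0%E.
Proof.
move=> a0 b0 e0 e10 e20 le /(ecvg0P e10) c1 /(ecvg0P e20) c2; apply/(ecvg0P e0) => eps eps0.
have d0 : 0 < eps / (a + b + 1) by rewrite divr_gt0//; lra.
have := c1 _ d0; have := c2 _ d0; apply: filterS2 => n h2 h1.
apply: le_trans (le n) _.
apply: le_trans (leeD (lee_wpmul2l _ h1) (lee_wpmul2l _ h2)) _; rewrite ?lee_fin//.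
rewrite -mulrDl mulrA ler_pdivrMr; last by lra.
rewrite mulrC ler_wpM2l ?(ltW eps0)//; lra.
Qed.

End null_sequences.

Section boundary_integrals.
Context {R : realType} {N : nat}.
Local Notation row := (lebesgue_row N).
Local Notation cube := (@open_cube R N).
Implicit Types (F G : 'rV[R]_N -> R) (p : R).

Lemma measurable_powR_norm d (T : measurableType d) (D : set T) (p : R) (F : T -> R) :
  measurable_fun D F -> measurable_fun D (fun x => `|F x| `^ p).
Proof. by move=> mF; apply: (measurableT_comp (measurable_powR p)); exact: measurableT_comp. Qed.

Lemma int_powD_le p F G : 0 <= p -> measurable_fun cube F -> measurable_fun cube G ->
  (\int[row]_(x in cube) (`|F x + G x| `^ p)%:E <=
   (2 `^ p)%:E * \int[row]_(x in cube) (`|F x| `^ p)%:E + (2 `^ p)%:E * \int[row]_(x in cube) (`|G x| `^ p)%:E)%E.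
Proof.
move=> p0 mF mG.
apply: int_lin_le; rewrite ?powR_ge0//.
- exact: measurable_open_cube.
- by apply: measurable_powR_norm; exact: measurable_funD.
- exact: measurable_powR_norm.
- exact: measurable_powR_norm.
move=> x _; rewrite powR_ge0 -mulrDr/=.
apply: le_trans (powR_addle _ _ p0); rewrite ?normr_ge0//.
by apply: ge0_powR_le => //; rewrite normr_ge0/= ler_normD.
Qed.

End boundary_integrals.

(** * The trace inequality extracted from the existence of one trace *)

Section free_trace.
Context {R : realType} {N : nat} (s m : R).
Local Notation p := (crit_exp N s).
Local Notation row := (lebesgue_row N).
Local Notation cube := (@open_cube R N).
Local Notation en u := (energy s m u (gradient u)).
Hypothesis p1 : 1 <= p.

Lemma test_boundary_measurable (u : 'rV[R]_N * R -> R) D : test_function s m u ->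
  measurable_fun (D : set 'rV[R]_N) (fun x => u (x, 0)).
Proof.
move=> [su _ _]; apply: measurable_funTS; apply: continuous_measurable_row.
exact: smooth_boundary_continuous.
Qed.

Lemma energy_diff_self (u : 'rV[R]_N * R -> R) :
  energy s m (fun z => u z - u z) (fun k z => gradient u k z - gradient u k z) = 0%E.
Proof.
rewrite energyE; apply: integral0_eq => z _; congr (_%:E); rewrite /dens.
under eq_bigr do rewrite subrr expr0n.
by rewrite big1// subrr expr0n/= mulr0 addr0 mulr0.
Qed.

Lemma test_smooth (u : 'rV[R]_N * R -> R) : test_function s m u -> smooth_up_to_boundary u.
Proof. by case. Qed.

Lemma test_approximates (u : 'rV[R]_N * R -> R) : test_function s m u ->
  approximates s m (fun _ => u) u (gradient u).
Proof.
split => //.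
by rewrite (_ : (fun _ => _) = (fun=> 0%E)); [exact: cvg_cst|apply/funext => n; exact: energy_diff_self].
Qed.

Definition Xspace_of_test (u : 'rV[R]_N * R -> R) (tu : test_function s m u) : @Xspace R N s m :=
  @Build_Xspace R N s m u (gradient u) (smooth_field (test_smooth tu)).1
    (smooth_field (test_smooth tu)).2 (ex_intro (fun u_ => approximates s m u_ u (gradient u)) _ (test_approximates tu)).

Lemma X_field (v : @Xspace R N s m) : measurable_field (Xfun v) (Xgrad v).
Proof. by split; [exact: Xfun_measurable|move=> k; exact: Xgrad_measurable]. Qed.

Lemma field_sub (w1 w2 : 'rV[R]_N * R -> R) G1 G2 : measurable_field w1 G1 -> measurable_field w2 G2 ->
  measurable_field (fun z => w1 z - w2 z) (fun k z => G1 k z - G2 k z).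
Proof.
move=> [m1 mG1] [m2 mG2]; split; first exact: measurable_funB.
by move=> k; exact: measurable_funB.
Qed.

(* If a single element has a trace, then the restriction of test functions is
   continuous at 0 in the energy norm, since a null sequence may be added to
   any approximating sequence. *)
Lemma trace_small (v : @Xspace R N s m) T : is_trace v T ->
  exists2 c : R, 0 < c & forall w, test_function s m w -> (en w <= c%:E)%E ->
    (\int[row]_(x in cube) (`|w (x, 0)| `^ p)%:E <= 1)%E.
Proof.
move=> [mT trT]; apply: contrapT => nc.
have p0 : 0 <= p by apply: le_trans p1.
have : forall n : nat, exists w, [/\ test_function s m w, (en w <= (n.+1%:R^-1)%:E)%E &
    ~ (\int[row]_(x in cube) (`|w (x, 0)| `^ p)%:E <= 1)%E].
  move=> n; apply: contrapT => nw; apply: nc; exists (n.+1%:R^-1) => // w tw ew.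
  by apply: contrapT => nle; apply: nw; exists w; split.
move=> /choice[w_ wP].
have [u_ [tu_ eu]] := X_approximable v.
have ew0 : (fun n => en (w_ n)) @ \oo --> 0%E.
  apply/ecvg0P; first by move=> n; exact: energy_ge0.
  move=> eps eps0; have := near_infty_natSinv_lt (PosNum eps0); apply: filterS => n /= nlt.
  by have [_ le _] := wP n; apply: le_trans le _; rewrite lee_fin ltW.
pose uw n z := 1 * u_ n z + 1 * w_ n z.
have tuw n : test_function s m (uw n).
  by have [tw _ _] := wP n; exact: (test_lin 1 1 (tu_ n) tw).1.
have appuw : approximates s m uw (Xfun v) (Xgrad v).
  split=> //; apply: (@ecvg0_lin _ _ _ _ 2 2 _ _ _ _ _ _ eu ew0) => //.
  - by move=> n; exact: energy_ge0.
  - by move=> n; exact: energy_ge0.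
  - by move=> n; exact: energy_ge0.
  move=> n; have [[sw _ _] _ _] := wP n; have [su _ _] := tu_ n; have [suw _ _] := tuw n.
  have H := @energy_lin_le R N s m 1 1 _ _ _ _ _ _ (field_sub (smooth_field suw) (X_field v))
    (field_sub (smooth_field su) (X_field v)) (smooth_field sw).
  rewrite expr1n mulr1 in H; apply: H => [z Hz|k z Hz]; first by rewrite /uw; ring.
  rewrite gradient_lin//; [ring|exact: HC_Ho].
have c1 := trT _ appuw; have c2 := trT _ (conj tu_ eu).
(* Both [uw] and [u_] have restrictions tending to [T], so those of [w_] tend to 0, contrary to
   their choice. *)
have cw : (fun n => \int[row]_(x in cube) (`|w_ n (x, 0)| `^ p)%:E)%E @ \oo --> 0%E.
  have p20 : 0 <= 2 `^ p :> R by exact: powR_ge0.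
  apply: (@ecvg0_lin _ _ _ _ _ _ p20 p20 _ _ _ _ c1 c2).
  - by move=> n; apply: integral_ge0 => x _; rewrite lee_fin powR_ge0.
  - by move=> n; apply: integral_ge0 => x _; rewrite lee_fin powR_ge0.
  - by move=> n; apply: integral_ge0 => x _; rewrite lee_fin powR_ge0.
  move=> n; have [tw _ _] := wP n.
  have mA : measurable_fun cube (fun x => uw n (x, 0) - T x).
    by apply: measurable_funB => //; exact: test_boundary_measurable (tuw n).
  have mB : measurable_fun cube (fun x => - (u_ n (x, 0) - T x)).
    by apply: measurable_funN; apply: measurable_funB => //; exact: test_boundary_measurable (tu_ n).
  have E1 : (\int[row]_(x in cube) (`|w_ n (x, 0)| `^ p)%:E =
      \int[row]_(x in cube) (`|uw n (x, 0) - T x + - (u_ n (x, 0) - T x)| `^ p)%:E)%E.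
    by apply: eq_integral => x _; congr (`|_| `^ _)%:E; rewrite /uw; ring.
  have E2 : (\int[row]_(x in cube) (`|u_ n (x, 0) - T x| `^ p)%:E =
      \int[row]_(x in cube) (`|- (u_ n (x, 0) - T x)| `^ p)%:E)%E.
    by apply: eq_integral => x _; rewrite normrN.
  by rewrite E1 E2; exact: int_powD_le p0 mA mB.
move/ecvg0P : cw => /(_ _ 1 ltr01)[|n _ /(_ n (leqnn n)) Hn].
  by move=> n; apply: integral_ge0 => x _; rewrite lee_fin powR_ge0.
by have [_ _] := wP n; apply.
Qed.

(** Homogeneity turns continuity at 0 into an inequality: [w] is scaled until its energy falls below
    the threshold. The exponent [p / 2] appears because the energy is quadratic and the boundary
    integral has degree [p]. *)
Lemma trace_bound (v : @Xspace R N s m) T : is_trace v T ->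
  exists2 c : R, 0 < c & forall w (a : R), test_function s m w -> 0 < a -> (en w <= a%:E)%E ->
    (\int[row]_(x in cube) (`|w (x, 0)| `^ p)%:E <= ((a / c) `^ (p / 2))%:E)%E.
Proof.
move=> /trace_small[c c0 cP]; exists (c / 2); first by rewrite divr_gt0.
move=> w a tw a0 ea.
(* Solves 2 l^2 a = c; the 2 is the loss of [test_lin], used here with a zero second summand. *)
pose l := Num.sqrt (c / 2 / a).
have l20 : 0 < c / 2 / a by rewrite !divr_gt0.
have l0 : 0 < l by rewrite sqrtr_gt0.
have l2 : l ^+ 2 = c / 2 / a by rewrite sqr_sqrtr// ltW.
have [tl el] := test_lin l 0 tw tw.
have := cP _ tl.
have -> : (en (fun z => (l * w z + 0 * w z)%R) <= c%:E)%E.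
  apply: le_trans el _; rewrite expr0n/= mulr0 mul0e adde0 l2.
  apply: le_trans (lee_wpmul2l _ ea) _; first by rewrite lee_fin mulr_ge0// ltW.
  rewrite -EFinM lee_fin (_ : 2 * (c / 2 / a) * a = c)//.
  by field; rewrite gt_eqF.
move=> /(_ isT) H.
have mw := test_boundary_measurable (D := cube) tw.
have lp0 : 0 < l `^ p by exact: powR_gt0.
have E : (\int[row]_(x in cube) (`|l * w (x, 0%R) + 0 * w (x, 0%R)| `^ p)%:E =
    (l `^ p)%:E * \int[row]_(x in cube) (`|w (x, 0%R)| `^ p)%:E)%E.
  have mF : measurable_fun cube (EFin \o (fun x => `|w (x, 0)| `^ p)).
    by apply/measurable_EFinP; exact: measurable_powR_norm.
  rewrite -(@ge0_integralZl_EFin _ _ _ row _ (@measurable_open_cube R N) _ _ mF) ?powR_ge0//.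
    by apply: eq_integral => x _; rewrite mul0r addr0 normrM (gtr0_norm l0) powRM// ltW.
  by move=> x _; rewrite lee_fin powR_ge0.
rewrite E in H.
have {}H : (\int[row]_(x in cube) (`|w (x, 0%R)| `^ p)%:E <= ((l `^ p)^-1)%:E)%E.
  by rewrite -[X in (X <= _)%E]mul1e -(@mulVf _ (l `^ p)) ?gt_eqF// EFinM -muleA
    -[X in (_ <= X)%E]mule1 lee_wpmul2l// lee_fin invr_ge0 ltW.
apply: le_trans H _; rewrite lee_fin -powRN /l -powR12_sqrt ?(ltW l20)// -powRrM.
have -> : a / (c / 2) = (c / 2 / a) `^ (-1).
  rewrite powR_inv1; last exact: ltW.
  by field; rewrite !gt_eqF.
rewrite -powRrM (_ : 2^-1 * - p = -1 * (p / 2))//; by field.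
Qed.

(** The trace inequality that [v] provides is applied to [u_ n - w]; the energy tolerance [a] is
    chosen so that (a/c)^(p/2) = eps. *)
Lemma trace_test (v : @Xspace R N s m) T (w : 'rV[R]_N * R -> R) (tw : test_function s m w) :
  is_trace v T -> is_trace (Xspace_of_test tw) (fun x => w (x, 0)).
Proof.
move=> /trace_bound[c c0 cP]; split; first exact: test_boundary_measurable tw.
move=> u_ [tu_ eu].
have p0 : 0 < p by apply: lt_le_trans p1.
have I0 n : (0 <= \int[row]_(x in cube) (`|u_ n (x, 0) - w (x, 0)| `^ p)%:E)%E.
  by apply: integral_ge0 => x _; rewrite lee_fin powR_ge0.
apply/(ecvg0P I0) => eps eps0.
pose a := c * eps `^ (2 / p).
have a0 : 0 < a by rewrite mulr_gt0// powR_gt0.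
have /(_ a a0) := (ecvg0P (fun n => energy_ge0 _ _ _ _)).1 eu.
apply: filterS => n en_.
have [td _] := test_lin 1 (- 1) (tu_ n) tw.
have := cP _ a td a0.
have -> : (en (fun z => (1 * u_ n z + - 1 * w z)%R) <= a%:E)%E.
  apply: le_trans en_.
  rewrite le_eqVlt; apply/orP; left; apply/eqP; apply: eq_integral => z /set_mem Hz.
  apply: (congr1 EFin).
  apply: (@eq_dens _ _ s m (fun z => 1 * u_ n z + -1 * w z) (gradient (fun z => 1 * u_ n z + -1 * w z))
    (fun z => u_ n z - w z) (fun k z => gradient (u_ n) k z - gradient w k z)); [by []|by rewrite /=; ring|].
  move=> k; have [[su _ _] [sw _ _]] := (tu_ n, tw).
  rewrite gradient_lin//=; [ring|exact: HC_Ho Hz].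
move=> /(_ isT) H.
rewrite (_ : (\int[row]_(x in cube) _)%E =
    (\int[row]_(x in cube) (`|1 * u_ n (x, 0) + -1 * w (x, 0)| `^ p)%:E)%E); last first.
  by apply: eq_integral => x _; congr (`|_| `^ _)%:E; ring.
apply: le_trans H _; rewrite lee_fin /a mulrAC mulfV ?gt_eqF// mul1r -powRrM.
rewrite (_ : 2 / p * (p / 2) = 1) ?powRr1 ?(ltW eps0)//.
by field; rewrite gt_eqF.
Qed.

(** [Tr] is a chosen representative and is identified with the restriction almost everywhere: along
    the constant approximating sequence the distance integral is a constant that tends to 0. *)
Lemma Tr_test (v : @Xspace R N s m) T (w : 'rV[R]_N * R -> R) (tw : test_function s m w) :
  is_trace v T -> measurable_fun cube (Tr (Xspace_of_test tw)) /\
    {ae row, forall x, cube x -> Tr (Xspace_of_test tw) x = w (x, 0)}.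
Proof.
move=> trv; have tt := trace_test tw trv.
have [mT cT] : is_trace (Xspace_of_test tw) (Tr (Xspace_of_test tw)).
  exact: (xgetPex _ (ex_intro _ _ tt)).
split => //.
have app := test_approximates tw.
have := cT _ app.
set I := (\int[row]_(x in cube) _)%E => cI.
have {cI} I0 : I = 0%E.
  have c0 : (fun _ : nat => I) @ \oo --> I by exact: cvg_cst.
  exact: cvg_unique c0 cI.
have mw := test_boundary_measurable (D := cube) tw.
have mF : measurable_fun cube (fun x => `|w (x, 0) - Tr (Xspace_of_test tw) x| `^ p).
  by apply: measurable_powR_norm; exact: measurable_funB.
have /ae_eq_integral_abs : (\int[row]_(x in cube) `|(`|w (x, 0%R) - Tr (Xspace_of_test tw) x| `^ p)%:E|)%E = 0%E.
  by rewrite -[RHS]I0; apply: eq_integral => x _; rewrite gee0_abs// lee_fin powR_ge0.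
move=> /(_ (@measurable_open_cube R N)) /(_ (iffRL (measurable_EFinP _ _) mF)).
apply: filterS => x + Cx; move=> /(_ Cx) [/powR_eq0_eq0/eqP].
by rewrite normr_eq0 subr_eq0 => /eqP.
Qed.

End free_trace.

(** * The basic estimate for differences of the trace *)

Lemma lin_lt_pinfty {R : realType} (a b : R) (x y : \bar R) : 0 <= a -> 0 <= b ->
  (x < +oo)%E -> (y < +oo)%E -> (a%:E * x + b%:E * y < +oo)%E.
Proof.
by move=> a0 b0 xo yo; apply: lte_add_pinfty; apply: lte_mul_pinfty; rewrite ?lee_fin.
Qed.

Section real_integrals.
Context d (T : measurableType d) (R : realType) (mu : {measure set T -> \bar R}) (D : set T).
Hypothesis mD : measurable D.
Implicit Types (f : T -> R) (a : R).

Lemma Rint_norm_le f a : measurable_fun D f -> (\int[mu]_(x in D) (`|f x|)%:E <= a%:E)%E ->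
  `|\int[mu]_(x in D) f x| <= a.
Proof.
move=> mf fa; rewrite -lee_fin EFin_normr_Rintegral//.
  apply: le_trans fa; apply: (le_trans (le_abse_integral mu mD _)) => //.
  exact/measurable_EFinP.
by apply: int_fin_integrable => //; exact: le_lt_trans fa (ltry _).
Qed.

Lemma Rint_sub_le f1 f2 f3 a : mu.-integrable D (EFin \o f1) -> mu.-integrable D (EFin \o f2) ->
  (forall x, D x -> f1 x - f2 x = f3 x) ->
  (\int[mu]_(x in D) (`|f3 x|)%:E <= a%:E)%E ->
  `|\int[mu]_(x in D) f1 x - \int[mu]_(x in D) f2 x| <= a.
Proof.
move=> I1 I2 E fa; rewrite -RintegralB//; apply: Rint_norm_le.
  by apply: measurable_funB; apply/measurable_EFinP; [case/integrableP: I1|case/integrableP: I2].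
apply: le_trans fa; rewrite le_eqVlt; apply/orP; left; apply/eqP.
by apply: eq_integral => x /set_mem Dx; rewrite E.
Qed.

End real_integrals.

Section periodic_functions.
Context {R : realType} {N : nat}.
Local Notation row := (lebesgue_row N).
Local Notation cube := (@open_cube R N).
Local Notation "'\In_' x F" := (\int[row]_(x in cube) (F%R)%:E)%E (at level 36, x name, F at level 36).
Implicit Types (F G g : 'rV[R]_N -> R) (h : 'rV[R]_N) (e p q : R).

Definition periodic_row F := forall i x, F (x + period i) = F x.

(** Boundary counterpart of [shift_diff], alike down to the factor 1, so that
    [shift_diff h e u (x, 0)] is by computation the [bdiff h e] of the restriction of [u]. *)
Definition bdiff h e F : 'rV[R]_N -> R := fun x => 1 * F (x + h) + (- e) * F x.

Lemma measurable_shift_row h F : measurable_fun [set: 'rV[R]_N] F ->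
  measurable_fun [set: 'rV[R]_N] (fun x => F (x + h)).
Proof. by move=> mF; exact: (measurableT_comp mF (measurable_addrow h)). Qed.

Lemma measurable_bdiff h e F : measurable_fun [set: 'rV[R]_N] F ->
  measurable_fun [set: 'rV[R]_N] (bdiff h e F).
Proof.
move=> mF; apply: measurable_funD; apply: measurable_funM; try exact: measurable_cst.
  exact: measurable_shift_row.
exact: mF.
Qed.

Lemma periodic_shift h F : periodic_row F -> periodic_row (fun x => F (x + h)).
Proof. by move=> pF i x; rewrite addrAC pF. Qed.

Lemma periodic_bdiff h e F : periodic_row F -> periodic_row (bdiff h e F).
Proof. by move=> pF i x; rewrite /bdiff periodic_shift// pF. Qed.

Lemma int_shift (f : R -> R) F h : (forall i, `|h ord0 i| <= 2 * pi) ->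
  measurable_fun [set: R] f -> (forall t, 0 <= f t) ->
  measurable_fun [set: 'rV[R]_N] F -> periodic_row F ->
  (\In_x (f (F (x + h))) = \In_x (f (F x)))%E.
Proof.
move=> hb mf f0 mF pF; apply: (integral_cube_shift (f := fun x => (f (F x))%:E)) => //.
- by apply/measurable_EFinP; exact: measurableT_comp.
- by move=> x; rewrite lee_fin.
- by move=> i x; rewrite pF.
Qed.

Lemma int_bdiff_le h e F p : (forall i, `|h ord0 i| <= 2 * pi) -> `|e| <= 1 -> 0 <= p ->
  measurable_fun [set: 'rV[R]_N] F -> periodic_row F ->
  (\In_x (`|bdiff h e F x| `^ p) <= (2 * 2 `^ p)%:E * \In_x (`|F x| `^ p))%E.
Proof.
move=> hb e1 p0 mF pF.
have mS : measurable_fun [set: 'rV[R]_N] (fun x => F (x + h)) by exact: measurable_shift_row.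
have mT D (G : 'rV[R]_N -> R) : measurable_fun [set: 'rV[R]_N] G -> measurable_fun D G.
  by move=> mG; exact: measurable_funTS mG.
apply: (@le_trans _ _ ((2 `^ p)%:E * \In_x (`|F (x + h)| `^ p) + (2 `^ p)%:E * \In_x (`|F x| `^ p))%E).
  apply: int_lin_le; rewrite ?powR_ge0//.
  - exact: measurable_open_cube.
  - by apply: measurable_powR_norm; apply: mT; exact: measurable_bdiff.
  - by apply: measurable_powR_norm; exact: mT.
  - by apply: measurable_powR_norm; exact: mT.
  move=> x _; rewrite powR_ge0 -mulrDr/=.
  apply: le_trans (powR_addle _ _ p0); rewrite ?normr_ge0//.
  apply: ge0_powR_le => //; rewrite normr_ge0/=.
  apply: le_trans (ler_normD _ _) _; rewrite mul1r lerD2l normrM normrN.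
  by rewrite ler_piMl.
rewrite (int_shift (f := fun t => `|t| `^ p) hb) //; last first.
  by apply: measurable_powR_norm; exact: measurable_id.
rewrite -ge0_muleDl ?lee_fin ?powR_ge0// -EFinD.
by rewrite (_ : 2 `^ p + 2 `^ p = 2 * 2 `^ p)//; ring.
Qed.

Lemma int_young g F l p q : 1 < p -> q = p / (p - 1) -> 0 < l ->
  measurable_fun cube g -> measurable_fun cube F ->
  (\In_x (`|g x| * `|F x|) <= l%:E * \In_x (`|g x| `^ q) + (l `^ (1 - p))%:E * \In_x (`|F x| `^ p))%E.
Proof.
move=> p1 qE l0 mg mF; apply: int_lin_le; rewrite ?powR_ge0 ?(ltW l0)//.
- exact: measurable_open_cube.
- by apply: measurable_funM; exact: measurableT_comp.
- exact: measurable_powR_norm.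
- exact: measurable_powR_norm.
move=> x _; rewrite mulr_ge0//=.
exact: young_split.
Qed.

Lemma int_pow_ge0 F p : (0 <= \In_x (`|F x| `^ p))%E.
Proof. by apply: integral_ge0 => x _; rewrite lee_fin powR_ge0. Qed.

Lemma integrable_prod g F p q : 1 < p -> q = p / (p - 1) ->
  measurable_fun cube g -> measurable_fun cube F ->
  (\In_x (`|g x| `^ q) < +oo)%E -> (\In_x (`|F x| `^ p) < +oo)%E ->
  row.-integrable cube (EFin \o (fun x => g x * F x)).
Proof.
move=> p1 qE mg mF fg fF; apply: int_fin_integrable; first exact: measurable_funM.
under eq_integral do rewrite normrM.
apply: le_lt_trans (int_young p1 qE ltr01 mg mF) _.
by apply: lin_lt_pinfty; [exact: ler01|exact: powR_ge0|exact: fg|exact: fF].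
Qed.

(** The conjugate moments of [g] and [F] make each product integrable, so the difference splits and
    one piece is translated over a period. *)
Lemma Rint_bdiff_adjoint h e g F p q : (forall i, `|h ord0 i| <= 2 * pi) -> `|e| <= 1 ->
  1 < p -> q = p / (p - 1) ->
  measurable_fun [set: 'rV[R]_N] g -> measurable_fun [set: 'rV[R]_N] F ->
  periodic_row g -> periodic_row F ->
  (\In_x (`|g x| `^ q) < +oo)%E -> (\In_x (`|F x| `^ p) < +oo)%E ->
  \int[row]_(x in cube) (g x * bdiff (- h) e F x) = \int[row]_(x in cube) (bdiff h e g x * F x).
Proof.
move=> hb e1 p1 qE mg mF pg pF fg fF.
have nb i : `|(- h) ord0 i| <= 2 * pi by rewrite mxE normrN.
have mT D (G : 'rV[R]_N -> R) : measurable_fun [set: 'rV[R]_N] G -> measurable_fun D G.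
  by move=> mG; exact: measurable_funTS mG.
have mC := @measurable_open_cube R N.
have mpow r : measurable_fun [set: R] (fun t : R => `|t| `^ r).
  by apply: measurable_powR_norm; exact: measurable_id.
have I0 := integrable_prod p1 qE (mT _ _ mg) (mT _ _ mF) fg fF.
have I1 : row.-integrable cube (EFin \o (fun x => g x * F (x - h))).
  apply: (integrable_prod p1 qE); [exact: mT|by apply: mT; exact: measurable_shift_row|exact: fg|].
  by rewrite (int_shift (f := fun t => `|t| `^ p) nb (mpow p) _ mF pF) => [|t]; [exact: fF|exact: powR_ge0].
have I2 : row.-integrable cube (EFin \o (fun x => g (x + h) * F x)).
  apply: (integrable_prod p1 qE); [by apply: mT; exact: measurable_shift_row|exact: mT| |exact: fF].
  by rewrite (int_shift (f := fun t => `|t| `^ q) hb (mpow q) _ mg pg) => [|t]; [exact: fg|exact: powR_ge0].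
have S : \int[row]_(x in cube) (g x * F (x - h)) = \int[row]_(x in cube) (g (x + h) * F x).
  apply: (congr1 fine).
  rewrite -[RHS](@signed_integral_cube_shift _ _ _ (- h))//.
  - by apply: eq_integral => x _; rewrite subrK.
  - by apply/measurable_EFinP; apply: measurable_funM => //; exact: measurable_shift_row.
  - by move=> i x; rewrite addrAC pg pF.
have iZ (c : R) (G : 'rV[R]_N -> R) : row.-integrable cube (EFin \o G) -> row.-integrable cube (EFin \o (fun z => c * G z)).
  by move=> iG; exact: (integrableZl mC c iG).
transitivity (1 * \int[row]_(x in cube) (g x * F (x - h)) + - e * \int[row]_(x in cube) (g x * F x)).
  rewrite -!RintegralZl// -RintegralD//; try by apply: iZ.
  by apply: eq_Rintegral => x _; rewrite /bdiff; ring.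
rewrite S -!RintegralZl// -RintegralD//; try by apply: iZ.
by apply: eq_Rintegral => x _; rewrite /bdiff; ring.
Qed.

End periodic_functions.

Section key_estimate.
Context {R : realType} {N : nat} (s m : R).
Local Notation p := (crit_exp N s).
Local Notation q := (p / (p - 1)).
Local Notation row := (lebesgue_row N).
Local Notation cube := (@open_cube R N).
Local Notation cyl := (@lebesgue_cyl R N).
Local Notation HC := (@half_cylinder R N).
Local Notation "'\In_' x F" := (\int[row]_(x in cube) (F%R)%:E)%E (at level 36, x name, F at level 36).
Local Notation en u := (energy s m u (gradient u)).

Variables (v : @Xspace R N s m) (T g : 'rV[R]_N -> R) (kap : R).
Hypothesis p1 : 1 < p.
Hypothesis trv : is_trace v T.
Hypothesis mT : measurable_fun [set: 'rV[R]_N] T.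
Hypothesis perT : periodic_row T.
Hypothesis mg : measurable_fun [set: 'rV[R]_N] g.
Hypothesis perg : periodic_row g.
Hypothesis fin_g : (\In_x (`|g x| `^ q) < +oo)%E.
Hypothesis weak : forall phi, test_function s m phi ->
  \int[cyl]_(z in HC) bil s m (Xfun v) (Xgrad v) phi (gradient phi) z =
  kap * \int[row]_(x in cube) (g x * phi (x, 0)).

Let p0 : 0 <= p. Proof. exact: le_trans (ltW p1). Qed.
Let q0 : 0 < q. Proof. by rewrite divr_gt0 ?subr_gt0// (lt_trans _ p1). Qed.

Let mTS D (G : 'rV[R]_N -> R) : measurable_fun [set: 'rV[R]_N] G -> measurable_fun D G.
Proof. by move=> mG; exact: measurable_funTS mG. Qed.

Lemma test_trace_fin (w : 'rV[R]_N * R -> R) : test_function s m w -> (\In_x (`|w (x, 0)| `^ p) < +oo)%E.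
Proof.
move=> tw; have [c c0 cP] := trace_bound (ltW p1) trv.
have fw : en w \is a fin_num by rewrite ge0_fin_numE ?energy_ge0//; case: tw.
apply: le_lt_trans (cP w (fine (en w) + 1) tw _ _) (ltry _).
  by rewrite ltr_wpDl ?fine_ge0 ?energy_ge0.
by rewrite EFinD fineK// leeDl.
Qed.

Lemma measurable_boundary (w : 'rV[R]_N * R -> R) : test_function s m w ->
  measurable_fun [set: 'rV[R]_N] (fun x => w (x, 0)).
Proof. by move=> tw; exact: (test_boundary_measurable tw). Qed.

Lemma periodic_boundary (w : 'rV[R]_N * R -> R) : test_function s m w -> periodic_row (fun x => w (x, 0)).
Proof. by case=> _ pw _ i x; rewrite pw. Qed.

Lemma fin_T : (\In_x (`|T x| `^ p) < +oo)%E.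
Proof.
have [u_ [tu_ eu]] := X_approximable v.
have /ecvg0P H := trv.2 _ (conj tu_ eu).
have [n _ /(_ n (leqnn n)) Hn] := H (fun n => int_pow_ge0 _ _) 1 ltr01.
have mu := measurable_boundary (tu_ n).
have E : (\In_x (`|T x| `^ p) = \In_x (`|u_ n (x, 0) + - (u_ n (x, 0) - T x)| `^ p))%E.
  by apply: eq_integral => x _; congr (`|_| `^ _)%:E; ring.
rewrite E; apply: le_lt_trans (int_powD_le p0 _ _) _.
- exact: mTS.
- by apply: mTS; apply: measurable_funN; exact: measurable_funB.
apply: lin_lt_pinfty; [exact: powR_ge0|exact: powR_ge0|exact: test_trace_fin|].
by under eq_integral do rewrite normrN; exact: le_lt_trans Hn (ltry _).
Qed.

Lemma energy_bounded (u_ : nat -> 'rV[R]_N * R -> R) : approximates s m u_ (Xfun v) (Xgrad v) ->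
  exists2 M : R, 0 < M & \forall n \near \oo, (en (u_ n) <= M%:E)%E.
Proof.
move=> [tu_ eu].
have /(_ _ ltr01) H := (ecvg0P (fun n => energy_ge0 _ _ _ _)).1 eu.
have [n0 _ /(_ n0 (leqnn n0)) Hn0] := H.
have fu n : measurable_field (u_ n) (gradient (u_ n)) by apply: smooth_field; have [] := tu_ n.
have fd n := field_sub (fu n) (X_field v).
have Ev : (energy s m (Xfun v) (Xgrad v) < +oo)%E.
  apply: (le_lt_trans (@energy_lin_le R N s m 1 (-1) _ _ _ _ _ _ (X_field v) (fu n0) (fd n0) _ _)).
  - by move=> z _; ring.
  - by move=> k z _; ring.
  apply: lin_lt_pinfty.
  - by apply: mulr_ge0; rewrite ?sqr_ge0.
  - by apply: mulr_ge0; rewrite ?sqr_ge0.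
  - by have [] := tu_ n0.
  exact: le_lt_trans Hn0 (ltry _).
have fEv : energy s m (Xfun v) (Xgrad v) \is a fin_num by rewrite ge0_fin_numE ?energy_ge0.
exists (2 + 2 * fine (energy s m (Xfun v) (Xgrad v))).
  by rewrite ltr_wpDr// mulr_ge0// fine_ge0// energy_ge0.
apply: filterS H => n Hn.
apply: (le_trans (@energy_lin_le R N s m 1 1 _ _ _ _ _ _ (fu n) (fd n) (X_field v) _ _)).
- by move=> z _; ring.
- by move=> k z _; ring.
have -> : (2 + 2 * fine (energy s m (Xfun v) (Xgrad v)))%:E = (2%:E * 1%:E + 2%:E * energy s m (Xfun v) (Xgrad v))%E.
  by rewrite -[in RHS](fineK fEv) -!EFinM -EFinD mulr1.
by rewrite expr1n mulr1; apply: leeD => //; apply: lee_wpmul2l.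
Qed.

Lemma cvg_boundary (u_ : nat -> 'rV[R]_N * R -> R) : approximates s m u_ (Xfun v) (Xgrad v) ->
  forall C eps : R, 0 <= C -> 0 < eps ->
  \forall n \near \oo, (C%:E * \In_x (`|u_ n (x, 0) - T x| `^ p) <= eps%:E)%E.
Proof.
move=> /trv.2/(ecvg0P (fun n => int_pow_ge0 _ _)) H C eps C0 eps0.
have d0 : 0 < eps / (C + 1) by rewrite divr_gt0// ltr_wpDl.
apply: filterS (H _ d0) => n Hn; apply: le_trans (lee_wpmul2l _ Hn) _; rewrite ?lee_fin//.
rewrite mulrA ler_pdivrMr ?ltr_wpDl// mulrC ler_wpM2l ?(ltW eps0)// lerDl//.
Qed.

(** The weak equation speaks of [v], the chain rule of a test function [u]; [d] is the price of
    exchanging one for the other in the bilinear form. *)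
Lemma weak_test_bound (u phi : 'rV[R]_N * R -> R) (d : R) : test_function s m u -> test_function s m phi ->
  (\int[cyl]_(z in HC) (`|bil s m (fun z => u z - Xfun v z)%R (fun k z => gradient u k z - Xgrad v k z)%R
     phi (gradient phi) z|)%:E <= d%:E)%E ->
  (energy s m (Xfun v) (Xgrad v) < +oo)%E ->
  \int[cyl]_(z in HC) bil s m u (gradient u) phi (gradient phi) z <=
    `|kap| * `|\int[row]_(x in cube) (g x * phi (x, 0))| + d.
Proof.
move=> tu tp dle Ev.
have fp := smooth_field (test_smooth tp).
have I1 := test_integrable_bil tu tp.
have I2 := integrable_bil (X_field v) fp Ev (let: And3 _ _ H := tp in H).
have := Rint_sub_le (@measurable_half_cylinder R N) I1 I2 _ dle.
rewrite weak// => /(_ _)/(le_trans (ler_norm _)).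
rewrite lerBlDl => H; apply: le_trans (H _) _.
  move=> z _; rewrite /bil -mulrBr; congr (_ * _).
  under [in RHS]eq_bigr do rewrite mulrBl.
  rewrite sumrB; ring.
by rewrite lerD2r -normrM ler_norm.
Qed.

Lemma energy_v_fin : (energy s m (Xfun v) (Xgrad v) < +oo)%E.
Proof.
have [u_ [tu_ eu]] := X_approximable v.
have /(_ _ ltr01) [n0 _ /(_ n0 (leqnn n0)) Hn0] := (ecvg0P (fun n => energy_ge0 _ _ _ _)).1 eu.
have fu : measurable_field (u_ n0) (gradient (u_ n0)) by apply: smooth_field; have [] := tu_ n0.
apply: (le_lt_trans (@energy_lin_le R N s m 1 (-1) _ _ _ _ _ _ (X_field v) fu (field_sub fu (X_field v)) _ _)).
- by move=> z _; ring.
- by move=> k z _; ring.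
apply: lin_lt_pinfty.
- by apply: mulr_ge0; rewrite ?sqr_ge0.
- by apply: mulr_ge0; rewrite ?sqr_ge0.
- by have [] := tu_ n0.
exact: le_lt_trans Hn0 (ltry _).
Qed.

Section fixed_parameters.
Variables (h : 'rV[R]_N) (e eps b e0 : R).
Implicit Types F G : 'rV[R]_N -> R.
Hypothesis hb : forall i, `|h ord0 i| <= 2 * pi.
Hypothesis e1 : `|e| <= 1.
Hypothesis eps01 : 0 < eps <= 1.
Hypothesis b0 : 0 <= b.
Hypothesis e00 : 0 < e0.
Local Notation L := (eps^-1 `^ b * (1 + 2 * b)).
Local Notation w u := (shift_diff h e u).
Local Notation psi u := (fun z => tprof eps b (shift_diff h e u z)).
Local Notation phi u := (shift_diff (- h) e (fun z => tprof eps b (shift_diff h e u z))).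
Local Notation wT := (bdiff h e T).
Local Notation psiT := (fun x => tprof eps b (bdiff h e T x)).
Local Notation phiT := (bdiff (- h) e (fun x => tprof eps b (bdiff h e T x))).

Let nb i : `|(- h) ord0 i| <= 2 * pi. Proof. by rewrite mxE normrN. Qed.

Let L0 : 0 <= L. Proof. by apply: mulr_ge0; rewrite ?powR_ge0// addr_ge0// mulr_ge0. Qed.

(** The bound depends on the truncation through [L] but not on the approximating index, which
    suffices because [eps] is fixed while that index grows. The 16 is a factor 4 for each of the two
    difference operators. *)
Lemma test_phi u (M : R) : test_function s m u -> (en u <= M%:E)%E ->
  [/\ test_function s m (w u), test_function s m (psi u), test_function s m (phi u) &
      (en (phi u) <= (16 * L ^+ 2 * M)%:E)%E].
Proof.
move=> tu uM; have [tw ew] := test_shift_diff hb e1 tu.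
have [tp ep] := test_tprof eps01 b0 tw.
have [tphi ephi] := test_shift_diff nb e1 tp.
split => //; apply: le_trans ephi _.
have -> : (16 * L ^+ 2 * M)%:E = (4%:E * ((L ^+ 2)%:E * (4%:E * M%:E)))%E.
  by rewrite -!EFinM; congr EFin; ring.
apply: lee_wpmul2l => //; apply: le_trans ep _; apply: lee_wpmul2l; first by rewrite lee_fin sqr_ge0.
by apply: le_trans ew _; apply: lee_wpmul2l.
Qed.

Let mtprof g0 F : measurable_fun [set: 'rV[R]_N] F -> measurable_fun [set: 'rV[R]_N] (fun x => tprof eps g0 (F x)).
Proof.
move=> mF; apply: (measurableT_comp _ mF); apply: continuous_measurable_fun => t.
have /andP[eps0 _] := eps01.
by apply: differentiable_continuous; apply/derivable1_diffP; have [] := is_derive_tprof g0 t eps0.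
Qed.

Let pertprof g0 F : periodic_row F -> periodic_row (fun x => tprof eps g0 (F x)).
Proof. by move=> pF i x; rewrite pF. Qed.

Let mphi F : measurable_fun [set: 'rV[R]_N] F ->
  measurable_fun [set: 'rV[R]_N] (bdiff (- h) e (fun x => tprof eps b (bdiff h e F x))).
Proof. by move=> mF; apply: measurable_bdiff; apply: mtprof; exact: measurable_bdiff. Qed.

Lemma int_tprof_diff_le g0 F G : 0 <= g0 -> measurable_fun [set: 'rV[R]_N] F -> measurable_fun [set: 'rV[R]_N] G ->
  periodic_row F -> periodic_row G ->
  (\In_x (`|tprof eps g0 (bdiff h e F x) - tprof eps g0 (bdiff h e G x)| `^ p) <=
   ((eps^-1 `^ g0 * (1 + 2 * g0)) `^ p * (2 * 2 `^ p))%:E * \In_x (`|F x - G x| `^ p))%E.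
Proof.
move=> g00 mF mG pF pG.
pose D' x := F x - G x.
have Lg0 : 0 <= eps^-1 `^ g0 * (1 + 2 * g0) by apply: mulr_ge0; rewrite ?powR_ge0// addr_ge0// mulr_ge0.
have mD' : measurable_fun [set: 'rV[R]_N] D' by exact: measurable_funB.
have pD' : periodic_row D' by move=> i x; rewrite /D' pF pG.
rewrite [X in (_ <= X * _)%E]EFinM -muleA.
apply: (@le_trans _ _ (((eps^-1 `^ g0 * (1 + 2 * g0)) `^ p)%:E * \In_x (`|bdiff h e D' x| `^ p)))%E; last first.
  apply: lee_wpmul2l; first by rewrite lee_fin powR_ge0.
  exact: (int_bdiff_le hb e1 p0 mD' pD').
apply: int_scale_le.
- exact: measurable_open_cube.
- by apply: measurable_powR_norm; apply: mTS; apply: measurable_funB; apply: mtprof; exact: measurable_bdiff.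
- by apply: measurable_powR_norm; apply: mTS; exact: measurable_bdiff.
- exact: powR_ge0.
- by move=> x _; exact: powR_ge0.
move=> x _; rewrite powR_ge0/= -powRM//.
apply: ge0_powR_le => //; rewrite normr_ge0/=.
have -> : bdiff h e D' x = bdiff h e F x - bdiff h e G x by rewrite /bdiff /D'; ring.
exact: tprof_lip.
Qed.

Lemma int_phi_diff_le F G : measurable_fun [set: 'rV[R]_N] F -> measurable_fun [set: 'rV[R]_N] G ->
  periodic_row F -> periodic_row G ->
  (\In_x (`|bdiff (- h) e (fun x => tprof eps b (bdiff h e F x)) x -
           bdiff (- h) e (fun x => tprof eps b (bdiff h e G x)) x| `^ p) <=
   ((2 * 2 `^ p) * (L `^ p * (2 * 2 `^ p)))%:E * \In_x (`|F x - G x| `^ p))%E.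
Proof.
move=> mF mG pF pG.
pose D x := tprof eps b (bdiff h e F x) - tprof eps b (bdiff h e G x).
have mD : measurable_fun [set: 'rV[R]_N] D.
  by apply: measurable_funB; apply: mtprof; exact: measurable_bdiff.
have pD : periodic_row D by move=> i x; rewrite /D !periodic_bdiff.
rewrite (_ : (\In_x _)%E = \In_x (`|bdiff (- h) e D x| `^ p)); last first.
  by apply: eq_integral => x _; congr (`|_| `^ _)%:E; rewrite /bdiff /D; ring.
apply: le_trans (int_bdiff_le nb e1 p0 mD pD) _.
rewrite [X in (_ <= X * _)%E]EFinM -muleA; apply: lee_wpmul2l; first by rewrite lee_fin mulr_ge0// powR_ge0.
exact: int_tprof_diff_le.
Qed.

Lemma fin_tprof g0 F : 0 <= g0 -> measurable_fun [set: 'rV[R]_N] F -> periodic_row F ->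
  (\In_x (`|F x| `^ p) < +oo)%E ->
  (\In_x (`|tprof eps g0 (bdiff h e F x)| `^ p) < +oo)%E.
Proof.
move=> g00 mF pF fF.
have := @int_tprof_diff_le g0 F (fun _ => 0) g00 mF (measurable_cst _) pF (fun _ _ => erefl).
have E1 : (\In_x (`|F x - 0| `^ p) = \In_x (`|F x| `^ p))%E.
  by apply: eq_integral => x _; rewrite subr0.
rewrite E1 => H; apply: le_lt_trans (le_trans _ H) _.
  rewrite le_eqVlt; apply/orP; left; apply/eqP; apply: eq_integral => x _.
  by rewrite {3}/bdiff mulr0 mulr0 addr0 tprof0 subr0.
apply: lte_mul_pinfty; [|by []|exact: fF].
by rewrite lee_fin; apply: mulr_ge0; [exact: powR_ge0|apply: mulr_ge0; [by []|exact: powR_ge0]].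
Qed.

Lemma fin_phi F : measurable_fun [set: 'rV[R]_N] F -> periodic_row F ->
  (\In_x (`|F x| `^ p) < +oo)%E ->
  (\In_x (`|bdiff (- h) e (fun x => tprof eps b (bdiff h e F x)) x| `^ p) < +oo)%E.
Proof.
move=> mF pF fF.
have := @int_phi_diff_le F (fun _ => 0) mF (measurable_cst _) pF (fun _ _ => erefl).
have E1 : (\In_x (`|F x - 0| `^ p) = \In_x (`|F x| `^ p))%E.
  by apply: eq_integral => x _; rewrite subr0.
rewrite E1 => H; apply: le_lt_trans (le_trans _ H) _.
  rewrite le_eqVlt; apply/orP; left; apply/eqP; apply: eq_integral => x _.
  by rewrite /bdiff mulr0 mulr0 addr0 tprof0 mulr0 mulr0 addr0 subr0.
apply: lte_mul_pinfty; [|by []|exact: fF].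
rewrite lee_fin; apply: mulr_ge0; first by apply: mulr_ge0; [by []|exact: powR_ge0].
by apply: mulr_ge0; [exact: powR_ge0|apply: mulr_ge0; [by []|exact: powR_ge0]].
Qed.

(** Three contributions of size [e0] make up 2 |kap| + 1: one for replacing [v] by [u_ n] in the
    form and, each multiplied by |kap|, one for replacing [T] by the restriction of [u_ n] and one
    for the boundary integral with [T] itself. The replacements are made small by taking n large. *)
Lemma key_energy (u_ : nat -> 'rV[R]_N * R -> R) : approximates s m u_ (Xfun v) (Xgrad v) ->
  (\In_x (`|bdiff h e g x| * `|tprof eps b (bdiff h e T x)|) <= e0%:E)%E ->
  \forall n \near \oo,
    (en (fun z => tprof eps (b / 2) (w (u_ n) z))%R <= ((1 + b) * (2 * `|kap| + 1) * e0)%:E)%E.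
Proof.
move=> au small.
have [M M0 nM] := energy_bounded au.
have [tu_ eu] := au.
set M' := 16 * L ^+ 2 * M + 1.
have M'0 : 0 < M' by apply: ltr_wpDl => //; apply: mulr_ge0; [apply: mulr_ge0 => //; exact: sqr_ge0|exact: ltW].
(* Weight for [int_bil_le]: an energy of [u_ n - v] below [e0 / (2 * l)] contributes [e0 / 2], and
   so does [M' / l]. *)
set l := 2 * M' / e0.
have l0 : 0 < l by rewrite divr_gt0// mulr_gt0.
have al0 : 0 < e0 / (2 * l) by rewrite divr_gt0// mulr_gt0.
have n1 := (ecvg0P (fun n => energy_ge0 _ _ _ _)).1 eu _ al0.
set Gq := fine (\In_x (`|g x| `^ q))%E.
have Gq0 : 0 <= Gq by rewrite fine_ge0// int_pow_ge0.
have GqE : (\In_x (`|g x| `^ q) = Gq%:E)%E.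
  by rewrite /Gq fineK// (ge0_fin_numE (int_pow_ge0 g q)); exact: fin_g.
(* Makes the [g] part of Young's inequality at most [e0 / 2]; the [+ 1] keeps the denominator
   positive. The resulting large weight on the other part is compensated by n. *)
set l2 := e0 / (2 * (Gq + 1)).
have l20 : 0 < l2 by rewrite divr_gt0// mulr_gt0// ltr_wpDl.
set Cphi := 2 * 2 `^ p * (L `^ p * (2 * 2 `^ p)).
have Cphi0 : 0 <= Cphi by do !(apply: mulr_ge0 || exact: powR_ge0 || by []).
have n2 := cvg_boundary au (mulr_ge0 (powR_ge0 l2 (1 - p)) Cphi0) (divr_gt0 e00 (ltr0Sn R 1)).
have mgT := @mTS cube _ mg.
have fT := fin_T.
have mpT := mphi mT.
have fphiT := fin_phi mT perT fT.
have IT := integrable_prod p1 erefl mgT (@mTS cube _ mpT) fin_g fphiT.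
(* Moving the outer difference operator onto [g] turns this integral into the one bounded by
   [small]. *)
have RT : `|\int[row]_(x in cube) (g x * phiT x)| <= e0.
  have mpsi : measurable_fun [set: 'rV[R]_N] psiT by apply: mtprof; exact: measurable_bdiff.
  have ppsi : periodic_row psiT by apply: pertprof; exact: periodic_bdiff.
  have fpsi := fin_tprof b0 mT perT fT.
  rewrite [X in `|X|](Rint_bdiff_adjoint hb e1 p1 erefl mg mpsi perg ppsi fin_g fpsi).
  apply: Rint_norm_le; first exact: measurable_open_cube.
    by apply: mTS; apply: measurable_funM; [exact: measurable_bdiff|apply: mtprof; exact: measurable_bdiff].
  by apply: le_trans small; under eq_integral do rewrite normrM.
near=> n.
have tu := tu_ n.
have uM : (en (u_ n) <= M%:E)%E by near: n.
have [tw tpsi tphi ephi] := test_phi tu uM.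
have uM' : (en (phi (u_ n)) <= M'%:E)%E.
  by apply: le_trans ephi _; rewrite lee_fin lerDl.
apply: le_trans (energy_tprof_le eps01 b0 tw) _.
rewrite lee_fin -mulrA; apply: ler_wpM2l; first exact: addr_ge0.
rewrite -(bil_shift_diff e hb tu tpsi).
have fp := smooth_field (test_smooth tphi).
have fu := smooth_field (test_smooth tu).
apply: le_trans (weak_test_bound (d := e0) tu tphi _ energy_v_fin) _.
  apply: le_trans (int_bil_le (a := e0 / (2 * l)) (b := M') l0 (field_sub fu (X_field v)) fp _ uM') _.
    by near: n.
  have M'n := lt0r_neq0 M'0; have e0n := lt0r_neq0 e00.
  rewrite lee_fin (_ : _ + _ = e0)// /l; move: (M') M'n => y yn.
  by field; rewrite yn e0n.
rewrite mulrDl mul1r lerD2r -mulrA [X in _ <= X]mulrCA; apply: ler_wpM2l => //.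
have mun := measurable_boundary tu.
have pun := periodic_boundary tu.
have fphin := test_trace_fin tphi.
have In := integrable_prod p1 erefl mgT (@mTS cube _ (measurable_boundary tphi)) fin_g fphin.
set J := \int[row]_(x in cube) (g x * phiT x).
rewrite [X in _ <= X](_ : _ = e0 + e0); last by ring.
rewrite -[X in `|X|](subrK J); apply: le_trans (ler_normD _ _) (lerD _ RT).
apply: (Rint_sub_le (f3 := fun x => g x * (phi (u_ n) (x, 0) - phiT x)) (@measurable_open_cube R N) In IT).
  by move=> x _; rewrite mulrBr.
under eq_integral do rewrite normrM.
have mdiff : measurable_fun [set: 'rV[R]_N] (fun x => phi (u_ n) (x, 0) - phiT x).
  by apply: measurable_funB => //; exact: measurable_boundary.
apply: le_trans (int_young p1 erefl l20 mgT (@mTS cube _ mdiff)) _.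
apply: (@le_trans _ _ ((e0 / 2)%:E + (e0 / 2)%:E)%E); last by rewrite -EFinD -splitr.
apply: leeD.
  rewrite GqE -EFinM lee_fin /l2 mulrAC ler_pdivrMr; last by apply: mulr_gt0; rewrite ?ltr_wpDl.
  rewrite (_ : e0 / 2 * (2 * (Gq + 1)) = e0 * Gq + e0); last by field.
  by rewrite lerDl ltW.
apply: (@le_trans _ _ ((l2 `^ (1 - p) * Cphi)%:E * \In_x (`|u_ n (x, 0) - T x| `^ p))%E); last by near: n.
rewrite EFinM -muleA; apply: lee_wpmul2l; first by rewrite lee_fin powR_ge0.
exact: (int_phi_diff_le mun mT pun perT).
Unshelve. all: by end_near.
Qed.

(** The trace inequality bounds the truncated power of the increment of [u_ n], and the Lipschitz
    bound for [tprof] at fixed [eps] transfers it to [T]. The bound [Kc] also serves as tolerance of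
    the transfer, hence the factor 2 * 2^p. *)
Lemma key_fixed (c : R) : 0 < c ->
  (forall (u : 'rV[R]_N * R -> R) (a : R), test_function s m u -> 0 < a -> (en u <= a%:E)%E ->
     (\In_x (`|u (x, 0)| `^ p) <= ((a / c) `^ (p / 2))%:E)%E) ->
  (\In_x (`|bdiff h e g x| * `|tprof eps b (bdiff h e T x)|) <= e0%:E)%E ->
  (\In_x (`|tprof eps (b / 2) (bdiff h e T x)| `^ p) <=
    ((2 * 2 `^ p * ((1 + b) * (2 * `|kap| + 1) / c) `^ (p / 2)) * e0 `^ (p / 2))%:E)%E.
Proof.
move=> c0 cP small.
have [u_ au] := X_approximable v.
have nE := key_energy au small.
have [tu_ eu] := au.
have b20 : 0 <= b / 2 by rewrite divr_ge0.
set A := (1 + b) * (2 * `|kap| + 1) in nE *.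
have A0 : 0 < A by apply: mulr_gt0; [exact: ltr_wpDr|exact: ltr_wpDl (mulr_ge0 _ _) _].
set Kc := (A * e0 / c) `^ (p / 2).
have Kc0 : 0 < Kc by rewrite powR_gt0// divr_gt0// mulr_gt0.
set CH := (eps^-1 `^ (b / 2) * (1 + 2 * (b / 2))) `^ p * (2 * 2 `^ p).
have CH0 : 0 <= CH by do !(apply: mulr_ge0 || exact: powR_ge0 || by []).
have n2 := cvg_boundary au CH0 Kc0.
have KE : 2 * 2 `^ p * (A / c) `^ (p / 2) * e0 `^ (p / 2) = 2 `^ p * Kc + 2 `^ p * Kc.
  have -> : Kc = (A / c) `^ (p / 2) * e0 `^ (p / 2).
    by rewrite /Kc -(powRM _ (ltW (divr_gt0 A0 c0)) (ltW e00)); congr (_ `^ _); ring.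
  by ring.
near \oo => n.
have tu := tu_ n.
have mun := measurable_boundary tu.
have pun := periodic_boundary tu.
pose Hn x := tprof eps (b / 2) (bdiff h e (fun x => u_ n (x, 0)) x).
pose H x := tprof eps (b / 2) (bdiff h e T x).
have mHn : measurable_fun cube Hn by apply: mTS; apply: mtprof; exact: measurable_bdiff.
have mH : measurable_fun cube H by apply: mTS; apply: mtprof; exact: measurable_bdiff.
have Hle : (\In_x (`|Hn x| `^ p) <= Kc%:E)%E.
  apply: (cP (fun z => tprof eps (b / 2) (w (u_ n) z))%R (A * e0)).
  - by have [] := test_tprof eps01 b20 (test_shift_diff hb e1 tu).1.
  - exact: mulr_gt0.
  - by near: n.
have dle : (\In_x (`|Hn x - H x| `^ p) <= Kc%:E)%E.
  apply: le_trans (int_tprof_diff_le b20 mun mT pun perT) _.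
  by near: n.
have -> : (\In_x (`|H x| `^ p) = \In_x (`|Hn x + - (Hn x - H x)| `^ p))%E.
  by apply: eq_integral => x _; congr (`|_| `^ _)%:E; ring.
have mD : measurable_fun cube (fun x => - (Hn x - H x)).
  by apply: measurable_funN; exact: measurable_funB.
apply: le_trans (int_powD_le p0 mHn mD) _.
rewrite KE [X in (_ <= X)%E]EFinD [X in (_ <= X + X)%E]EFinM.
apply: leeD; (apply: lee_wpmul2l; first by rewrite lee_fin powR_ge0); first exact: Hle.
by under eq_integral do rewrite normrN.
Unshelve. all: by end_near.
Qed.

End fixed_parameters.

(** The order of quantifiers is the point: uniformity in [eps] lets the truncation be removed,
    uniformity in [h] yields decay rates, and the freedom in [e] serves both iterations. *)
Lemma key_estimate (b : R) : 0 <= b -> exists2 K : R, 0 < K &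
  forall (h : 'rV[R]_N) (e eps e0 : R), (forall i, `|h ord0 i| <= 2 * pi) -> `|e| <= 1 ->
    0 < eps <= 1 -> 0 < e0 ->
    (\In_x (`|bdiff h e g x| * `|tprof eps b (bdiff h e T x)|) <= e0%:E)%E ->
    (\In_x (`|tprof eps (b / 2) (bdiff h e T x)| `^ p) <= (K * e0 `^ (p / 2))%:E)%E.
Proof.
move=> b0; have [c c0 cP] := trace_bound (ltW p1) trv.
exists (2 * 2 `^ p * ((1 + b) * (2 * `|kap| + 1) / c) `^ (p / 2)).
  apply: mulr_gt0; first by apply: mulr_gt0 => //; exact: powR_gt0.
  apply: powR_gt0; apply: divr_gt0 => //; apply: mulr_gt0; first exact: ltr_wpDr.
  by apply: ltr_wpDl => //; apply: mulr_ge0.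
move=> h e eps e0 hb e1 eps01 e00; exact: key_fixed.
Qed.

End key_estimate.

(** * Brezis-Kato iteration and self-improvement of the decay of differences *)

Section limits_of_integrals.
Context d (T : measurableType d) (R : realType) (mu : {measure set T -> \bar R}) (D : set T).
Hypothesis mD : measurable D.
Implicit Types (f G : T -> R).

Lemma fatou_le (f_ : nat -> T -> R) f (B : \bar R) : (forall n, measurable_fun D (f_ n)) ->
  (forall n x, D x -> 0 <= f_ n x) ->
  (forall x, D x -> f_ n x @[n --> \oo] --> f x) ->
  (\forall n \near \oo, (\int[mu]_(x in D) (f_ n x)%:E <= B)%E) ->
  (\int[mu]_(x in D) (f x)%:E <= B)%E.
Proof.
move=> mf f0 fc [n0 _ fB].
pose F n x := (f_ (n + n0)%N x)%:E.
have mF n : measurable_fun D (F n) by exact/measurable_EFinP.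
have F0 n x : D x -> (0 <= F n x)%E by move=> Dx; rewrite lee_fin f0.
have H := fatou mu mD mF F0.
apply: (@le_trans _ _ (\int[mu]_(x in D) limn_einf (F^~ x))%E).
  rewrite le_eqVlt; apply/orP; left; apply/eqP; apply: eq_integral => x /set_mem Dx.
  have Fc : F n x @[n --> \oo] --> (f x)%:E.
    apply: cvg_EFin; first exact: nearW.
    by rewrite /F/= (cvg_shiftn n0 (fun n => f_ n x)); exact: fc.
  by rewrite is_cvg_limn_einfE ?(cvg_lim _ Fc)//; apply/cvg_ex; eexists; exact: Fc.
apply: le_trans H _.
rewrite limn_einf_lim; apply: lime_le; first exact: is_cvg_einfs.
apply: nearW => n; apply: le_trans (ereal_inf_lbound _) (fB (n + n0)%N (leq_addl _ _)).
by exists n => //=.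
Qed.

Lemma dominated_near (f_ : nat -> T -> R) f G : (forall n, measurable_fun D (f_ n)) ->
  measurable_fun D f -> measurable_fun D G ->
  (forall x, D x -> f_ n x @[n --> \oo] --> f x) ->
  (forall n x, D x -> `|f_ n x| <= G x) -> (\int[mu]_(x in D) (G x)%:E < +oo)%E ->
  forall eta : R, 0 < eta -> \forall n \near \oo, (\int[mu]_(x in D) (`|f_ n x - f x|)%:E <= eta%:E)%E.
Proof.
move=> mf_ mf mG fc fG fin.
have iG : mu.-integrable D (EFin \o G).
  apply: int_fin_integrable => //; apply: le_lt_trans fin.
  rewrite le_eqVlt; apply/orP; left; apply/eqP; apply: eq_integral => x /set_mem Dx.
  by rewrite ger0_norm// (le_trans _ (fG 0%N x Dx)).
have ae1 : {ae mu, forall x, D x -> (EFin \o f_ n) x @[n --> \oo] --> (EFin \o f) x}.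
  by apply: aeW => x Dx; apply: cvg_EFin; [exact: nearW|exact: fc].
have ae2 : {ae mu, forall x n, D x -> (`|(EFin \o f_ n) x| <= (EFin \o G) x)%E}.
  by apply: aeW => x n Dx; rewrite /= lee_fin fG.
have [_ + _] := dominated_convergence mD (fun n => iffRL (measurable_EFinP _ _) (mf_ n))
  (iffRL (measurable_EFinP _ _) mf) ae1 iG ae2.
by move=> /(ecvg0P _).1; apply => n; apply: integral_ge0 => x _; exact: abse_ge0.
Qed.

End limits_of_integrals.

Section moments.
Context {R : realType} {N : nat}.
Local Notation row := (lebesgue_row N).
Local Notation cube := (@open_cube R N).
Local Notation "'\In_' x F" := (\int[row]_(x in cube) (F%R)%:E)%E (at level 36, x name, F at level 36).
Implicit Types (F G : 'rV[R]_N -> R) (p q b B : R).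
Let mC := @measurable_open_cube R N.

Lemma int_cst (c : R) : (\In_x c = (c * (2 * pi) ^+ N)%:E)%E.
Proof. by rewrite integral_cst//= lebesgue_row_open_cube. Qed.

Lemma fin_mono F p q : measurable_fun cube F -> 0 < p <= q ->
  (\In_x (`|F x| `^ q) < +oo)%E -> (\In_x (`|F x| `^ p) < +oo)%E.
Proof.
move=> mF pq fq.
apply: le_lt_trans (_ : (\In_x (`|F x| `^ p) <= 1%:E * \In_x 1 + 1%:E * \In_x (`|F x| `^ q))%E) _.
  apply: int_lin_le => //; try exact: measurable_powR_norm; try by move=> *; exact: powR_ge0.
  by move=> x _; rewrite powR_ge0 !mul1r powR_mono_add.
by apply: lin_lt_pinfty => //; rewrite int_cst ltry.
Qed.

(** Dominated convergence: the parts of |F|^p above the levels n + 1 are dominated by |F|^p and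
    vanish eventually at each point. *)
Lemma tail_small F p eta : 0 < eta -> measurable_fun cube F -> (\In_x (`|F x| `^ p) < +oo)%E ->
  exists2 A : R, 0 < A & (\In_x (if `|F x| <= A then 0 else `|F x| `^ p) <= eta%:E)%E.
Proof.
move=> eta0 mF fF.
have mI (A : R) : measurable_fun cube (fun x => if `|F x| <= A then 0 else `|F x| `^ p).
  apply: measurable_fun_if => //.
  - by apply: measurable_fun_ler => //; exact: measurableT_comp.
  - by apply: measurable_funS (measurable_powR_norm _ mF) => // x [].
have := @dominated_near _ _ _ row cube mC (fun n x => if `|F x| <= n.+1%:R then 0 else `|F x| `^ p)
  (fun _ => 0) (fun x => `|F x| `^ p) (fun n => mI _) (measurable_cst _) (measurable_powR_norm _ mF).
move=> /(_ _ _ fF eta eta0)[].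
- move=> x _; apply: cvg_near_cst.
  near=> n; rewrite ifT//; apply: (@le_trans _ _ n%:R); last by rewrite ler_nat.
  by near: n; exact: nbhs_infty_ger.
- by move=> n x _; case: ifP; rewrite ?normr0 ?(ger0_norm (powR_ge0 _ _))// powR_ge0.
move=> n0 _ /(_ n0 (leqnn _)) H; exists n0.+1%:R => //; apply: le_trans H.
rewrite le_eqVlt; apply/orP; left; apply/eqP; apply: eq_integral => x _.
by rewrite subr0; case: ifP; rewrite ?normr0 ?(ger0_norm (powR_ge0 _ _)).
Unshelve. all: by end_near.
Qed.

Lemma cvg_tprof b (t : R) : 0 <= b -> tprof (n.+1%:R^-1) b t @[n --> \oo] --> t * `|t| `^ (2 * b).
Proof.
move=> b0; have [->|t0] := eqVneq t 0.
  rewrite mul0r (_ : (fun n => _) = cst 0); first exact: cvg_cst.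
  by apply/funext => n; rewrite /tprof mul0r.
by apply: cvgM; [exact: cvg_cst|exact: cvg_prof].
Qed.

Lemma inv_nat01 n : 0 < (n.+1%:R^-1 : R) <= 1.
Proof. by rewrite invr_gt0 ltr0n/= invf_le1 ?ltr0n// ler1n. Qed.

Lemma measurable_tprof e b F (D : set 'rV[R]_N) : 0 < e -> measurable_fun D F ->
  measurable_fun D (fun x => tprof e b (F x)).
Proof.
move=> e0 mF; apply: (measurableT_comp _ mF); apply: continuous_measurable_fun => t.
by apply: differentiable_continuous; apply/derivable1_diffP; have [] := is_derive_tprof b t e0.
Qed.

Lemma norm_tprof_lim (t b : R) : 0 < b -> `|t * `|t| `^ (2 * b)| = `|t| `^ (1 + 2 * b).
Proof.
move=> b0; rewrite normrM (ger0_norm (powR_ge0 _ _)).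
have b1 : 0 < 2 * b by rewrite mulr_gt0.
rewrite powRD ?powRr1//; apply/implyP; rewrite gt_eqF// addr_gt0//.
Qed.

Lemma cvg_norm_powR p (u : nat -> R) (l : R) : 0 < p -> u n @[n --> \oo] --> l ->
  `|u n| `^ p @[n --> \oo] --> `|l| `^ p.
Proof.
move=> p0 ul; have nul : `|u n| @[n --> \oo] --> `|l| by exact: cvg_norm.
have [l0|l0] := eqVneq `|l| 0.
  rewrite l0 in nul *; apply/cvgrPdist_le => /= e e0.
  have e1 : 0 < e `^ p^-1 by exact: powR_gt0.
  move/cvgrPdist_le : nul => /(_ _ e1) nul; near=> n.
  rewrite (powR0 (lt0r_neq0 p0)) sub0r normrN (ger0_norm (powR_ge0 _ _)).
  apply: (@le_trans _ _ ((e `^ p^-1) `^ p)).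
    apply: ge0_powR_le; last exact: ltW.
    rewrite normr_ge0/=; suff : `|0 - `|u n| | <= e `^ p^-1 by rewrite sub0r normrN normr_id.
    by near: n.
  by rewrite -powRrM mulVf ?lt0r_neq0// powRr1// ltW.
have y1 : 0 < `|l| by rewrite lt_def l0 normr_ge0.
have C : {for `|l|, continuous (fun t : R => t `^ p)}.
  by apply: differentiable_continuous; apply/derivable1_diffP; apply: ex_derive; exact: is_derive1_powR.
exact: (cvg_comp _ _ nul C).
Unshelve. all: by end_near.
Qed.

(** Removal of the truncation: the truncated power with exponent [b / 2] tends to t |t|^b, of
    modulus |t|^(1 + b). The bound is asked only for large n, and how large may depend on other
    data. *)
Lemma fatou_tprof F p b B : 0 < p -> 0 < b -> measurable_fun cube F ->
  (\forall n \near \oo, (\In_x (`|tprof (n.+1%:R^-1) (b / 2) (F x)| `^ p) <= B%:E)%E) ->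
  (\In_x (`|F x| `^ ((1 + b) * p)) <= B%:E)%E.
Proof.
move=> p0 b0 mF H; apply: (fatou_le mC _ _ _ H).
- by move=> n; apply: measurable_powR_norm; apply: measurable_tprof.
- by move=> n x _; exact: powR_ge0.
move=> x _; have b20 : 0 < b / 2 by rewrite divr_gt0.
rewrite powRrM (_ : 1 + b = 1 + 2 * (b / 2)); last by field.
rewrite -norm_tprof_lim//.
exact: (cvg_norm_powR p0 (cvg_tprof (t := F x) (ltW b20))).
Qed.

End moments.

Lemma unbounded_expn {R : realType} (a : R) (Q : R) : 1 < a -> exists k, Q <= a ^+ k.
Proof.
move=> a1; have a10 : 0 < a - 1 by rewrite subr_gt0.
have B k : 1 + k%:R * (a - 1) <= a ^+ k.
  elim: k => [|k IH]; first by rewrite mul0r addr0 expr0.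
  rewrite exprS; apply: le_trans (ler_wpM2l (ltW (lt_trans ltr01 a1)) IH).
  have K0 : 0 <= k%:R * (a - 1) * (a - 1) by rewrite !mulr_ge0// ltW.
  rewrite -natr1; move: (k%:R : R) K0 => r; nra.
have [k _ /(_ k (leqnn k)) kP] := nbhs_infty_ger (Q / (a - 1)).
exists k; apply: le_trans (B k); rewrite ler_pdivrMr// in kP.
by apply: (le_trans kP); rewrite lerDr.
Qed.

Lemma half_absorb {R : realType} (P z : R) : z <= P + 1 / 2 * z -> z <= 2 * P.
Proof. by move=> ?; lra. Qed.

(** * All moments of the trace, then better decay of its increments *)

Section bootstrap.
Context {R : realType} {N : nat}.
Local Notation row := (lebesgue_row N).
Local Notation cube := (@open_cube R N).
Local Notation "'\In_' x F" := (\int[row]_(x in cube) (F%R)%:E)%E (at level 36, x name, F at level 36).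
Implicit Types (F G : 'rV[R]_N -> R) (h : 'rV[R]_N) (q b B C M Q r : R).
Let mC := @measurable_open_cube R N.

Variables (p Cg : R) (T g : 'rV[R]_N -> R).
Hypothesis p2 : 2 < p.
Hypothesis mT : measurable_fun [set: 'rV[R]_N] T.
Hypothesis perT : periodic_row T.
Hypothesis mg : measurable_fun [set: 'rV[R]_N] g.
Hypothesis perg : periodic_row g.
Hypothesis Cg0 : 0 < Cg.
Hypothesis gT : forall x, `|g x| <= Cg * (`|T x| + `|T x| `^ (p - 1)).
Hypothesis fin_T : (\In_x (`|T x| `^ p) < +oo)%E.
Hypothesis key : forall b : R, 0 <= b -> exists2 K : R, 0 < K &
  forall (h : 'rV[R]_N) (e eps e0 : R), (forall i, `|h ord0 i| <= 2 * pi) -> `|e| <= 1 ->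
    0 < eps <= 1 -> 0 < e0 ->
    (\In_x (`|bdiff h e g x| * `|tprof eps b (bdiff h e T x)|) <= e0%:E)%E ->
    (\In_x (`|tprof eps (b / 2) (bdiff h e T x)| `^ p) <= (K * e0 `^ (p / 2))%:E)%E.

Let p0 : 0 < p. Proof. exact: lt_trans p2. Qed.

Let mTS D F : measurable_fun [set: 'rV[R]_N] F -> measurable_fun D F.
Proof. by move=> mF; exact: measurable_funTS mF. Qed.

Lemma bdiff0 F : bdiff 0 0 F = F.
Proof. by apply/funext => x; rewrite /bdiff addr0 mul1r oppr0 mul0r addr0. Qed.

Lemma growth_moment q : 0 < q -> (\In_x (`|T x| `^ q) < +oo)%E ->
  (\In_x (`|T x| `^ ((p - 1) * q)) < +oo)%E -> (\In_x (`|g x| `^ q) < +oo)%E.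
Proof.
move=> q0 f1 f2; have mTc := @mTS cube _ mT.
have p10 : 0 < p - 1 by rewrite subr_gt0; apply: lt_trans p2; rewrite ltr1n.
apply: le_lt_trans (_ : (_ <= (Cg `^ q * 2 `^ q)%:E * \In_x (`|T x| `^ q) +
   (Cg `^ q * 2 `^ q)%:E * \In_x (`|T x| `^ ((p - 1) * q)))%E) _.
  have c0 : 0 <= Cg `^ q * 2 `^ q by apply: mulr_ge0; exact: powR_ge0.
  apply: int_lin_le => //; try by move=> *; exact: powR_ge0.
  - by apply: measurable_powR_norm; exact: mTS.
  - exact: measurable_powR_norm.
  - exact: measurable_powR_norm.
  move=> x _; rewrite powR_ge0/= -mulrDr -mulrA [`|T x| `^ (_ * _)]powRrM.
  apply: le_trans (_ : _ <= Cg `^ q * (`|T x| + `|T x| `^ (p - 1)) `^ q) _.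
    have S0 : 0 <= `|T x| + `|T x| `^ (p - 1) by rewrite addr_ge0// powR_ge0.
    rewrite -(powRM _ (ltW Cg0) S0).
    by apply: ge0_powR_le; [rewrite normr_ge0 gT|exact: ltW].
  by apply: ler_wpM2l; [exact: powR_ge0|apply: powR_addle; rewrite ?powR_ge0// ltW].
by apply: lin_lt_pinfty => //; apply: mulr_ge0; exact: powR_ge0.
Qed.

Lemma fin_tprof_T b e : 0 <= b -> 0 < e <= 1 -> (\In_x (`|tprof e b (T x)| `^ p) < +oo)%E.
Proof.
move=> b0 e01; have /andP[e0 _] := e01.
apply: le_lt_trans (_ : (_ <= ((e^-1 `^ b) `^ p)%:E * \In_x (`|T x| `^ p))%E) _.
  apply: int_scale_le => //.
  - by apply: measurable_powR_norm; apply: measurable_tprof => //; exact: mTS.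
  - by apply: measurable_powR_norm; exact: mTS.
  - exact: powR_ge0.
  move=> x _; rewrite powR_ge0/= -powRM ?powR_ge0//.
  by apply: ge0_powR_le; [rewrite normr_ge0 tprof_bound|exact: ltW].
by apply: lte_mul_pinfty; [rewrite lee_fin powR_ge0|by []|exact: fin_T].
Qed.

(* The subcritical part of g is controlled by the low moments of T; the part of
   |T|^(p - 2) above the level A is absorbed using that its L^(p/(p - 2)) norm
   is small. *)
Lemma critical_pointwise b e A l t (s : R) : 0 <= b -> 0 < e <= 1 -> 0 < A -> 0 < l ->
  `|s| <= Cg * (`|t| + `|t| `^ (p - 1)) ->
  `|s| * `|tprof e b t| <= Cg * (1 + A `^ (p - 2)) * (`|t| ^+ 2 * (1 + t ^+ 2) `^ b) +
    (Cg * l) * (if `|t| <= A then 0 else `|t| `^ p) +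
    (Cg * l `^ (1 - p / 2)) * `|tprof e (b / 2) t| `^ p.
Proof.
move=> b0 e01 A0 l0 st; have /andP[e0 _] := e01.
have p20 : 0 < p - 2 by rewrite subr_gt0.
set H := tprof e (b / 2) t.
have HG : `|t| * `|tprof e b t| = H ^+ 2.
  by rewrite -normrM -tprof_sqr// ger0_norm// sqr_ge0.
have HD : H ^+ 2 <= `|t| ^+ 2 * (1 + t ^+ 2) `^ b.
  rewrite -HG /tprof normrM mulrA -expr2; apply: ler_wpM2l; first exact: sqr_ge0.
  by rewrite ger0_norm ?prof_ub1// ltW// prof_gt0.
have H20 : 0 <= H ^+ 2 by exact: sqr_ge0.
have tp1 : `|t| `^ (p - 1) = `|t| `^ (p - 2) * `|t|.
  rewrite -{3}(powRr1 (normr_ge0 t)) -powRD; first by congr (_ `^ _); ring.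
  by apply/implyP => /eqP; lra.
apply: (@le_trans _ _ (Cg * (1 + `|t| `^ (p - 2)) * H ^+ 2)).
  rewrite -HG mulrA; apply: ler_wpM2r => //; apply: le_trans st _.
  rewrite tp1; lra.
rewrite -!mulrA -!mulrDr; apply: ler_wpM2l; first exact: ltW.
have HX : `|t| ^+ 2 * (1 + t ^+ 2) `^ b = `|t| * (`|t| * (1 + t ^+ 2) `^ b) by rewrite mulrA -expr2.
rewrite !mulrDl !mul1r -!addrA; apply: lerD; first by rewrite -?HX.
rewrite -?HX.
have [tA|tA] := leP `|t| A.
  rewrite mulr0 add0r; apply: ler_wpDr; first by apply: mulr_ge0; exact: powR_ge0.
  apply: ler_pM; [exact: powR_ge0|exact: H20| |exact: HD].
  by apply: ge0_powR_le; [rewrite normr_ge0|exact: ltW].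
apply: ler_wpDl; first by apply: mulr_ge0; [exact: powR_ge0|apply: mulr_ge0; [exact: sqr_ge0|exact: powR_ge0]].
(* Young's inequality with [p / 2] on [H ^+ 2] and the conjugate [p / (p - 2)] on |t|^(p - 2)
   returns exactly the critical powers |H|^p and |t|^p. *)
have pq1 : 1 < p / 2 by rewrite ltr_pdivlMr// mul1r.
apply: le_trans (young_split l0 (powR_ge0 _ _) H20 pq1 erefl) _.
have -> : (`|t| `^ (p - 2)) `^ (p / 2 / (p / 2 - 1)) = `|t| `^ p.
  rewrite -powRrM; congr (_ `^ _); field.
  by rewrite gt_eqF.
have -> : (H ^+ 2) `^ (p / 2) = `|H| `^ p.
  rewrite -[H ^+ 2]real_normK ?num_real// -powR_mulrn// -powRrM; congr (_ `^ _).
  by field.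
by [].
Qed.

(** By [prof_ub1] the integrand majorises |T tprof e b T| uniformly in [e]. *)
Lemma low_moment b : 0 < b -> (\In_x (`|T x| `^ (2 + 2 * b)) < +oo)%E ->
  exists2 B : R, 0 < B & (\In_x (`|T x| ^+ 2 * (1 + T x ^+ 2) `^ b) <= B%:E)%E.
Proof.
move=> b0 fb.
set I := (\In_x _)%E.
have mI : measurable_fun cube (fun x => `|T x| ^+ 2 * (1 + T x ^+ 2) `^ b).
  have mTc := @mTS cube _ mT.
  apply: measurable_funM; first by apply: measurable_funX; exact: measurableT_comp.
  apply: (measurableT_comp (measurable_powR b)); apply: measurable_funD; first exact: measurable_cst.
  exact: measurable_funX.
have If : (I < +oo)%E.
  apply: le_lt_trans (_ : (_ <= (2 `^ b)%:E * \In_x (`|T x| `^ 2) + (2 `^ b)%:E * \In_x (`|T x| `^ (2 + 2 * b)))%E) _.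
    apply: int_lin_le => //; try exact: powR_ge0; try by move=> *; exact: powR_ge0.
    - by apply: measurable_powR_norm; exact: mTS.
    - by apply: measurable_powR_norm; exact: mTS.
    move=> x _; apply/andP; split; first by apply: mulr_ge0; [exact: sqr_ge0|exact: powR_ge0].
    have E2 : `|T x| `^ 2 = `|T x| ^+ 2 by rewrite (@powR_mulrn _ _ 2).
    rewrite [`|T x| `^ (2 + _)]powRD; last by apply/implyP => /eqP; lra.
    have E3 : `|T x| `^ (2 * b) = (`|T x| ^+ 2) `^ b by rewrite powRrM E2.
    rewrite E3 E2; have := @powR_addle R 1 (`|T x| ^+ 2) b ler01 (sqr_ge0 _) (ltW b0).
    have T2 : T x ^+ 2 = `|T x| ^+ 2 by rewrite real_normK ?num_real.
    rewrite powR1 T2 => PA.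
    apply: le_trans (ler_wpM2l (sqr_ge0 _) PA) _.
    by rewrite [leLHS]mulrCA mulrDr mulr1 mulrDr.
  apply: lin_lt_pinfty; try exact: powR_ge0; last exact: fb.
  by apply: fin_mono fin_T; [exact: mTS|rewrite ltr0n/= ltW].
have I0 : (0 <= I)%E.
  by apply: integral_ge0 => x _; rewrite lee_fin; apply: mulr_ge0; [exact: sqr_ge0|exact: powR_ge0].
exists (fine I + 1); first by rewrite ltr_wpDl// fine_ge0.
by rewrite EFinD fineK ?leeDl// ge0_fin_numE.
Qed.

(** For each [e] the truncation makes [Y] finite; a bound independent of [e] is the aim. In terms of
    y = Y^(2/p), [key] reads y <= kp * e0 with e0 = a1 * B2 + Cg * th * y, which is affine in [y].
    As [th] is chosen with kp * Cg * th = 1/2, the term in [y] is absorbed on the left. *)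
Lemma brezis_kato_uniform b : 0 < b -> (\In_x (`|T x| `^ (2 + 2 * b)) < +oo)%E ->
  exists B : R, forall e, 0 < e <= 1 -> (\In_x (`|tprof e (b / 2) (T x)| `^ p) <= B%:E)%E.
Proof.
move=> b0 fb; have mTc := @mTS cube _ mT.
have [K K0 KP] := key (ltW b0).
have [B2 B20 HB2] := low_moment b0 fb.
set kp := K `^ (2 / p).
have kp0 : 0 < kp by exact: powR_gt0.
have p20 : 0 < p - 2 by rewrite subr_gt0.
have pn := lt0r_neq0 p0.
set th := (2 * kp * Cg)^-1.
have th0 : 0 < th by rewrite invr_gt0 !mulr_gt0.
(* With the Young weight [c1 * y], proportional to [y], a tail of size [th / (2 * c1)] and the term
   l^(1 - p/2) Y each contribute Cg * th / 2 * y. The level [A] thus depends neither on [e] nor on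
   [Y]. *)
set c1 := (th / 2) `^ (1 - p / 2)^-1.
have c10 : 0 < c1 by rewrite powR_gt0// divr_gt0.
have c1E : c1 `^ (1 - p / 2) = th / 2.
  rewrite /c1 -powRrM mulVf ?powRr1 ?divr_ge0 ?(ltW th0)//.
  by apply/eqP; lra.
have d0 : 0 < th / (2 * c1) by rewrite divr_gt0// mulr_gt0.
have [A A0 HA] := tail_small d0 mTc fin_T.
set a1 := Cg * (1 + A `^ (p - 2)).
have a10 : 0 < a1 by rewrite mulr_gt0// ltr_wpDr// powR_ge0.
exists ((2 * kp * a1 * B2) `^ (p / 2)) => e e01; have /andP[e0 _] := e01.
have b20 : 0 <= b / 2 by rewrite divr_ge0// ltW.
have mH : measurable_fun cube (fun x => `|tprof e (b / 2) (T x)| `^ p).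
  by apply: measurable_powR_norm; exact: measurable_tprof.
have H0 x : cube x -> 0 <= `|tprof e (b / 2) (T x)| `^ p by move=> _; exact: powR_ge0.
have fH := fin_tprof_T b20 e01.
have IH0 : (0 <= \In_x (`|tprof e (b / 2) (T x)| `^ p))%E by exact: int_pow_ge0.
set Y := fine (\In_x (`|tprof e (b / 2) (T x)| `^ p))%E.
have YE : (\In_x (`|tprof e (b / 2) (T x)| `^ p))%E = Y%:E by rewrite /Y fineK// (ge0_fin_numE IH0).
have Y0 : 0 <= Y by exact: fine_ge0.
rewrite YE lee_fin.
(* The case [Y = 0] is set aside because a Young weight must be positive. *)
move: Y0; rewrite le_eqVlt => /predU1P[<-|Y0]; first exact: powR_ge0.
set y := Y `^ (2 / p).
have y0 : 0 < y by exact: powR_gt0.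
have yY : y `^ (p / 2) = Y.
  rewrite /y -powRrM (_ : 2 / p * (p / 2) = 1) ?powRr1 ?ltW//.
  by field.
rewrite -yY; apply: ge0_powR_le; last by rewrite divr_ge0// ltW.
rewrite (ltW y0)/=.
set l := c1 * y.
have l0 : 0 < l by exact: mulr_gt0.
have lY : l `^ (1 - p / 2) * Y = th / 2 * y.
  rewrite /l powRM ?(ltW c10) ?(ltW y0)// c1E -mulrA; congr (_ * _).
  rewrite -yY -powRD; last by rewrite (gt_eqF y0) implybT.
  by rewrite subrK powRr1// ltW.
have e00 : 0 < a1 * B2 + Cg * th * y by apply: addr_gt0; apply: mulr_gt0 => //; exact: mulr_gt0.
have small : (\In_x (`|bdiff 0 0 g x| * `|tprof e b (bdiff 0 0 T x)|) <= (a1 * B2 + Cg * th * y)%:E)%E.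
  rewrite !bdiff0.
  have m1 : measurable_fun cube (fun x => `|T x| ^+ 2 * (1 + T x ^+ 2) `^ b).
    apply: measurable_funM; first by apply: measurable_funX; exact: measurableT_comp.
    apply: (measurableT_comp (measurable_powR b)); apply: measurable_funD; first exact: measurable_cst.
    exact: measurable_funX.
  have m2 : measurable_fun cube (fun x => if `|T x| <= A then 0 else `|T x| `^ p).
    apply: measurable_fun_if => //.
      by apply: measurable_fun_ler => //; exact: measurableT_comp.
    by apply: measurable_funS (measurable_powR_norm _ mTc) => // x [].
  have n1 x : 0 <= `|T x| ^+ 2 * (1 + T x ^+ 2) `^ b by apply: mulr_ge0; [exact: sqr_ge0|exact: powR_ge0].
  have n2 x : 0 <= (if `|T x| <= A then 0 else `|T x| `^ p) by case: ifP => // _; exact: powR_ge0.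
  have c2 : 0 <= Cg * l by rewrite mulr_ge0// ltW.
  have c3 : 0 <= Cg * l `^ (1 - p / 2) by rewrite mulr_ge0 ?powR_ge0// ltW.
  pose f12 x := a1 * (`|T x| ^+ 2 * (1 + T x ^+ 2) `^ b) + (Cg * l) * (if `|T x| <= A then 0 else `|T x| `^ p).
  have m12 : measurable_fun cube f12.
    by apply: measurable_funD; apply: measurable_funM => //.
  have n12 x : cube x -> 0 <= f12 x by move=> _; apply: addr_ge0; apply: mulr_ge0 => //; exact: ltW.
  have mgc := @mTS cube _ mg.
  apply: (le_trans (int_lin_le row mC (a := 1) (b := Cg * l `^ (1 - p / 2)) (f := f12)
    (g := fun x => `|tprof e (b / 2) (T x)| `^ p) _ m12 mH n12 H0 ler01 c3 _)).
  - apply: measurable_funM; first exact: measurableT_comp.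
    by apply: measurableT_comp => //; exact: measurable_tprof.
  - move=> x _; rewrite mulr_ge0// mul1r.
    exact: critical_pointwise (ltW b0) e01 A0 l0 (gT x).
  rewrite YE mul1e (int_lin row mC m1 m2 (fun x _ => n1 x) (fun x _ => n2 x) (ltW a10) c2).
  apply: (@le_trans _ _ ((a1 * B2)%:E + (Cg * l * (th / (2 * c1)))%:E + (Cg * (th / 2 * y))%:E)%E).
    have -> : ((Cg * l `^ (1 - p / 2))%:E * Y%:E = (Cg * (th / 2 * y))%:E)%E by rewrite -EFinM -lY mulrA.
    apply: leeD; last exact: lexx.
    by apply: leeD; rewrite [X in (_ <= X)%E]EFinM; apply: lee_wpmul2l => //; rewrite lee_fin// ltW.
  rewrite -!EFinD lee_fin /l -addrA lerD2l.
  have c1n := lt0r_neq0 c10.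
  rewrite (_ : Cg * (c1 * y) * (th / (2 * c1)) + Cg * (th / 2 * y) = Cg * th * y)//.
  by field.
have := KP 0 0 e _ (fun i => _) _ e01 e00 small.
rewrite bdiff0 YE lee_fin => /(_ _ _) H.
have {}H : Y <= K * (a1 * B2 + Cg * th * y) `^ (p / 2).
  by apply: H => [i|]; rewrite ?mxE normr0// mulr_ge0// pi_ge0.
have yK : y <= kp * (a1 * B2 + Cg * th * y).
  have -> : a1 * B2 + Cg * th * y = ((a1 * B2 + Cg * th * y) `^ (p / 2)) `^ (2 / p).
    rewrite -powRrM (_ : p / 2 * (2 / p) = 1) ?powRr1 ?ltW//.
    by field.
  rewrite /kp -powRM ?powR_ge0 ?(ltW K0)//; apply: ge0_powR_le; first by rewrite (ltW Y0).
  by rewrite divr_ge0// ltW.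
have kth : kp * (Cg * th) = 1 / 2.
  by rewrite /th; field; rewrite !gt_eqF.
have E : kp * (a1 * B2 + Cg * th * y) = kp * a1 * B2 + 1 / 2 * y by rewrite -kth; ring.
rewrite E in yK; rewrite (_ : 2 * kp * a1 * B2 = 2 * (kp * a1 * B2)); last by ring.
exact: half_absorb yK.
Qed.

Lemma brezis_kato_step b : 0 < b -> (\In_x (`|T x| `^ (2 + 2 * b)) < +oo)%E ->
  (\In_x (`|T x| `^ ((1 + b) * p)) < +oo)%E.
Proof.
move=> b0 fb; have [B BP] := brezis_kato_uniform b0 fb.
apply: le_lt_trans (ltry B); apply: fatou_tprof => //; first exact: mTS.
by apply: nearW => n; apply: BP; exact: inv_nat01.
Qed.

(** A step leads from order 2 + 2b to order (1 + b) p, that is, multiplies the order by [p / 2 > 1].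
    Starting from [p] the orders are unbounded, and lower ones follow since the cube has finite
    measure. *)
Lemma moments q : 0 < q -> (\In_x (`|T x| `^ q) < +oo)%E.
Proof.
move=> q0; have p21 : 1 < p / 2 by rewrite ltr_pdivlMr// mul1r.
have H k : (\In_x (`|T x| `^ (p * (p / 2) ^+ k)) < +oo)%E.
  elim: k => [|k IH]; first by rewrite expr0 mulr1.
  have a1 : 1 <= (p / 2) ^+ k by rewrite exprn_ege1// ltW.
  set a := (p / 2) ^+ k in a1 IH.
  have pa : 1 < p * a / 2 by nra.
  rewrite (_ : p * (p / 2) ^+ k.+1 = (1 + (p * a / 2 - 1)) * p); last by rewrite exprS /a; field.
  apply: brezis_kato_step; first by rewrite subr_gt0.
  by rewrite (_ : 2 + 2 * (p * a / 2 - 1) = p * a)//; field.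
have [k kP] := unbounded_expn (q / p) p21.
apply: fin_mono (H k); first exact: mTS.
by rewrite q0/= mulrC -ler_pdivrMr.
Qed.

Lemma moments_g q : 0 < q -> (\In_x (`|g x| `^ q) < +oo)%E.
Proof.
move=> q0; apply: (growth_moment q0 (moments q0) (moments _)).
by apply: mulr_gt0 => //; rewrite subr_gt0; apply: lt_trans p2; rewrite ltr1n.
Qed.

Lemma bdiff_moment F Q : measurable_fun [set: 'rV[R]_N] F -> periodic_row F -> 0 < Q ->
  (\In_x (`|F x| `^ Q) < +oo)%E ->
  exists2 M : R, 0 < M & forall h, (forall i, `|h ord0 i| <= 2 * pi) ->
    (\In_x (`|bdiff h 1 F x| `^ Q) <= M%:E)%E.
Proof.
move=> mF pF Q0 fF; have I0 : (0 <= \In_x (`|F x| `^ Q))%E by exact: int_pow_ge0.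
exists ((2 * 2 `^ Q) * fine (\In_x (`|F x| `^ Q))%E + 1).
  apply: ltr_wpDl => //; apply: mulr_ge0; last exact: fine_ge0.
  by apply: mulr_ge0 => //; exact: powR_ge0.
move=> h hb; apply: le_trans (int_bdiff_le hb _ (ltW Q0) mF pF) _; first by rewrite normr1.
by rewrite [X in (_ <= X)%E]EFinD [X in (_ <= X + _)%E]EFinM fineK ?leeDl// (ge0_fin_numE I0).
Qed.

(** Isolates the truncation as an additive e^c; multiplied by a bounded moment it becomes negligible
    for small [e]. *)
Lemma prof_ub2 (e c t : R) : 0 < e -> 0 <= c -> prof e c t <= 2 `^ c * (e `^ c + `|t| `^ (2 * c)).
Proof.
move=> e0 c0; rewrite profE// powRrM (@powR_mulrn _ _ 2)// real_normK ?num_real//.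
apply: le_trans _ (powR_addle (ltW e0) (sqr_ge0 t) c0).
have d1 : 1 <= 1 + e * t ^+ 2 by rewrite lerDl mulr_ge0 ?sqr_ge0// ltW.
have n0 : 0 <= e + t ^+ 2 by rewrite addr_ge0 ?sqr_ge0// ltW.
apply: ge0_powR_le => //; rewrite divr_ge0//=; last exact: le_trans d1.
by rewrite ler_pdivrMr ?(lt_le_trans _ d1)// ler_peMr.
Qed.

(** The integrability exponent [q] is hidden because every improvement changes it; Campanato's
    argument asks only for [a > N], with whatever [q >= 1] comes along. *)
Definition diff_decay (a : R) := exists q C, [/\ 1 <= q, 0 < C &
  forall r h, 0 < r <= 1 -> (forall i, `|h ord0 i| <= r) ->
    (\In_x (`|bdiff h 1 T x| `^ q) <= (C * r `^ a)%:E)%E].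

(** With [2 * b = q] the quantity to bound is int |Dg| |D|^(1 + q), from which |D|^(q/th) is split
    off. Young's inequality with th and th' leaves bounded moments and int |D|^q <= C r^a, and gives
    the rate r^(a/th); [key] raises it to the power p/2 = th^2, with new integrability exponent (1 +
    b) p. *)
Lemma diff_decay_step (a : R) : 0 < a -> diff_decay a -> diff_decay (a * Num.sqrt (p / 2)).
Proof.
move=> a0 [q [C [q1 C0 qC]]].
have q0 : 0 < q by exact: lt_le_trans q1.
have p21 : 1 < p / 2 by rewrite ltr_pdivlMr// mul1r.
set th := Num.sqrt (p / 2).
have th2 : th * th = p / 2 by rewrite -expr2 sqr_sqrtr// ltW// (lt_trans _ p21).
have th1 : 1 < th by rewrite -sqrtr1 ltr_sqrt// (lt_trans _ p21).
have th0 : 0 < th by exact: lt_trans th1.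
have thn := lt0r_neq0 th0.
set th' := th / (th - 1).
have th'0 : 0 < th' by rewrite divr_gt0// subr_gt0.
set c := 1 + q - q / th.
have c0 : 0 < c by rewrite /c -addrA ltr_wpDr// subr_ge0 ler_pdivrMr// ler_peMr ?ltW.
have [b [b0 bE]] : exists b, 0 < b /\ 2 * b = q by exists (q / 2); split; [rewrite divr_gt0|field].
have [K K0 KP] := key (ltW b0).
(* Moments of increments, uniform in [h]: [M1] and [M2] bound the Young remainder, [M3] and [M4] the
   error due to the truncation. *)
have [M1 M10 HM1] := bdiff_moment mg perg (mulr_gt0 (ltr0Sn R 1) th'0) (moments_g (mulr_gt0 (ltr0Sn R 1) th'0)).
have cth0 : 0 < 2 * c * th' by apply: mulr_gt0 => //; exact: mulr_gt0.
have [M2 M20 HM2] := bdiff_moment mT perT cth0 (moments cth0).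
have [M3 M30 HM3] := bdiff_moment mg perg (ltr0Sn R 1) (moments_g (ltr0Sn R 1)).
have [M4 M40 HM4] := bdiff_moment mT perT (ltr0Sn R 1) (moments (ltr0Sn R 1)).
have MC0 : 0 < M1 + M2 + C by rewrite !addr_gt0.
set C' := K * (2 * 2 `^ b * (M1 + M2 + C)) `^ (p / 2).
have C'0 : 0 < C' by rewrite mulr_gt0// powR_gt0// !mulr_gt0// powR_gt0.
exists ((1 + b) * p), C'; split => //.
  have := p2; have := p0; nra.
move=> r h /andP[r0 r1] hr.
have hb i : `|h ord0 i| <= 2 * pi.
  apply: le_trans (hr i) (le_trans r1 _).
  by have := pi_ge2 R; lra.
pose D := bdiff h 1 T; pose Dg := bdiff h 1 g.
have mD : measurable_fun cube D by apply: mTS; exact: measurable_bdiff.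
have mDg : measurable_fun cube Dg by apply: mTS; exact: measurable_bdiff.
have pow_prod (x y u : R) : 0 <= x -> 0 <= y -> (x * y) `^ u <= x `^ (2 * u) + y `^ (2 * u).
  move=> x0 y0; rewrite powRM// ![2 * u]mulrC !powRrM !(@powR_mulrn _ _ 2) ?powR_ge0//.
  by have := sqr_ge0 (x `^ u - y `^ u); have := powR_ge0 x u; have := powR_ge0 y u; nra.
(* Balances the two Young terms: l^(1 - th) r^a = l. *)
set l := r `^ (a / th).
have l0 : 0 < l by exact: powR_gt0.
have E1 : (\In_x (`|Dg x| * `|D x| `^ (1 + q)) <= ((M1 + M2 + C) * l)%:E)%E.
  have mx : measurable_fun cube (fun x => (`|Dg x| * `|D x| `^ c) `^ th').
    apply: (measurableT_comp (measurable_powR th')); apply: measurable_funM; first exact: measurableT_comp.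
    exact: measurable_powR_norm.
  have x0 x : cube x -> 0 <= (`|Dg x| * `|D x| `^ c) `^ th' by move=> _; exact: powR_ge0.
  apply: (@le_trans _ _ (l%:E * \In_x ((`|Dg x| * `|D x| `^ c) `^ th') + (l `^ (1 - th))%:E * \In_x (`|D x| `^ q))%E).
    apply: int_lin_le => //; try exact: powR_ge0; try by move=> *; exact: powR_ge0.
    - by apply: measurable_funM; [exact: measurableT_comp|exact: measurable_powR_norm].
    - exact: measurable_powR_norm.
    move=> x _; rewrite mulr_ge0 ?powR_ge0//=.
    have -> : `|Dg x| * `|D x| `^ (1 + q) = (`|Dg x| * `|D x| `^ c) * `|D x| `^ (q / th).
      rewrite -mulrA -powRD; first by rewrite /c subrK.
      by rewrite /c subrK gt_eqF// addr_gt0.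
    have -> : `|D x| `^ q = (`|D x| `^ (q / th)) `^ th by rewrite -powRrM divfK.
    by apply: young_split.
  apply: (@le_trans _ _ (l%:E * (M1 + M2)%:E + (l `^ (1 - th))%:E * (C * r `^ a)%:E)%E).
    apply: leeD; apply: lee_wpmul2l; rewrite ?lee_fin ?powR_ge0//.
    - apply: (@le_trans _ _ (1%:E * \In_x (`|Dg x| `^ (2 * th')) + 1%:E * \In_x (`|D x| `^ (2 * c * th')))%E).
        apply: int_lin_le => //; try (by move=> *; exact: powR_ge0); try exact: measurable_powR_norm.
        move=> x _; rewrite powR_ge0/= !mul1r.
        apply: (le_trans (pow_prod _ _ th' (normr_ge0 _) (powR_ge0 _ _))).
        by rewrite -powRrM (_ : c * (2 * th') = 2 * c * th')//; ring.
      by rewrite !mul1e EFinD; exact: leeD (HM1 h hb) (HM2 h hb).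
    - by apply: qC => //; rewrite r0.
  rewrite -!EFinM -EFinD lee_fin.
  have -> : l `^ (1 - th) * (C * r `^ a) = C * l.
    rewrite mulrCA; congr (_ * _); rewrite /l -powRrM -powRD; last by rewrite (gt_eqF r0) implybT.
    by congr (_ `^ _); field.
  by rewrite mulrDl mulrC.
have E2 : (\In_x (`|Dg x| * `|D x|) <= (M3 + M4)%:E)%E.
  apply: (@le_trans _ _ (1%:E * \In_x (`|Dg x| `^ 2) + 1%:E * \In_x (`|D x| `^ 2))%E).
    apply: int_lin_le => //; try (by move=> *; exact: powR_ge0); try exact: measurable_powR_norm.
      by apply: measurable_funM; exact: measurableT_comp.
    move=> x _; rewrite mulr_ge0//= !mul1r.
    have := pow_prod `|Dg x| `|D x| 1 (normr_ge0 _) (normr_ge0 _).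
    by rewrite mulr1 powRr1// mulr_ge0.
  by rewrite !mul1e EFinD; exact: leeD (HM3 h hb) (HM4 h hb).
have B0 : 0 < (M1 + M2 + C) * l by exact: mulr_gt0.
have -> : C' * r `^ (a * th) = K * (2 * 2 `^ b * ((M1 + M2 + C) * l)) `^ (p / 2).
  rewrite /C' mulrA [in RHS]powRM; last 2 first.
  - by rewrite !mulr_ge0 ?powR_ge0// ltW.
  - exact: powR_ge0.
  rewrite mulrA; congr (_ * _); rewrite /l -powRrM -th2; congr (_ `^ _).
  by field.
apply: fatou_tprof => //.
near=> n.
pose e : R := n.+1%:R^-1; have e01 : 0 < e <= 1 by exact: inv_nat01.
rewrite -/e.
have /andP[e0 _] := e01.
apply: KP => //; first by rewrite normr1.
  by rewrite !mulr_gt0// powR_gt0.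
(* For large n the truncation error is below the main term. How large depends on [r], which is
   harmless since n disappears in the limit. *)
have eM : e `^ b * (M3 + M4) <= (M1 + M2 + C) * l.
  have Xn : ((M3 + M4) / ((M1 + M2 + C) * l)) `^ b^-1 <= n%:R by near: n; exact: nbhs_infty_ger.
  have X0 : 0 <= (M3 + M4) / ((M1 + M2 + C) * l) by rewrite divr_ge0 ?addr_ge0 ?(ltW B0)// ltW.
  have Xb : (M3 + M4) / ((M1 + M2 + C) * l) <= n.+1%:R `^ b.
    have -> : (M3 + M4) / ((M1 + M2 + C) * l) = (((M3 + M4) / ((M1 + M2 + C) * l)) `^ b^-1) `^ b.
      by rewrite -powRrM (mulVf (lt0r_neq0 b0)) powRr1.
    apply: ge0_powR_le; last exact: ltW.
    by rewrite powR_ge0/=; apply: le_trans Xn _; rewrite ler_nat.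
  rewrite /e -(powR_inv1 (ler0n R n.+1)) -powRrM mulN1r powRN mulrC ler_pdivrMr ?powR_gt0 ?ltr0n//.
  by rewrite mulrC -ler_pdivrMr.
apply: (@le_trans _ _ ((2 `^ b * e `^ b)%:E * \In_x (`|Dg x| * `|D x|) + (2 `^ b)%:E * \In_x (`|Dg x| * `|D x| `^ (1 + q)))%E).
  apply: int_lin_le => //; try exact: powR_ge0; try by apply: mulr_ge0; exact: powR_ge0.
  - by apply: measurable_funM; apply: measurableT_comp => //; exact: measurable_tprof.
  - by apply: measurable_funM; exact: measurableT_comp.
  - by apply: measurable_funM; [exact: measurableT_comp|exact: measurable_powR_norm].
  move=> x _; rewrite mulr_ge0//= /tprof normrM (ger0_norm (ltW (prof_gt0 _ _ _)))//.
  have D1 : `|D x| `^ (1 + q) = `|D x| * `|D x| `^ (2 * b).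
    by rewrite bE powRD ?powRr1// gt_eqF// addr_gt0.
  rewrite D1 -/D -/Dg.
  apply: le_trans (ler_wpM2l (normr_ge0 _) (ler_wpM2l (normr_ge0 _) (prof_ub2 (D x) e0 (ltW b0)))) _.
  by rewrite [leLHS](_ : _ = 2 `^ b * e `^ b * (`|Dg x| * `|D x|) + 2 `^ b * (`|Dg x| * (`|D x| * `|D x| `^ (2 * b))))//; ring.
apply: (@le_trans _ _ ((2 `^ b * e `^ b)%:E * (M3 + M4)%:E + (2 `^ b)%:E * ((M1 + M2 + C) * l)%:E)%E).
  by apply: leeD; apply: lee_wpmul2l; rewrite ?lee_fin ?mulr_ge0 ?powR_ge0.
rewrite -!EFinM -EFinD lee_fin (_ : 2 * 2 `^ b * _ = 2 `^ b * ((M1 + M2 + C) * l) + 2 `^ b * ((M1 + M2 + C) * l)); last by ring.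
by rewrite lerD2r -mulrA; apply: ler_wpM2l; first exact: powR_ge0.
Unshelve. all: by end_near.
Qed.

Lemma diff_decay_large (a Q : R) : 0 < a -> diff_decay a -> exists2 a' : R, Q <= a' & diff_decay a'.
Proof.
move=> a0 da.
have p21 : 1 < p / 2 by rewrite ltr_pdivlMr// mul1r.
have th1 : 1 < Num.sqrt (p / 2) by rewrite -[ltLHS]sqrtr1 ltr_sqrt// (lt_trans _ p21).
have H k : diff_decay (a * Num.sqrt (p / 2) ^+ k).
  elim: k => [|k IH]; first by rewrite expr0 mulr1.
  rewrite exprSr mulrA; apply: diff_decay_step => //.
  by rewrite mulr_gt0// exprn_gt0// (lt_trans _ th1).
have [k kP] := unbounded_expn (Q / a) th1.
by exists (a * Num.sqrt (p / 2) ^+ k) => //; rewrite mulrC -ler_pdivrMr.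
Qed.

End bootstrap.

(** * Decay of differences from the energy *)

Section tonelli_on_rectangles.
Context d1 d2 (T1 : measurableType d1) (T2 : measurableType d2) (R : realType).
Local Notation Em := (T1 * T2)%type.
Variables (m1 : {sigma_finite_measure set T1 -> \bar R}) (m2 : {sigma_finite_measure set T2 -> \bar R}).
Variables (D1 : set T1) (D2 : set T2) (f : Em -> \bar R).
Hypothesis mD1 : measurable D1.
Hypothesis mD2 : measurable D2.
Hypothesis mf : measurable_fun [set: Em] f.
Hypothesis f0 : forall z, (0 <= f z)%E.

Let f' := f \_ (D1 `*` D2).

Let mf' : measurable_fun [set: Em] f'.
Proof.
apply: (iffLR (measurable_restrictT _ (measurableX mD1 mD2))); exact: measurable_funTS mf.
Qed.

Let f'0 z : (0 <= f' z)%E. Proof. by apply: erestrict_ge0. Qed.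

Let f'E x t : f' (x, t) = ((fun x => ((fun t => f (x, t)) \_ D2) t) \_ D1) x.
Proof.
rewrite /f' /patch; case: ifPn => [/set_mem[/= /mem_set -> /mem_set ->]//|/negP n].
case: ifPn => // /set_mem x1; case: ifPn => // /set_mem t2.
by exfalso; apply: n; apply/mem_set.
Qed.

Lemma tonelli_rect : (\int[m1]_(x in D1) \int[m2]_(t in D2) f (x, t) =
  \int[m2]_(t in D2) \int[m1]_(x in D1) f (x, t))%E.
Proof.
transitivity (\int[m1]_x \int[m2]_t f' (x, t))%E.
  rewrite integral_mkcond; apply: eq_integral => x _.
  under [RHS]eq_integral do rewrite f'E; rewrite /patch.
  case: ifPn => _; last by rewrite integral0_eq.
  exact: integral_mkcond.
rewrite (@fubini_tonelli _ _ _ _ _ m1 m2 _ mf' f'0) [RHS]integral_mkcond; apply: eq_integral => t _.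
under [LHS]eq_integral do rewrite f'E; rewrite [RHS]/patch.
case: ifPn => [t2|nt2].
  rewrite [RHS]integral_mkcond; apply: eq_integral => x _.
  by rewrite /patch t2.
apply: integral0_eq => x _; rewrite /patch (negbTE nt2); by case: ifPn.
Qed.

Lemma measurable_int_line : measurable_fun [set: T1] (fun x => \int[m2]_(t in D2) f (x, t))%E.
Proof.
pose g := f \_ (setT `*` D2).
have mg : measurable_fun [set: Em] g.
  apply: (iffLR (measurable_restrictT _ (measurableX measurableT mD2))); exact: measurable_funTS mf.
have g0 z : (0 <= g z)%E by apply: erestrict_ge0.
have := @measurable_fun_fubini_tonelli_F _ _ _ _ _ m2 g mg g0.
rewrite /fubini_F; congr (measurable_fun _ _); apply/funext => x.
rewrite [RHS]integral_mkcond; apply: eq_integral => t _.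
by rewrite /g /patch in_setX in_setT.
Qed.

Lemma measurable_int_row : measurable_fun [set: T2] (fun t => \int[m1]_(x in D1) f (x, t))%E.
Proof.
pose g := f \_ (D1 `*` setT).
have mg : measurable_fun [set: Em] g.
  apply: (iffLR (measurable_restrictT _ (measurableX mD1 measurableT))); exact: measurable_funTS mf.
have g0 z : (0 <= g z)%E by apply: erestrict_ge0.
have := @measurable_fun_fubini_tonelli_G _ _ _ _ _ m1 g mg g0.
rewrite /fubini_G; congr (measurable_fun _ _); apply/funext => x.
rewrite [RHS]integral_mkcond; apply: eq_integral => t _.
by rewrite /g /patch in_setX in_setT andbT.
Qed.

End tonelli_on_rectangles.

Section line_integrals.
Context {R : realType}.
Local Notation leb := (@lebesgue_measure R).

Lemma ftc_abs_le (F f : R -> R) (a b : R) : a < b ->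
  {within `[a, b], continuous F} -> {within `[a, b], continuous f} ->
  (forall x, a < x < b -> is_derive x 1 F (f x)) ->
  ((`|F b - F a|)%:E <= \int[leb]_(t in `]a, b[) (`|f t|)%:E)%E.
Proof.
move=> ab cF cf dF.
have dL : derivable_oo_LRcontinuous F a b.
  have [_ Fa Fb] := (continuous_within_itvP F ab).1 cF.
  by split => // x; rewrite in_itv/= => /dF[].
have F'f : {in `]a, b[, F^`()%classic =1 f}.
  by move=> x; rewrite in_itv/= => /dF H; rewrite derive1E (@derive_val _ _ _ _ _ _ _ H).
have mf : measurable_fun `[a, b] f by apply: subspace_continuous_measurable_fun.
have mfo : measurable_fun `]a, b[ f.
  by apply: measurable_funS mf => //; exact: subset_itv_oo_cc.
have E := continuous_FTC2 ab cf dL F'f.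
rewrite -EFinB in E.
apply: (@le_trans _ _ `|\int[leb]_(x in `[a, b]) (f x)%:E|%E); first by rewrite E.
rewrite -integral_itv_bndo_bndc; last first.
  by apply/measurable_EFinP; apply: measurable_funS mf => //; apply: subset_itvl; rewrite bnd_simp.
rewrite -integral_itv_obnd_cbnd; last exact/measurable_EFinP.
by apply: le_abse_integral => //; exact/measurable_EFinP.
Qed.

(** The integrand is singular at 0 for s < 1/2, so the primitive is used on [a n, r] and the left
    end is sent to 0 by Fatou's lemma. The index [n.+2] keeps [a n < r] from n = 0 on. *)
Lemma int_powR_le (s r : R) : 0 < s -> 0 < r ->
  (\int[leb]_(t in `]0%R, r[) (t `^ (2 * s - 1))%:E <= (r `^ (2 * s) / (2 * s))%:E)%E.
Proof.
move=> s0 r0; have s20 : 0 < 2 * s by rewrite mulr_gt0.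
have mp : measurable_fun [set: R] (fun t : R => t `^ (2 * s - 1)) by exact: measurable_powR.
pose a n : R := r * n.+2%:R^-1.
have a0 n : 0 < a n by rewrite mulr_gt0// invr_gt0.
have ar n : a n < r by rewrite gtr_pMr// invf_lt1// ltr1n.
apply: (@fatou_le _ _ _ leb `]0%R, r[%classic _ (fun n t => if a n < t then t `^ (2 * s - 1) else 0)) => //.
- move=> n; apply: measurable_fun_if => //; first exact: measurable_fun_ltr.
  by apply: measurable_funS mp => //.
- by move=> n x _; case: ifP => // _; exact: powR_ge0.
- move=> x; rewrite /= in_itv/= => /andP[x0 xr]; apply: cvg_near_cst.
  near=> n; rewrite ifT// /a ltr_pdivrMr// -ltr_pdivrMl//.
  apply: (@le_lt_trans _ _ n%:R); last by rewrite ltr_nat.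
  by near: n; exact: nbhs_infty_ger.
apply: nearW => n.
apply: (@le_trans _ _ (\int[leb]_(t in `[a n, r]) (t `^ (2 * s - 1))%:E)%E).
  rewrite integral_mkcond [leRHS]integral_mkcond; apply: ge0_le_integral => //.
  - by move=> x _; rewrite erestrict_ge0// => t _; case: ifP => // _; rewrite lee_fin powR_ge0.
  - apply: (iffLR (measurable_restrictT _ _)) => //; apply/measurable_EFinP.
    apply: measurable_fun_if => //; first exact: measurable_fun_ltr.
    by apply: measurable_funS mp.
  - apply: (iffLR (measurable_restrictT _ _)) => //; apply/measurable_EFinP.
    by apply: measurable_funS mp.
  move=> x _; rewrite /patch.
  case: ifPn => [/set_mem|_]; last by case: ifPn => // _; rewrite lee_fin powR_ge0.
  rewrite /= in_itv/= => /andP[x0 xr]; case: ifP => [ax|_]; last by case: ifP => // _; rewrite lee_fin powR_ge0.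
  by rewrite mem_set//= in_itv/= (ltW ax) ltW.
have dF (x : R) : 0 < x -> is_derive x 1 (fun t : R => (2 * s)^-1 * t `^ (2 * s)) (x `^ (2 * s - 1)).
  move=> x0; have := @is_deriveZ _ _ _ _ (2 * s)^-1 x 1 _ (is_derive1_powR (2 * s) x0).
  by rewrite scalerA mulVf ?scale1r// lt0r_neq0.
have cP (c x : R) : 0 < x -> {for x, continuous (fun t : R => t `^ c)}.
  by move=> x0; apply: differentiable_continuous; apply/derivable1_diffP; apply: ex_derive; exact: is_derive1_powR.
have cW (c : R) : {within `[a n, r], continuous (fun t : R => t `^ c)}.
  apply: continuous_in_subspaceT => x; rewrite inE/= in_itv/= => /andP[x0 _].
  by apply: cP; exact: lt_le_trans x0.
have cF : {within `[a n, r], continuous (fun t : R => (2 * s)^-1 * t `^ (2 * s))}.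
  apply: continuous_in_subspaceT => x; rewrite inE/= in_itv/= => /andP[x0 _].
  by apply: cvgM; [exact: cvg_cst|apply: cP; exact: lt_le_trans x0].
rewrite (@continuous_FTC2 _ _ (fun t : R => (2 * s)^-1 * t `^ (2 * s)) _ _ (ar n) (cW _)).
- by rewrite -EFinB lee_fin mulrC lerBlDr lerDl mulr_ge0 ?powR_ge0// invr_ge0 ltW.
- have [_ Fa Fb] := (continuous_within_itvP _ (ar n)).1 cF.
  split => // x; rewrite in_itv/= => /andP[x0 _].
  by have [] := dF x (lt_trans (a0 n) x0).
- move=> x; rewrite in_itv/= => /andP[x0 _].
  by rewrite derive1E (@derive_val _ _ _ _ _ _ _ (dF x (lt_trans (a0 n) x0))).
Unshelve. all: by end_near.
Qed.

End line_integrals.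

Lemma ge0_le_integral3 d (T : measurableType d) (R : realType) (mu : {measure set T -> \bar R})
    (D : set T) (h f1 f2 f3 : T -> \bar R) (I1 I2 I3 : \bar R) : measurable D ->
  measurable_fun [set: T] h -> measurable_fun [set: T] f1 -> measurable_fun [set: T] f2 ->
  measurable_fun [set: T] f3 -> (forall x, (0 <= h x)%E) -> (forall x, (0 <= f1 x)%E) ->
  (forall x, (0 <= f2 x)%E) -> (forall x, (0 <= f3 x)%E) ->
  (forall x, (h x <= f1 x + f2 x + f3 x)%E) ->
  (\int[mu]_(x in D) f1 x = I1)%E -> (\int[mu]_(x in D) f2 x = I2)%E ->
  (\int[mu]_(x in D) f3 x = I3)%E ->
  (\int[mu]_(x in D) h x <= I1 + I2 + I3)%E.
Proof.
move=> mD mh m1 m2 m3 h0 p1 p2 p3 hle <- <- <-.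
have m12 : measurable_fun [set: T] (fun x => f1 x + f2 x)%E by exact: emeasurable_funD.
rewrite -(ge0_integralD mu mD (fun x _ => p1 x) (measurable_funTS m1) (fun x _ => p2 x) (measurable_funTS m2)).
rewrite -(ge0_integralD mu mD (fun x _ => adde_ge0 (p1 x) (p2 x)) (measurable_funTS m12) (fun x _ => p3 x) (measurable_funTS m3)).
apply: ge0_le_integral => //; first exact: measurable_funTS.
by apply: measurable_funTS; exact: emeasurable_funD.
Qed.

Section differences_of_test_functions.
Context {R : realType} {N : nat} (s m : R).
Local Notation Em := ('rV[R]_N * measurableTypeR R)%type.
Local Notation row := (lebesgue_row N).
Local Notation leb := (@lebesgue_measure R).
Local Notation cube := (@open_cube R N).
Local Notation cyl := (@lebesgue_cyl R N).
Local Notation HC := (@half_cylinder R N : set Em).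
Local Notation Ho := (@half_space R N : set Em).
Local Notation en u := (energy s m u (gradient u)).
Local Notation "'\In_' x F" := (\int[row]_(x in cube) (F%R)%:E)%E (at level 36, x name, F at level 36).
Local Notation e_ i := (delta_mx ord0 i : 'rV[R]_N).
Implicit Types (u w : 'rV[R]_N * R -> R) (h x : 'rV[R]_N) (r t tau : R) (k : option 'I_N).
Hypothesis s01 : 0 < s < 1.

(** Extension by zero to xi <= 0 gives a function measurable on the whole product, as the Tonelli
    lemmas above require. *)
Definition grad_abs u k (z : 'rV[R]_N * R) : R := if 0 < z.2 then `|gradient u k z| else 0.

Lemma grad_abs_ge0 u k z : 0 <= grad_abs u k z.
Proof. by rewrite /grad_abs; case: ifP. Qed.

Lemma measurable_grad_abs u k : smooth_up_to_boundary u -> measurable_fun [set: Em] (grad_abs u k).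
Proof.
move=> su; have H : measurable_fun Ho (fun z => `|gradient u k z|).
  by apply: measurableT_comp => //; exact: smooth_gradient_measurable.
have := (iffLR (measurable_restrictT _ (@measurable_Ho R N))) H.
congr (measurable_fun _ _); apply/funext => z; rewrite /patch /grad_abs.
by case: ifPn => [/set_mem /= ->//|/negP nz]; case: ifP => // z0; exfalso; apply: nz; apply/mem_set.
Qed.

Lemma periodic_grad_abs u k i x t : smooth_up_to_boundary u -> periodic_half_space u ->
  grad_abs u k (x + period i, t) = grad_abs u k (x, t).
Proof.
move=> su pu; rewrite /grad_abs /=; case: ifP => // t0.
by rewrite (gradient_periodic (z := (x, t)) k i su pu).
Qed.

Lemma vertical_difference u x tau : smooth_up_to_boundary u -> 0 < tau ->
  ((`|u (x, tau) - u (x, 0)|)%:E <= \int[leb]_(t in `]0%R, tau[) (grad_abs u None (x, t))%:E)%E.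
Proof.
move=> su tau0; have [w sw wE] := smooth_grad_smooth None su.
have cont y : smooth_up_to_boundary y -> {within `[0, tau], continuous (fun t => y (x, t))}.
  move=> sy; have S : `[0%R, tau] `<=` [set t : R | 0 <= t] by move=> t /=; rewrite in_itv/= => /andP[].
  exact: (continuous_subspaceW S (smooth_line_continuous (x := x) sy)).
apply: le_trans (ftc_abs_le tau0 (cont _ su) (cont _ sw) _) _.
  move=> t /andP[t0 _]; rewrite -(wE (x, t) t0).
  have /is_derive_lineP H := smooth_grad None su (t0 : Ho (x, t)).
  apply/is_derive_lineP; move: H; congr (is_derive _ _ _ _); apply/funext => y /=.
  by congr (u (_, _)); rewrite /= ?scaler0 ?add0r.
rewrite le_eqVlt; apply/orP; left; apply/eqP; apply: eq_integral => t.
by rewrite inE/= in_itv/= => /andP[t0 _]; rewrite /grad_abs /= t0 wE.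
Qed.

Lemma horizontal_difference u x i tau t : smooth_up_to_boundary u -> 0 < tau -> 0 < t ->
  ((`|u (x + t *: e_ i, tau) - u (x, tau)|)%:E <=
    \int[leb]_(y in `]0%R, t[) (grad_abs u (Some i) (x + y *: e_ i, tau))%:E)%E.
Proof.
move=> su tau0 t0; have [w sw wE] := smooth_grad_smooth (Some i) su.
have cont y : smooth_up_to_boundary y -> continuous (fun r => y (x + r *: e_ i, tau)).
  move=> sy r; have H := within_half_continuous (smooth_cont sy).
  have cr : (fun r => x + r *: e_ i) @ r --> x + r *: e_ i.
    apply: cvgD; first exact: cvg_cst.
    by apply: cvgZl; exact: cvg_id.
  have ct : (fun r => (x + r *: e_ i, tau)) @ r --> (x + r *: e_ i, tau).
    by apply: (@cvg_pair _ _ _ _ (nbhs (x + r *: e_ i)) (nbhs tau)); [exact: cr|exact: cvg_cst].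
  have Hz := H (x + r *: e_ i, tau) (mem_set (tau0 : Ho (x + r *: e_ i, tau))).
  exact: (cvg_comp _ _ ct Hz).
have cont' y : smooth_up_to_boundary y -> {within `[0, t], continuous (fun r => y (x + r *: e_ i, tau))}.
  by move=> sy; apply: continuous_subspaceT; exact: cont.
have -> : u (x, tau) = (fun r => u (x + r *: e_ i, tau)) 0 by rewrite /= scale0r addr0.
apply: le_trans (ftc_abs_le t0 (cont' _ su) (cont' _ sw) _) _.
  move=> r _; rewrite -wE//.
  have /is_derive_lineP H := smooth_grad (Some i) su (tau0 : Ho (x + r *: e_ i, tau)).
  apply/is_derive_lineP; move: H; congr (is_derive _ _ _ _); apply/funext => y /=.
  congr (u (_, _)); last by rewrite /= ?scaler0 ?add0r.
  by rewrite [y *: 1]mulr1 scalerDl addrCA.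
rewrite le_eqVlt; apply/orP; left; apply/eqP; apply: eq_integral => r _.
by rewrite /grad_abs /= tau0 wE.
Qed.

Let SS u k r : \bar R := (\int[leb]_(t in `]0%R, r[) \int[row]_(x in cube) (grad_abs u k (x, t))%:E)%E.

(** Cauchy-Schwarz in the form |G| <= r^s w G^2 + r^(-s) / w with the weight w = xi^(1 - 2s): over
    the strip of height r the inverse weight has integral at most (2 pi)^N r^(2s) / (2s), so both
    terms are of order r^s. This is the origin of the initial rate s. *)
Lemma strip_gradient u k (M r : R) : test_function s m u -> (en u <= M%:E)%E -> 0 < r ->
  (SS u k r <= ((M + (2 * pi) ^+ N / (2 * s)) * r `^ s)%:E)%E.
Proof.
move=> [su pu fu] uM r0; have /andP[s0 s1] := s01.
have mA := measurable_grad_abs k su.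
have mr : measurable [set z : Em | z.2 < r].
  have := @measurable_fun_ltr _ _ _ setT (fun z : Em => z.2 : R) (fun=> r) measurable_snd (measurable_cst _).
  move=> /(_ measurableT [set true]); rewrite setTI; apply => //.
have mif (F : Em -> R) (D : set Em) : measurable D -> measurable_fun D F -> measurable_fun D (fun z : Em => if z.2 < r then F z else 0).
  move=> mD mF; apply: measurable_fun_if => //.
    by apply: measurable_fun_ltr => //; apply: measurable_funTS; exact: measurable_snd.
  by apply: measurable_funS mF => // z [].
have mHC := @measurable_half_cylinder R N.
have SE : SS u k r = (\int[cyl]_(z in HC) (if z.2 < r then grad_abs u k z else 0)%:E)%E.
  rewrite integral_cyl_tonelli; last 2 first.
  - by apply/measurable_EFinP; exact: mif.
  - by move=> z; rewrite lee_fin; case: ifP => // _; exact: grad_abs_ge0.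
  rewrite /SS integral_mkcond [RHS]integral_mkcond; apply: eq_integral => t _.
  rewrite /patch; have [t0|t0] := ltP 0 t; last first.
    rewrite memNset; last by rewrite /= in_itv/= ltNge t0.
    by rewrite memNset//= in_itv/= andbT ltNge t0.
  rewrite [t \in `]0%R, +oo[%classic]mem_set; last by rewrite /= in_itv/= t0.
  have [tr|tr] := ltP t r.
    by rewrite mem_set//= in_itv/= t0.
  rewrite memNset; last by rewrite /= in_itv/= [t < r]ltNge tr andbF.
  by rewrite integral0_eq.
have mw (D : set Em) c : measurable_fun D (fun z : Em => (z.2 : R) `^ c).
  apply: measurable_funTS; apply: (measurableT_comp (measurable_powR c)); exact: measurable_snd.
have HE : (\int[cyl]_(z in HC) (if z.2 < r then z.2 `^ (2 * s - 1) else 0)%:E <=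
    ((2 * pi) ^+ N * (r `^ (2 * s) / (2 * s)))%:E)%E.
  rewrite integral_cyl_tonelli; last 2 first.
  - by apply/measurable_EFinP; apply: mif.
  - by move=> z; rewrite lee_fin; case: ifP => // _; exact: powR_ge0.
  apply: (@le_trans _ _ (\int[leb]_(t in `]0%R, r[) ((2 * pi) ^+ N * t `^ (2 * s - 1))%:E)%E); last first.
    under eq_integral do rewrite EFinM.
    rewrite ge0_integralZl//.
    - rewrite EFinM; apply: lee_wpmul2l; last exact: int_powR_le.
      by rewrite lee_fin exprn_ge0// mulr_ge0// pi_ge0.
    - by apply/measurable_EFinP; apply: measurable_funTS; exact: measurable_powR.
    - by move=> t _; rewrite lee_fin powR_ge0.
    - by rewrite lee_fin exprn_ge0// mulr_ge0// pi_ge0.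
  rewrite le_eqVlt; apply/orP; left; apply/eqP.
  rewrite integral_mkcond [RHS]integral_mkcond; apply: eq_integral => t _.
  rewrite /patch; have [t0|t0] := ltP 0 t; last first.
    rewrite memNset; last by rewrite /= in_itv/= andbT ltNge t0.
    by rewrite memNset//= in_itv/= ltNge t0.
  rewrite mem_set; last by rewrite /= in_itv/= t0.
  have [tr|tr] := ltP t r.
    rewrite mem_set; last by rewrite /= in_itv/= t0.
    transitivity ((t `^ (2 * s - 1) * (2 * pi) ^+ N)%:E : \bar R); first by rewrite -(@int_cst R N (t `^ (2 * s - 1))).
    by congr EFin; exact: mulrC.
  by rewrite [t \in `]0%R, r[%classic]memNset ?integral0_eq//= in_itv/= [t < r]ltNge tr andbF.
have mdn : measurable_fun HC (dens s m u (gradient u)).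
  have [a b] := smooth_field su; exact: measurable_dens.
have rs0 : 0 <= r `^ s by exact: powR_ge0.
rewrite SE.
apply: (@le_trans _ _ ((r `^ s)%:E * en u + (r `^ (- s))%:E *
   \int[cyl]_(z in HC) (if z.2 < r then z.2 `^ (2 * s - 1) else 0)%:E)%E).
  rewrite energyE; apply: int_lin_le => //; try exact: powR_ge0.
  - by apply: mif => //; exact: measurable_funTS mA.
  - exact: mif.
  - by move=> z _; exact: dens_ge0.
  - by move=> z _; case: ifP => // _; exact: powR_ge0.
  move=> z [_ z0]; case: ifP => zr; last by rewrite lexx mulr0 addr0 mulr_ge0// dens_ge0.
  rewrite grad_abs_ge0/= /grad_abs z0 /dens /wt.
  set w := z.2 `^ (1 - 2 * s); have w0 : 0 < w by exact: powR_gt0.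
  have -> : z.2 `^ (2 * s - 1) = w^-1.
    by rewrite /w -powRN; congr (_ `^ _); ring.
  have -> : r `^ (- s) = (r `^ s)^-1 by rewrite powRN.
  have rs : 0 < r `^ s by exact: powR_gt0.
  set c := r `^ s in rs *; set y := `|gradient u k z|.
  have y0 : 0 <= y by exact: normr_ge0.
  apply: (@le_trans _ _ (c * (w * y ^+ 2) + c^-1 * w^-1)); last first.
    rewrite lerD2r; apply: ler_wpM2l; first exact: ltW.
    apply: ler_wpM2l; first exact: ltW.
    rewrite (bigD1 k)//= /y real_normK ?num_real// -addrA lerDl addr_ge0//.
      by apply: sumr_ge0 => ? _; exact: sqr_ge0.
    by apply: mulr_ge0; exact: sqr_ge0.
  rewrite -invfM.
  have a0 : 0 < c * w by exact: mulr_gt0.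
  rewrite (_ : c * (w * y ^+ 2) = (c * w) * y ^+ 2); last by rewrite mulrA.
  set a := c * w in a0 *.
  rewrite -(ler_pM2l a0) mulrDr divff ?lt0r_neq0//.
  have := sqr_ge0 (a * y - 1); rewrite sqrrB1 exprMn => H.
  have q0 : 0 <= a * y by rewrite mulr_ge0// ltW.
  rewrite mulrA -expr2; lra.
apply: (@le_trans _ _ ((r `^ s)%:E * M%:E + (r `^ (- s))%:E * ((2 * pi) ^+ N * (r `^ (2 * s) / (2 * s)))%:E)%E).
  by apply: leeD; apply: lee_wpmul2l; rewrite ?lee_fin ?powR_ge0.
rewrite -!EFinM -EFinD lee_fin.
have -> : r `^ (2 * s) = r `^ s * r `^ s by rewrite -powRD ?(gt_eqF r0) ?implybT//; congr (_ `^ _); ring.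
have rs : 0 < r `^ s by exact: powR_gt0.
rewrite powRN (_ : _ + _ = (M + (2 * pi) ^+ N / (2 * s)) * r `^ s)//.
by field; rewrite !gt_eqF.
Qed.

Let mC := @measurable_open_cube R N.

Lemma integral_itv_cst (a : R) (c : \bar R) : 0 < a -> (0 <= c)%E ->
  (\int[leb]_(t in `]0%R, a[) c = c * a%:E)%E.
Proof.
move=> a0 c0; rewrite integral_cst//; congr (_ * _)%E.
by rewrite /= lebesgue_measure_itv/= lte_fin a0 oppr0 addr0.
Qed.

(** Two boundary points are joined through height [tau]: up, across and down. The vertical legs are
    enlarged to the full strip and so become independent of [tau]; the horizontal leg, integrated in
    x and translated over the period, costs [t] times one slice. *)
Lemma slice_difference u i (r t tau : R) : smooth_up_to_boundary u -> periodic_half_space u ->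
  0 < t <= 2 * pi -> 0 < tau < r ->
  (\In_x (`|u (x + t *: e_ i, 0) - u (x, 0)|) <=
   (SS u None r + SS u None r) + t%:E * \In_x (grad_abs u (Some i) (x, tau)))%E.
Proof.
move=> su pu /andP[t0 t2] /andP[tau0 taur].
have mA k := measurable_grad_abs k su.
have mAE k : measurable_fun [set: Em] (fun z => (grad_abs u k z)%:E) by exact/measurable_EFinP.
have A0 k z : (0 <= (grad_abs u k z)%:E)%E by rewrite lee_fin grad_abs_ge0.
pose V x := (\int[leb]_(y in `]0%R, r[) (grad_abs u None (x, y))%:E)%E.
pose F (z : Em) := (grad_abs u (Some i) (z.1 + (z.2 : R) *: e_ i, tau))%:E.
pose W x := (\int[leb]_(y in `]0%R, t[) F (x, y))%E.
have mF : measurable_fun [set: Em] F.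
  apply: (measurableT_comp (mAE (Some i))).
  apply/measurable_fun_pair; last exact: measurable_cst.
  apply: measurable_to_mx => a b; under eq_fun do rewrite !mxE.
  apply: measurable_funD.
    exact: (measurableT_comp (measurable_mx_coord _ _) measurable_fst).
  by apply: measurable_funM; [exact: measurable_snd|exact: measurable_cst].
have F0 z : (0 <= F z)%E by exact: A0.
have mV : measurable_fun [set: 'rV[R]_N] V.
  exact: (@measurable_int_line _ _ _ _ _ leb `]0%R, r[%classic _ (measurable_itv _) (mAE None) (A0 None)).
have V0 x : (0 <= V x)%E by apply: integral_ge0 => y _; exact: A0.
have mW : measurable_fun [set: 'rV[R]_N] W.
  exact: (@measurable_int_line _ _ _ _ _ leb `]0%R, t[%classic _ (measurable_itv _) mF F0).
have W0 x : (0 <= W x)%E by apply: integral_ge0 => y _; exact: F0.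
have mVh : measurable_fun [set: 'rV[R]_N] (fun x => V (x + t *: e_ i)).
  exact: (measurableT_comp mV (measurable_addrow _)).
have pV j x : V (x + period j) = V x.
  by apply: eq_integral => y _; rewrite periodic_grad_abs.
have vert x : ((`|u (x, tau) - u (x, 0)|)%:E <= V x)%E.
  apply: le_trans (vertical_difference x su tau0) _.
  apply: ge0_subset_integral => //.
  - apply: measurable_funTS; apply: (measurableT_comp (mAE None)).
    by apply/measurable_fun_pair; [exact: measurable_cst|exact: measurable_id].
  - by move=> y /=; rewrite !in_itv/= => /andP[-> /lt_trans]; apply.
have hb y : 0 <= y <= t -> forall j, `|(y *: e_ i) ord0 j| <= 2 * pi.
  move=> /andP[y0 yt] j; rewrite !mxE eqxx/=; case: eqP => _; rewrite ?mulr1 ?mulr0 ?normr0 ?mulr_ge0 ?pi_ge0//.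
  by rewrite ger0_norm// (le_trans yt).
have IV : (\int[row]_(x in cube) V x = SS u None r)%E.
  exact: (@tonelli_rect _ _ _ _ _ row leb cube `]0%R, r[%classic _ mC (measurable_itv _) (mAE None) (A0 None)).
have IVh : (\int[row]_(x in cube) V (x + t *: e_ i)%R = SS u None r)%E.
  have tt : 0 <= t <= t by rewrite lexx ltW.
  exact: etrans (integral_cube_shift (hb t tt) mV V0 pV) IV.
have IW : (\int[row]_(x in cube) W x = t%:E * \In_x (grad_abs u (Some i) (x, tau)))%E.
  apply: etrans (@tonelli_rect _ _ _ _ _ row leb cube `]0%R, t[%classic _ mC (measurable_itv _) mF F0) _.
  have JJ0 : (0 <= \In_x (grad_abs u (Some i) (x, tau)))%E by apply: integral_ge0 => x _; exact: A0.
  rewrite [RHS]muleC -(integral_itv_cst t0 JJ0).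
  apply: eq_integral => y /set_mem/=; rewrite in_itv/= => /andP[y0 yt].
  have yt' : 0 <= y <= t by rewrite !ltW.
  have m1 : measurable_fun [set: 'rV[R]_N] (fun x => (grad_abs u (Some i) (x, tau))%:E).
    apply: (measurableT_comp (mAE (Some i))).
    by apply/measurable_fun_pair; [exact: measurable_id|exact: measurable_cst].
  have p1 j x : (grad_abs u (Some i) (x + period j, tau))%:E = (grad_abs u (Some i) (x, tau))%:E.
    by rewrite periodic_grad_abs.
  exact: (@integral_cube_shift R N _ (y *: e_ i) (hb y yt') m1 (fun x => A0 _ _) p1).
have c0 : continuous (fun x => u (x, 0)) by exact: smooth_boundary_continuous.
have mu : measurable_fun [set: 'rV[R]_N] (fun x => u (x, 0)) by exact: continuous_measurable_row.
have mL : measurable_fun [set: 'rV[R]_N] (fun x => (`|u (x + t *: e_ i, 0) - u (x, 0)|)%:E).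
  apply/measurable_EFinP; apply: measurableT_comp => //.
  by apply: measurable_funB => //; exact: (measurable_shift_row _ mu).
have L0 x : (0 <= (`|u (x + t *: e_ i, 0) - u (x, 0)|)%:E)%E by rewrite lee_fin.
apply: (ge0_le_integral3 mC mL mV mVh mW L0 V0 (fun x => V0 _) W0 _ IV IVh IW) => x.
apply: (@le_trans _ _ ((`|u (x, tau) - u (x, 0)|)%:E + (`|u (x + t *: e_ i, tau) - u (x + t *: e_ i, 0)|)%:E +
   (`|u (x + t *: e_ i, tau) - u (x, tau)|)%:E)%E).
  rewrite -!EFinD lee_fin.
  rewrite (_ : u (x + t *: e_ i, 0) - u (x, 0) = (u (x, tau) - u (x, 0)) -
    (u (x + t *: e_ i, tau) - u (x + t *: e_ i, 0)) + (u (x + t *: e_ i, tau) - u (x, tau))); last by ring.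
  by apply: le_trans (ler_normD _ _) (lerD (ler_normB _ _) (lexx _)).
apply: leeD; first by apply: leeD; exact: vert.
exact: horizontal_difference.
Qed.

(** The energy does not control a single slice of the gradient, so the slice inequality is
    integrated over [tau] in ]0, r[. The slices add up to a strip integral and [t <= r] compensates
    the length [r]; two vertical strips and a horizontal one make the 3. *)
Lemma coordinate_difference u i (M r t : R) : test_function s m u -> (en u <= M%:E)%E ->
  0 < t <= r -> r <= 1 ->
  (\In_x (`|u (x + t *: e_ i, 0) - u (x, 0)|) <= (3 * (M + (2 * pi) ^+ N / (2 * s)) * r `^ s)%:E)%E.
Proof.
move=> tu uM /andP[t0 tr] r1; have [su pu _] := tu.
have r0 : 0 < r by exact: lt_le_trans tr.
have S0 k : (SS u k r <= ((M + (2 * pi) ^+ N / (2 * s)) * r `^ s)%:E)%E by exact: strip_gradient.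
set B := (M + _) * _ in S0; rewrite -!mulrA -/B.
have t2 : 0 < t <= 2 * pi.
  rewrite t0 (le_trans tr)// (le_trans r1)//.
  by have := pi_ge2 R; move=> ?; lra.
set I0 := (\In_x _)%E.
have I00 : (0 <= I0)%E by apply: integral_ge0.
have mA := measurable_grad_abs (Some i) su.
pose J tau := (\In_x (grad_abs u (Some i) (x, tau)))%E.
have mJ : measurable_fun [set: measurableTypeR R] J.
  apply: (@measurable_int_row _ _ _ _ _ row cube (fun z => (grad_abs u (Some i) z)%:E) mC).
  - exact/measurable_EFinP.
  - by move=> z; rewrite lee_fin grad_abs_ge0.
have J0 tau : (0 <= J tau)%E by apply: integral_ge0 => x _; rewrite lee_fin grad_abs_ge0.
have B0 : 0 <= B.
  rewrite -lee_fin; apply: le_trans (S0 None); apply: integral_ge0 => tau _.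
  by apply: integral_ge0 => x _; rewrite lee_fin grad_abs_ge0.
have H : (I0 * r%:E <= (3 * B * r)%:E)%E.
  rewrite -integral_itv_cst//.
  apply: (@le_trans _ _ (\int[leb]_(tau in `]0%R, r[) ((B + B)%:E + t%:E * J tau))%E).
    apply: ge0_le_integral => //.
    - apply: measurable_funTS; apply: emeasurable_funD; first exact: measurable_cst.
      exact: measurable_funeM.
    - move=> tau /=; rewrite in_itv/= => tr'.
      apply: le_trans (slice_difference i su pu t2 tr') _.
      by apply: leeD => //; rewrite EFinD; apply: leeD.
  have tJ0 tau : (0 <= t%:E * J tau)%E by apply: mule_ge0 => //; rewrite lee_fin ltW.
  have mtJ : measurable_fun `]0%R, r[ (fun tau => t%:E * J tau)%E.
    by apply: measurable_funTS; exact: measurable_funeM.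
  have BB0 : (0 <= (B + B)%:E)%E by rewrite lee_fin addr_ge0.
  rewrite ge0_integralD//.
  rewrite integral_itv_cst ?lee_fin ?addr_ge0// ge0_integralZl//; last 2 first.
  - exact: measurable_funTS.
  - by rewrite lee_fin ltW.
  have -> : (3 * B * r)%:E = ((B + B)%:E * r%:E + r%:E * B%:E)%E by rewrite -!EFinM -EFinD; congr EFin; ring.
  rewrite leeD2l//; apply: lee_pmul => //; rewrite ?lee_fin ?(ltW t0)//.
    by apply: integral_ge0.
  exact: (S0 (Some i)).
by move: H; rewrite EFinM lee_pmul2r// lte_fin.
Qed.

End differences_of_test_functions.

Section telescoping.
Context {R : realType} {N : nat}.
Local Notation row := (lebesgue_row N).
Local Notation cube := (@open_cube R N).
Local Notation "'\In_' x F" := (\int[row]_(x in cube) (F%R)%:E)%E (at level 36, x name, F at level 36).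
Local Notation e_ i := (delta_mx ord0 i : 'rV[R]_N).
Implicit Types (F : 'rV[R]_N -> R) (h x : 'rV[R]_N) (r t B : R).
Let mC := @measurable_open_cube R N.

Let mabs : measurable_fun [set: R] (fun t : R => `|t|).
Proof. exact: normr_measurable. Qed.

Lemma int_bdiffN F h : (forall i, `|h ord0 i| <= 2 * pi) ->
  measurable_fun [set: 'rV[R]_N] F -> periodic_row F ->
  (\In_x (`|bdiff (- h) 1 F x|) = \In_x (`|bdiff h 1 F x|))%E.
Proof.
move=> hb mF pF.
have nb i : `|(- h) ord0 i| <= 2 * pi by rewrite mxE normrN.
rewrite -[RHS](int_shift nb mabs (@normr_ge0 _ R) (measurable_bdiff h 1 mF) (periodic_bdiff h 1 pF)).
apply: eq_integral => x _; congr EFin; rewrite /bdiff subrK !mulN1r !mul1r distrC.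
by [].
Qed.

(** [H k] keeps the first [k] coordinates of [h], so consecutive ones differ by a shift in one
    coordinate, whose integral is unaffected by the translation by [H k]. Negative coordinates are
    reversed by [int_bdiffN]. *)
Lemma telescope_bdiff F r B : 0 <= r <= 1 -> 0 <= B ->
  measurable_fun [set: 'rV[R]_N] F -> periodic_row F ->
  (forall i t, 0 < t <= r -> (\In_x (`|bdiff (t *: e_ i) 1 F x|) <= B%:E)%E) ->
  forall h, (forall i, `|h ord0 i| <= r) -> (\In_x (`|bdiff h 1 F x|) <= (N%:R * B)%:E)%E.
Proof.
move=> /andP[r0 r1] B0 mF pF HB h hr.
have r2 : r <= 2 * pi.
  by apply: le_trans r1 _; have := pi_ge2 R; move=> ?; lra.
have Hte i t : `|t| <= r -> (\In_x (`|bdiff (t *: e_ i) 1 F x|) <= B%:E)%E.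
  move=> tr; have hb j : `|(t *: e_ i) ord0 j| <= 2 * pi.
    rewrite !mxE eqxx/=; case: eqP => _; rewrite ?mulr1 ?mulr0 ?normr0 ?mulr_ge0 ?pi_ge0//.
    exact: le_trans r2.
  have [t0|t0|t0] := ltgtP t 0.
  - rewrite -(int_bdiffN hb mF pF) -scaleNr; apply: HB.
    by rewrite oppr_gt0 t0/= -(ltr0_norm t0).
  - by apply: HB; rewrite t0/= -(gtr0_norm t0).
  - rewrite t0 integral0_eq ?lee_fin// => x _; congr EFin.
    by rewrite /bdiff scale0r addr0 mul1r mulN1r subrr normr0.
pose H k := (\row_i (if (i < k)%N then h ord0 i else 0)) : 'rV[R]_N.
have Hr k i : `|H k ord0 i| <= r by rewrite mxE; case: ifP => // _; rewrite normr0.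
have K k : (k <= N)%N -> (\In_x (`|bdiff (H k) 1 F x|) <= (k%:R * B)%:E)%E.
  elim: k => [_|k IH kN].
    rewrite (_ : H 0%N = 0); last by apply/rowP => i; rewrite !mxE.
    rewrite integral0_eq ?lee_fin ?mulr_ge0// => x _; congr EFin.
    by rewrite /bdiff addr0 mul1r mulN1r subrr normr0.
  pose i0 := Ordinal kN.
  have HS : H k.+1 = H k + h ord0 i0 *: e_ i0.
    apply/rowP => i; rewrite !mxE eqxx/= ltnS leq_eqVlt.
    have [->|ne] := eqVneq i i0; first by rewrite eqxx/= ltnn add0r mulr1.
    by rewrite -[(i : nat) == k]/(i == i0) (negbTE ne) mulr0 addr0.
  have hk : `|h ord0 i0| <= r by [].
  have Hb j : `|H k ord0 j| <= 2 * pi by exact: le_trans r2.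
  have mD := measurable_bdiff (h ord0 i0 *: e_ i0) 1 mF.
  have mDk := measurable_bdiff (H k) 1 mF.
  have E := int_shift Hb mabs (@normr_ge0 _ R) mD (periodic_bdiff _ 1 pF).
  apply: (@le_trans _ _ (1%:E * \In_x (`|bdiff (h ord0 i0 *: e_ i0) 1 F (x + H k)|) + 1%:E * \In_x (`|bdiff (H k) 1 F x|))%E).
    apply: int_lin_le => //.
    - apply: measurable_funTS; apply: measurableT_comp => //; exact: (measurable_bdiff _ 1 mF).
    - apply: measurable_funTS; apply: measurableT_comp => //; exact: (measurable_shift_row _ mD).
    - by apply: measurable_funTS; apply: measurableT_comp.
    move=> x _; rewrite normr_ge0/= !mul1r; apply: le_trans (ler_normD _ _).
    by rewrite HS /bdiff addrA le_eqVlt; apply/orP; left; apply/eqP; congr `|_|; ring.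
  rewrite E !mul1e (_ : (k.+1%:R * B)%:E = (B%:E + (k%:R * B)%:E)%E); last first.
    by rewrite -EFinD -natr1; congr EFin; ring.
  exact: leeD (Hte _ _ hk) (IH (ltnW kN)).
have -> : h = H N by apply/rowP => i; rewrite !mxE ltn_ord.
exact: K.
Qed.

End telescoping.

Section start.
Context {R : realType} {N : nat} (s m : R).
Local Notation p := (crit_exp N s).
Local Notation row := (lebesgue_row N).
Local Notation cube := (@open_cube R N).
Local Notation "'\In_' x F" := (\int[row]_(x in cube) (F%R)%:E)%E (at level 36, x name, F at level 36).
Implicit Types (h x : 'rV[R]_N) (r t : R).

(** The bound for increments of test functions depends on them only through the energy bound [M], so
    [T] may be compared with a [u_ n] whose index depends on [r] and whose L^1 distance to [T] is
    O(r^s). *)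
Lemma trace_diff_decay (v : @Xspace R N s m) (T : 'rV[R]_N -> R) : 0 < s < 1 -> 1 < p ->
  is_trace v T -> measurable_fun [set: 'rV[R]_N] T -> periodic_row T -> diff_decay T s.
Proof.
move=> s01 p1 trv mT pT; have /andP[s0 _] := s01.
have [u_ au] := X_approximable v; have [tu_ _] := au.
have [M M0 nM] := energy_bounded au.
set C0 := 3 * (M + (2 * pi) ^+ N / (2 * s)).
have pi2 : 0 <= (2 * pi) ^+ N :> R by rewrite exprn_ge0// mulr_ge0// pi_ge0.
have C00 : 0 < C0 by rewrite mulr_gt0// ltr_wpDr// divr_ge0// mulr_ge0// ltW.
pose D0 : R := 4 * ((2 * pi) ^+ N + 1).
have D00 : 0 < D0 by rewrite mulr_gt0// ltr_wpDl.
exists 1, (N%:R * C0 + D0); split => //; first by rewrite ltr_wpDl// mulr_ge0// ltW.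
move=> r h /andP[r0 r1] hr.
have hb i : `|h ord0 i| <= 2 * pi.
  apply: le_trans (hr i) (le_trans r1 _).
  by have := pi_ge2 R; move=> ?; lra.
have rs0 : 0 < r `^ s by exact: powR_gt0.
(* The weight (r^s)^(1 - p) is that of [le_addpowR] with threshold r^s; it turns L^p closeness into
   L^1 closeness of order r^s. *)
have nT := cvg_boundary trv au (powR_ge0 (r `^ s) (1 - p)) rs0.
near \oo => n.
have uT : (((r `^ s) `^ (1 - p))%:E * \In_x (`|u_ n (x, 0) - T x| `^ p) <= (r `^ s)%:E)%E by near: n.
have uM : (energy s m (u_ n) (gradient (u_ n)) <= M%:E)%E by near: n.
have tu := tu_ n; pose U x := u_ n (x, 0).
have mU : measurable_fun [set: 'rV[R]_N] U by exact: measurable_boundary tu.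
have pU : periodic_row U by exact: periodic_boundary tu.
have mD : measurable_fun [set: 'rV[R]_N] (fun x => U x - T x) by exact: measurable_funB.
have pD : periodic_row (fun x => U x - T x) by move=> i x; rewrite pU pT.
have near1 : (\In_x (`|U x - T x|) <= (((2 * pi) ^+ N + 1) * r `^ s)%:E)%E.
  apply: (@le_trans _ _ ((r `^ s)%:E * \In_x 1 + ((r `^ s) `^ (1 - p))%:E * \In_x (`|U x - T x| `^ p))%E).
    apply: int_lin_le => //; try exact: powR_ge0.
    - exact: measurable_open_cube.
    - by apply: measurable_funTS; apply: measurableT_comp.
    - by apply: measurable_powR_norm; exact: measurable_funTS.
    move=> x _; rewrite normr_ge0 mulr1/=.
    by apply: le_addpowR => //; exact: ltW.
  rewrite mulrDl !mul1r EFinD; apply: leeD; last exact: uT.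
  have H1 := @int_cst R N 1; rewrite mul1r in H1.
  by rewrite H1 [X in (_ <= X)%E]EFinM muleC.
have E1 : (\In_x (`|bdiff h 1 U x|) <= (N%:R * (C0 * r `^ s))%:E)%E.
  apply: (@telescope_bdiff _ _ U r) => //; first by rewrite ltW.
    by rewrite mulr_ge0// ltW.
  move=> i t tr.
  apply: le_trans (coordinate_difference s01 i tu uM tr r1).
  rewrite le_eqVlt; apply/orP; left; apply/eqP; apply: eq_integral => x _.
  by rewrite /bdiff mul1r mulN1r.
have E2 : (\In_x (`|bdiff h 1 (fun x => U x - T x)%R x|) <= (4 * (((2 * pi) ^+ N + 1) * r `^ s))%:E)%E.
  have := int_bdiff_le hb (_ : `|1| <= 1 :> R) ler01 mD pD.
  rewrite normr1 lexx => /(_ isT); rewrite powRr1//.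
  under eq_integral do rewrite powRr1//.
  under [X in (_ <= _ * X)%E -> _]eq_integral do rewrite powRr1//.
  move=> H; apply: le_trans H _; rewrite [X in (_ <= X)%E]EFinM.
  rewrite (_ : 2 * 2 = 4 :> R); last by ring.
  exact: lee_wpmul2l.
under eq_integral do rewrite powRr1//.
apply: (@le_trans _ _ (1%:E * \In_x (`|bdiff h 1 U x|) + 1%:E * \In_x (`|bdiff h 1 (fun x => U x - T x)%R x|))%E).
  apply: int_lin_le => //.
  - exact: measurable_open_cube.
  - by apply: measurable_funTS; apply: measurableT_comp => //; exact: (measurable_bdiff _ _ mT).
  - by apply: measurable_funTS; apply: measurableT_comp => //; exact: (measurable_bdiff _ _ mU).
  - by apply: measurable_funTS; apply: measurableT_comp => //; exact: (measurable_bdiff _ _ mD).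
  move=> x _; rewrite normr_ge0/= !mul1r; apply: le_trans (ler_normB _ _).
  by rewrite /bdiff le_eqVlt; apply/orP; left; apply/eqP; congr `|_|; ring.
rewrite !mul1e (_ : _ * r `^ s = N%:R * (C0 * r `^ s) + 4 * (((2 * pi) ^+ N + 1) * r `^ s)); last by rewrite /D0; ring.
by rewrite EFinD; exact: leeD.
Unshelve. all: by end_near.
Qed.

End start.

(** * Campanato's argument *)

Section averages.
Context {R : realType} {N : nat}.
Local Notation row := (lebesgue_row N).
Local Notation cube := (@open_cube R N).
Local Notation "'\In_' x F" := (\int[row]_(x in cube) (F%R)%:E)%E (at level 36, x name, F at level 36).
Local Notation Q r := (@box R N `[0%R, r]%classic).
Local Notation B r := (@box R N `[(- r)%R, r]%classic).
Implicit Types (F : 'rV[R]_N -> R) (h x y : 'rV[R]_N) (r c : R).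
Let mC := @measurable_open_cube R N.

Let mQ r : measurable (Q r). Proof. exact: measurable_box. Qed.
Let mB r : measurable (B r). Proof. exact: measurable_box. Qed.

Lemma lebesgue_row_Q r : 0 < r -> row (Q r) = (r ^+ N)%:E.
Proof. by move=> r0; rewrite lebesgue_row_box// lebesgue_measure_itv/= lte_fin r0 oppr0 adde0 EFin_expe. Qed.

Lemma lebesgue_row_B r : 0 < r -> row (B r) = ((2 * r) ^+ N)%:E.
Proof.
move=> r0; rewrite lebesgue_row_box// lebesgue_measure_itv/= lte_fin gtrN// EFin_expe.
by congr (_ ^+ _)%E; rewrite -EFinB; congr EFin; ring.
Qed.

(** Applied to y |-> T (y + x) this averages over the cube with corner [x]. For [r <= 1] the cube
    [Q r] lies in the period cell, so moving it by any [x] of the closed cube is covered by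
    periodicity. *)
Definition avg r F := (r ^+ N)^-1 * \int[row]_(y in Q r) F y.

Lemma avg_dist r c F : 0 < r -> row.-integrable (Q r) (EFin \o F) ->
  ((`|c - avg r F|)%:E <= ((r ^+ N)^-1)%:E * \int[row]_(y in Q r) (`|c - F y|)%:E)%E.
Proof.
move=> r0 iF; have rN : 0 < r ^+ N by rewrite exprn_gt0.
have ic : row.-integrable (Q r) (EFin \o (fun=> c)).
  apply: int_fin_integrable => //.
  by rewrite integral_cst//= lebesgue_row_Q// -EFinM ltry.
have -> : c - avg r F = (r ^+ N)^-1 * \int[row]_(y in Q r) (c - F y).
  rewrite RintegralB// mulrBr /avg; congr (_ - _).
  rewrite Rintegral_cst//= lebesgue_row_Q//=.
  by field; rewrite gt_eqF.
rewrite normrM ger0_norm ?invr_ge0 ?(ltW rN)// EFinM; apply: lee_wpmul2l; first by rewrite lee_fin invr_ge0 ltW.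
have iD : row.-integrable (Q r) (EFin \o (fun y => c - F y)) by exact: (integrableB (mQ r) ic iF).
rewrite EFin_normr_Rintegral//; apply: (le_trans (le_abse_integral _ _ _)) => //.
by case/integrableP : iD.
Qed.

Variables (q C a : R) (T : 'rV[R]_N -> R).
Hypothesis q1 : 1 <= q.
Hypothesis C0 : 0 < C.
Hypothesis mT : measurable_fun [set: 'rV[R]_N] T.
Hypothesis pT : periodic_row T.
Hypothesis finT : (\In_x (`|T x|) < +oo)%E.
Hypothesis decay : forall r h, 0 < r <= 1 -> (forall i, `|h ord0 i| <= r) ->
  (\In_x (`|bdiff h 1 T x| `^ q) <= (C * r `^ a)%:E)%E.

Let mabs : measurable_fun [set: R] (fun t : R => `|t|).
Proof. exact: normr_measurable. Qed.

Let pi2 : 2 <= pi :> R. Proof. exact: pi_ge2. Qed.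

Let Q_cube r : r <= 1 -> Q r `<=` cube.
Proof.
move=> r1 y Qy i; have := Qy i; rewrite /= in_itv/= => /andP[y0 yr].
by have := pi2; move=> ?; apply/andP; split; lra.
Qed.

Let cube_bound x : closed_cube x -> forall i, `|x ord0 i| <= 2 * pi.
Proof.
move=> cx i; have := cx i; rewrite -ler_norml => /le_trans; apply.
by have := pi2; move=> ?; lra.
Qed.

Lemma int_Q_le x r : closed_cube x -> r <= 1 ->
  (\int[row]_(y in Q r) (`|T (y + x)|)%:E <= \In_x (`|T x|))%E.
Proof.
move=> cx r1; have m1 : measurable_fun [set: 'rV[R]_N] (fun y => (`|T (y + x)|)%:E).
  by apply/measurable_EFinP; apply: measurableT_comp => //; exact: (measurable_shift_row x mT).
apply: (@le_trans _ _ (\In_y (`|T (y + x)|)))%E.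
  by apply: ge0_subset_integral => //; [exact: measurable_funTS|exact: Q_cube].
by rewrite (int_shift (cube_bound cx) mabs (@normr_ge0 _ R) mT pT).
Qed.

Lemma integrable_Q x r : closed_cube x -> r <= 1 ->
  row.-integrable (Q r) (EFin \o (fun y => T (y + x))).
Proof.
move=> cx r1; apply: int_fin_integrable => //.
  by apply: measurable_funTS; exact: (measurable_shift_row x mT).
by apply: le_lt_trans finT; exact: int_Q_le.
Qed.

Let Phi x x' (z : 'rV[R]_N * 'rV[R]_N) : \bar R := (`|T (z.1 + x) - T (z.2 + x')| `^ q)%:E.

Let mTx d (S : measurableType d) (f : S -> 'rV[R]_N) x : measurable_fun [set: S] f ->
  measurable_fun [set: S] (fun z => T (f z + x)).
Proof. by move=> mf; exact: (measurableT_comp (measurable_shift_row x mT) mf). Qed.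

Let maddrow d (S : measurableType d) (f g : S -> 'rV[R]_N) : measurable_fun [set: S] f ->
  measurable_fun [set: S] g -> measurable_fun [set: S] (fun z => f z + g z).
Proof.
move=> mf mg; apply: measurable_to_mx => i j; under eq_fun do rewrite mxE.
by apply: measurable_funD; exact: (measurableT_comp (measurable_mx_coord _ _)).
Qed.

(* After the substitution y' = k + y the increment (k + x' - x) no longer
   depends on y. *)
Lemma double_difference x x' r r' : closed_cube x -> closed_cube x' ->
  (forall i, `|x' ord0 i - x ord0 i| <= r) -> 0 < r' <= r -> r <= 1 / 2 ->
  (\int[row]_(y in Q r) \int[row]_(y' in Q r') Phi x x' (y, y') <=
   ((2 * r) ^+ N * (C * (2 * r) `^ a))%:E)%E.
Proof.
move=> cx cx' xx' /andP[r'0 r'r] r12.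
have r0 : 0 < r by exact: lt_le_trans r'r.
pose f (z : 'rV[R]_N * 'rV[R]_N) := Phi x x' (z.1, z.2 + z.1).
have mPhi d (S : measurableType d) (u w : S -> 'rV[R]_N) : measurable_fun [set: S] u -> measurable_fun [set: S] w ->
    measurable_fun [set: S] (fun z => Phi x x' (u z, w z)).
  move=> mu mw; apply/measurable_EFinP; apply: measurable_powR_norm.
  by apply: measurable_funB; exact: mTx.
have mf : measurable_fun [set: 'rV[R]_N * 'rV[R]_N] f.
  by apply: mPhi; [exact: measurable_fst|apply: maddrow; [exact: measurable_snd|exact: measurable_fst]].
have Phi0 z : (0 <= Phi x x' z)%E by rewrite lee_fin powR_ge0.
have f0 z : (0 <= f z)%E by exact: Phi0.
have mf1 y : measurable_fun [set: 'rV[R]_N] (fun k => f (y, k)).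
  exact: (mPhi _ _ (fun _ : 'rV[R]_N => y) (fun k : 'rV[R]_N => k + y) (measurable_cst _) (measurable_addrow y)).
have mf2 k : measurable_fun [set: 'rV[R]_N] (fun y => f (y, k)).
  exact: (mPhi _ _ id (fun y : 'rV[R]_N => k + y) (@measurable_id _ _ _) (maddrow (measurable_cst k) (@measurable_id _ _ _))).
have S1 y : Q r y -> (\int[row]_(y' in Q r') Phi x x' (y, y') <= \int[row]_(k in B r) f (y, k))%E.
  move=> Qy; rewrite integral_mkcond [leRHS]integral_mkcond.
  have mP : measurable_fun [set: 'rV[R]_N] ((fun y' => Phi x x' (y, y')) \_ (Q r')).
    by apply: (iffLR (measurable_restrictT _ (mQ r'))); apply: measurable_funTS; apply: mPhi => //.
  have P0 k : (0 <= ((fun y' => Phi x x' (y, y')) \_ (Q r')) k)%E by apply: erestrict_ge0.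
  rewrite -(integral_row_shift y mP P0); apply: ge0_le_integral => //.
  - by apply: (measurableT_comp mP); exact: measurable_addrow.
  - by apply: (iffLR (measurable_restrictT _ (mB r))); exact: measurable_funTS (mf1 y).
  move=> k _; rewrite /patch; case: ifPn => [/set_mem Qk|_]; last by case: ifPn => // _; exact: f0.
  rewrite mem_set// => i; rewrite /= in_itv/=; have := Qk i; have := Qy i.
  rewrite /= !in_itv/= !mxE => /andP[y0 yr] /andP[k0 kr]; apply/andP; split; lra.
apply: (@le_trans _ _ (\int[row]_(y in Q r) \int[row]_(k in B r) f (y, k))%E).
  have mPP : measurable_fun [set: 'rV[R]_N * 'rV[R]_N] (Phi x x').
    exact: (mPhi _ _ _ _ measurable_fst measurable_snd).
  have g1 := @measurable_int_line _ _ _ _ _ row (Q r') (Phi x x') (mQ r') mPP Phi0.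
  have g2 := @measurable_int_line _ _ _ _ _ row (B r) f (mB r) mf f0.
  have g0 y : Q r y -> (0 <= \int[row]_(y' in Q r') Phi x x' (y, y'))%E.
    by move=> _; apply: integral_ge0 => y' _; exact: Phi0.
  exact: (ge0_le_integral row (mQ r) g0 (measurable_funTS g1) (measurable_funTS g2) S1).
rewrite (@tonelli_rect _ _ _ _ _ row row (Q r) (B r) f (mQ r) (mB r) mf f0).
apply: (@le_trans _ _ (\int[row]_(k in B r) (C * (2 * r) `^ a)%:E)%E); last first.
  by rewrite integral_cst//= lebesgue_row_B// -EFinM mulrC.
apply: ge0_le_integral => //.
- by move=> k _; apply: integral_ge0 => y _; exact: f0.
- by apply: measurable_funTS; exact: (@measurable_int_row _ _ _ _ _ row (Q r) f (mQ r)).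
(* The coordinates of [h] are at most [2 * r], which has to be at most 1 for [decay]; hence the
   condition [r <= 1 / 2]. *)
move=> k Bk; pose h := k + x' - x.
have hr i : `|h ord0 i| <= 2 * r.
  have := Bk i; rewrite /= in_itv/= -ler_norml => kr.
  rewrite /h !mxE -addrA; apply: le_trans (ler_normD _ _) _.
  by rewrite mulrDl mul1r; apply: lerD.
have r2 : 0 < 2 * r <= 1 by apply/andP; split; lra.
have hb i : `|h ord0 i| <= 2 * pi.
  by apply: le_trans (hr i) _; have := pi2; move=> ?; case/andP: r2 => _ ?; lra.
apply: le_trans (decay r2 hr).
have mpow : measurable_fun [set: R] (fun t : R => `|t| `^ q).
  by apply: measurable_powR_norm; exact: measurable_id.
rewrite -(int_shift (cube_bound cx) mpow _ (measurable_bdiff h 1 mT) (periodic_bdiff h 1 pT)); last first.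
  by move=> t; exact: powR_ge0.
apply: (@le_trans _ _ (\int[row]_(y in cube) f (y, k))%E).
  apply: ge0_subset_integral => //; first exact: measurable_funTS.
  by apply: Q_cube; case/andP: r2 => _ ?; lra.
rewrite le_eqVlt; apply/orP; left; apply/eqP; apply: eq_integral => y _; congr EFin.
rewrite /= /bdiff mul1r mulN1r distrC; congr (`|T _ - _| `^ _).
by rewrite /h !addrA [y + x + k]addrAC [_ + x + x']addrAC addrK [y + k]addrC.
Qed.

Hypothesis aN : N%:R < a.
Local Notation alpha := ((a - N%:R) / q).
Local Notation A r x := (avg r (fun y => T (y + x))).

Let q0 : 0 < q. Proof. exact: lt_le_trans q1. Qed.

Let C1 := 4 ^+ N * C * 2 `^ a.

(** The exponent alpha = (a - N)/q is the one for which (r^alpha)^(1 - q) r^(a - N) = r^alpha. In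
    [C1], one 2^N pays for [r'] against [r], the other 2^N and 2^a for the doubled radius. *)
Lemma decay_constants (r r' : R) : 0 < r -> r / 2 <= r' ->
  (r ^+ N)^-1 * ((r `^ alpha) `^ (1 - q) * ((r' ^+ N)^-1 * ((2 * r) ^+ N * (C * (2 * r) `^ a)))) <= C1 * r `^ alpha.
Proof.
move=> r0 rr'; have r20 : 0 < r / 2 by rewrite divr_gt0.
have r'0 : 0 < r' by exact: lt_le_trans rr'.
have rN : 0 < r ^+ N by rewrite exprn_gt0.
have inv : (r' ^+ N)^-1 <= 2 ^+ N * (r ^+ N)^-1.
  rewrite -[2 ^+ N]invrK -invfM lef_pV2 ?posrE ?exprn_gt0 ?mulr_gt0 ?invr_gt0 ?exprn_gt0//.
  rewrite -exprVn -exprMn mulrC; apply: lerXn2r; [by rewrite nnegrE ltW|by rewrite nnegrE ltW|exact: rr'].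
have E : (2 * r) `^ a = 2 `^ a * (r `^ (a - N%:R) * r ^+ N).
  rewrite powRM ?(ltW r0)//; congr (_ * _).
  rewrite -[r ^+ N]powR_mulrn ?(ltW r0)// -powRD ?subrK//.
  by rewrite (gt_eqF r0) implybT.
have Ea : (r `^ alpha) `^ (1 - q) * r `^ (a - N%:R) = r `^ alpha.
  rewrite -powRrM -powRD ?(gt_eqF r0) ?implybT//; congr (_ `^ _).
  by field; rewrite gt_eqF.
rewrite E exprMn.
set P := (r `^ alpha) `^ (1 - q) in Ea *; set S := r `^ (a - N%:R) in Ea *.
have PS0 : 0 <= P * S by rewrite mulr_ge0 ?powR_ge0.
apply: (@le_trans _ _ ((r ^+ N)^-1 * (P * ((2 ^+ N * (r ^+ N)^-1) * (2 ^+ N * r ^+ N * (C * (2 `^ a * (S * r ^+ N)))))))).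
  apply: ler_wpM2l; first by rewrite invr_ge0 ltW.
  apply: ler_wpM2l; first exact: powR_ge0.
  apply: ler_wpM2r => //.
  apply: mulr_ge0; first by rewrite mulr_ge0 ?exprn_ge0// ltW.
  apply: mulr_ge0; first exact: ltW.
  by apply: mulr_ge0; [exact: powR_ge0|apply: mulr_ge0; [exact: powR_ge0|exact: ltW]].
have rNn := lt0r_neq0 rN.
rewrite le_eqVlt /C1; apply/orP; left; apply/eqP; rewrite -Ea.
have -> : 4 ^+ N = 2 ^+ N * 2 ^+ N :> R by rewrite -exprMn; congr (_ ^+ _); ring.
move: (r ^+ N) rNn (2 ^+ N : R) => z zn w.
by field; rewrite zn.
Qed.

(** Covers both comparisons of Campanato's argument: neighbouring points at the same radius, and one
    point with the radius halved. [avg_dist] is used twice, and [le_addpowR] with threshold r^alpha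
    reduces the double average to [double_difference]. *)
Lemma avg_close x x' r r' : closed_cube x -> closed_cube x' ->
  (forall i, `|x' ord0 i - x ord0 i| <= r) -> 0 < r -> r / 2 <= r' <= r -> r <= 1 / 2 ->
  `|A r x - A r' x'| <= (1 + C1) * r `^ alpha.
Proof.
move=> cx cx' xx' r0 /andP[rr' r'r] r12.
have r'0 : 0 < r' by apply: lt_le_trans rr'; rewrite divr_gt0.
have r1 : r <= 1 by lra.
have r'1 : r' <= 1 by lra.
set c := A r' x'; set eps := r `^ alpha.
have eps0 : 0 < eps by exact: powR_gt0.
have rN : 0 < r ^+ N by rewrite exprn_gt0.
have r'N : 0 < r' ^+ N by rewrite exprn_gt0.
have mP : measurable_fun [set: 'rV[R]_N * 'rV[R]_N] (Phi x x').
  apply/measurable_EFinP; apply: measurable_powR_norm.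
  by apply: measurable_funB; apply: mTx; [exact: measurable_fst|exact: measurable_snd].
have P0 z : (0 <= Phi x x' z)%E by rewrite lee_fin powR_ge0.
pose G y := (\int[row]_(y' in Q r') Phi x x' (y, y'))%E.
have mG : measurable_fun [set: 'rV[R]_N] G.
  exact: (@measurable_int_line _ _ _ _ _ row (Q r') (Phi x x') (mQ r') mP P0).
have G0 y : (0 <= G y)%E by apply: integral_ge0 => y' _; exact: P0.
have k0 : 0 <= eps `^ (1 - q) * (r' ^+ N)^-1 by rewrite mulr_ge0 ?powR_ge0// invr_ge0 ltW.
have mTl z : measurable_fun [set: 'rV[R]_N] (fun y => T (y + z)) by exact: (measurable_shift_row z mT).
have S1 y : ((`|c - T (y + x)|)%:E <= eps%:E + (eps `^ (1 - q) * (r' ^+ N)^-1)%:E * G y)%E.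
  rewrite distrC; apply: le_trans (avg_dist (T (y + x)) r'0 (integrable_Q cx' r'1)) _.
  apply: (@le_trans _ _ (((r' ^+ N)^-1)%:E * (eps%:E * (r' ^+ N)%:E + (eps `^ (1 - q))%:E * G y))%E).
    apply: lee_wpmul2l; first by rewrite lee_fin invr_ge0 ltW.
    have -> : (r' ^+ N)%:E = (\int[row]_(y' in Q r') 1%:E)%E.
      by rewrite integral_cst//= lebesgue_row_Q// mul1e.
    apply: int_lin_le => //; try exact: powR_ge0; try exact: ltW.
    - apply: measurable_funTS; apply: measurableT_comp => //.
      exact: (measurable_funB (measurable_cst (T (y + x))) (mTl x')).
    - apply: measurable_powR_norm; apply: measurable_funTS.
      exact: (measurable_funB (measurable_cst (T (y + x))) (mTl x')).
    move=> y' _; rewrite normr_ge0/= mulr1; exact: le_addpowR.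
  rewrite muleDr ?fin_num_adde_defr// -EFinM.
  have -> : (r' ^+ N)^-1 * (eps * r' ^+ N) = eps by field; rewrite gt_eqF.
  by rewrite muleA -EFinM [_^-1 * _]mulrC.
rewrite distrC -lee_fin; apply: le_trans (avg_dist c r0 (integrable_Q cx r1)) _.
apply: (@le_trans _ _ (((r ^+ N)^-1)%:E * (eps%:E * (r ^+ N)%:E +
    (eps `^ (1 - q) * (r' ^+ N)^-1)%:E * ((2 * r) ^+ N * (C * (2 * r) `^ a))%:E))%E).
  apply: lee_wpmul2l; first by rewrite lee_fin invr_ge0 ltW.
  apply: (@le_trans _ _ (\int[row]_(y in Q r) (eps%:E + (eps `^ (1 - q) * (r' ^+ N)^-1)%:E * G y))%E).
    apply: (ge0_le_integral row (mQ r)).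
    - by move=> y _; rewrite lee_fin.
    - apply: measurable_funTS; apply/measurable_EFinP; apply: measurableT_comp => //.
      by apply: measurable_funB; [exact: measurable_cst|exact: (mTl x)].
    - apply: measurable_funTS; apply: emeasurable_funD; first exact: measurable_cst.
      exact: measurable_funeM.
    - by move=> y _; exact: S1.
  have kG0 y : Q r y -> (0 <= (eps `^ (1 - q) * (r' ^+ N)^-1)%:E * G y)%E.
    by move=> _; apply: mule_ge0 => //; rewrite lee_fin.
  have mkG : measurable_fun (Q r) (fun y => (eps `^ (1 - q) * (r' ^+ N)^-1)%:E * G y)%E.
    by apply: measurable_funTS; exact: measurable_funeM.
  have e0 y : Q r y -> (0 <= eps%:E :> \bar R)%E by move=> _; rewrite lee_fin ltW.
  rewrite (ge0_integralD row (mQ r) e0 (measurable_cst _) kG0 mkG).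
  rewrite integral_cst//= lebesgue_row_Q//; apply: leeD => //.
  have G0' y : Q r y -> (0 <= G y)%E by [].
  rewrite (ge0_integralZl row (mQ r) (measurable_funTS mG) G0'); last by rewrite lee_fin.
  apply: lee_wpmul2l; first by rewrite lee_fin.
  by apply: double_difference => //; rewrite r'0.
change (((r ^+ N)^-1 * (eps * r ^+ N + eps `^ (1 - q) * (r' ^+ N)^-1 * ((2 * r) ^+ N * (C * (2 * r) `^ a))))%:E <=
  ((1 + C1) * eps)%:E)%E.
rewrite lee_fin [X in X <= _]mulrDr [X in _ <= X]mulrDl mul1r.
have -> : (r ^+ N)^-1 * (eps * r ^+ N) = eps by field; rewrite gt_eqF.
rewrite lerD2l -[_ * _ * (_ * _)]mulrA.
exact: decay_constants.
Qed.

Lemma avg_bound x r : closed_cube x -> 0 < r <= 1 ->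
  `|A r x| <= (r ^+ N)^-1 * fine (\In_x (`|T x|))%E.
Proof.
move=> cx /andP[r0 r1]; have I0 : (0 <= \In_x (`|T x|))%E by apply: integral_ge0.
rewrite -[`|_|]normrN -[X in `|X|]add0r -lee_fin.
apply: le_trans (avg_dist 0 r0 (integrable_Q cx r1)) _.
rewrite EFinM fineK ?ge0_fin_numE//; apply: lee_wpmul2l; first by rewrite lee_fin invr_ge0 exprn_ge0// ltW.
by under eq_integral do rewrite sub0r normrN; exact: int_Q_le.
Qed.

(** The dyadic radii start at 1/2, the largest one that [avg_close] admits. *)
Let rho k : R := (2 ^+ k.+1)^-1.

Let rho_gt0 k : 0 < rho k. Proof. by rewrite invr_gt0 exprn_gt0. Qed.

Let rhoS k : rho k.+1 = rho k / 2.
Proof. by rewrite /rho [in LHS]exprS invfM mulrC. Qed.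

Let rho_le k : rho k <= 1 / 2.
Proof.
elim: k => [|k IH]; first by rewrite /rho expr1 mul1r.
by rewrite rhoS; have := rho_gt0 k; lra.
Qed.

Let alpha_gt0 : 0 < alpha. Proof. by rewrite divr_gt0// subr_gt0. Qed.

Let theta : R := 2^-1 `^ alpha.

Let theta01 : 0 < theta < 1.
Proof.
have E1 : 1 `^ alpha = 1 :> R by rewrite powR1.
rewrite powR_gt0//= /theta -[ltRHS]E1 gt0_ltr_powR// ?nnegrE ?invr_ge0//.
by rewrite invf_lt1// ltr1n.
Qed.

Let C1_ge0 : 0 <= C1.
Proof. by rewrite !mulr_ge0 ?powR_ge0 ?exprn_ge0// ltW. Qed.

(** Sum over j >= k of the errors (1 + C1) rho_j^alpha, a geometric series of ratio [theta]. *)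
Let Bk k := (1 + C1) / (1 - theta) * rho k `^ alpha.

Let BkS k : Bk k - Bk k.+1 = (1 + C1) * rho k `^ alpha.
Proof.
rewrite /Bk rhoS powRM ?(ltW (rho_gt0 _))// -/theta.
have /andP[_ t1] := theta01; by field; rewrite gt_eqF// subr_gt0.
Qed.

Let Bk_gt0 k : 0 < Bk k.
Proof.
have /andP[_ t1] := theta01.
by rewrite mulr_gt0 ?powR_gt0// divr_gt0 ?subr_gt0// ltr_wpDr.
Qed.

Lemma avg_telescope x k n : closed_cube x -> `|A (rho k) x - A (rho (k + n)) x| <= Bk k - Bk (k + n).
Proof.
move=> cx; elim: n => [|n IH]; first by rewrite addn0 !subrr normr0.
rewrite -[X in `|X|](subrKA (A (rho (k + n)) x)) -[leRHS](subrKA (Bk (k + n))).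
apply: le_trans (ler_normD _ _) (lerD IH _).
rewrite addnS BkS; apply: avg_close => //.
- by move=> i; rewrite subrr normr0 ltW.
- by rewrite rhoS; have := rho_gt0 (k + n)%N; move=> ?; apply/andP; split; lra.
Qed.

(* The limit of the averages, written as an infimum: [A (rho k) x + Bk k] is
   nonincreasing in [k]. *)
Definition holder_rep x : R := inf (range (fun k => A (rho k) x + Bk k)).

Lemma holder_rep_close x k : closed_cube x -> `|A (rho k) x - holder_rep x| <= Bk k.
Proof.
move=> cx; pose S := range (fun k => A (rho k) x + Bk k).
(* Averages at two scales differ by at most the difference of their tails, so no A_j + B_j drops
   below A_k - B_k, whether j precedes k or follows it. *)
have lb : lbound S (A (rho k) x - Bk k).
  move=> _ [j _ <-].
  have [jk|kj] := leqP j k.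
    have := avg_telescope j (k - j) cx; rewrite subnKC// ler_norml => /andP[H1 H2].
    by have := Bk_gt0 k; have := Bk_gt0 j; lra.
  have := avg_telescope k (j - k) cx; rewrite subnKC 1?ltnW// ler_norml => /andP[H1 H2].
  by have := Bk_gt0 k; have := Bk_gt0 j; lra.
have Sk : S (A (rho k) x + Bk k) by exists k.
have hS : has_inf S by split; [exists (A (rho k) x + Bk k)|exists (A (rho k) x - Bk k)].
have h1 : A (rho k) x - Bk k <= holder_rep x by apply: lb_le_inf => //; exists (A (rho k) x + Bk k).
have h2 : holder_rep x <= A (rho k) x + Bk k by apply: inf_lbound => //; exists (A (rho k) x - Bk k).
by rewrite ler_norml; apply/andP; split; lra.
Qed.

(** Far points are handled by the uniform bound [M]. For near ones the dyadic scale comparable to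
    the distance is used, at the price of one comparison of averages and two passages to the limit,
    which add up to [K]. *)
Lemma holder_rep_holder : exists C2 : R, forall x y, closed_cube x -> closed_cube y ->
  `|holder_rep x - holder_rep y| <= C2 * enorm (x - y) `^ alpha.
Proof.
pose M := 2 ^+ N * fine (\In_x (`|T x|))%E + Bk 0.
have M0 : 0 <= M.
  by rewrite addr_ge0 ?(ltW (Bk_gt0 _))// mulr_ge0 ?exprn_ge0// fine_ge0// integral_ge0.
have HM x : closed_cube x -> `|holder_rep x| <= M.
  move=> cx; have r1 : 0 < rho 0 <= 1.
    by rewrite rho_gt0/=; have := rho_le 0; lra.
  have := avg_bound cx r1; have := holder_rep_close 0 cx.
  rewrite /rho expr1 exprVn invrK => H1 H2.
  have -> : holder_rep x = A (2^-1) x + - (A (2^-1) x - holder_rep x) by ring.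
  by apply: le_trans (ler_normD _ _) (lerD H2 _); rewrite normrN.
pose K := (1 + C1) + 2 * ((1 + C1) / (1 - theta)).
have /andP[th0 th1] := theta01.
have K0 : 0 <= K.
  have c0 : 0 <= 1 + C1 by exact: addr_ge0.
  by apply: addr_ge0 => //; apply: mulr_ge0 => //; rewrite divr_ge0// subr_ge0 ltW.
have p2a : 0 <= 2 `^ alpha :> R by exact: powR_ge0.
exists (2 * M * 2 `^ alpha + K * 2 `^ alpha) => x y cx cy.
set e := enorm (x - y).
have e0 : 0 <= e by exact: sqrtr_ge0.
have xe i : `|y ord0 i - x ord0 i| <= e.
  rewrite distrC -sqrtr_sqr ler_wsqrtr// (bigD1 i)//= !mxE lerDl.
  by apply: sumr_ge0 => j _; exact: sqr_ge0.
have ea0 : 0 <= e `^ alpha by exact: powR_ge0.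
(* For e > 1/2 one has (2 e)^alpha >= 1, which accounts for the factor 2^alpha next to [2 * M]. *)
have [e_big|e_small] := ltP (1 / 2) e.
  rewrite mulrDl ler_wpDr//; first by rewrite !mulr_ge0.
  apply: (@le_trans _ _ (2 * M)).
    apply: le_trans (ler_normB _ _) _; rewrite [2 * M]mulrDl mul1r.
    by apply: lerD; exact: HM.
  rewrite -[leRHS]mulrA; apply: ler_peMr; first by rewrite mulr_ge0.
  have E1 : 1 `^ alpha = 1 :> R by rewrite powR1.
  rewrite -powRM// -[leLHS]E1; apply: ge0_powR_le; last exact: ltW.
  by apply/andP; split; lra.
have [e0E|en0] := eqVneq e 0.
  have -> : x = y.
    apply/rowP => i; apply/eqP; rewrite -subr_eq0 -normr_le0 distrC.
    by apply: le_trans (xe i) _; rewrite e0E.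
  by rewrite subrr normr0 mulr_ge0// addr_ge0// !mulr_ge0.
have e1 : 0 < e by rewrite lt_def en0.
(* The least such [k] also satisfies [e <= rho k], by minimality or, for [k = 0], because e <= 1/2;
   so [e] and [rho k] agree up to a factor 2. *)
have ex : exists k, rho k.+1 < e.
  have [k kP] := unbounded_expn e^-1 (ltr1n R 2).
  exists k; rewrite /rho -[ltRHS]invrK ltf_pV2 ?posrE ?invr_gt0 ?exprn_gt0//.
  apply: le_lt_trans kP _; rewrite ltr_eXn2l ?ltr1n//.
case: (ex_minnP ex) => k ke kmin.
have ek : e <= rho k.
  case: k ke kmin => [|k] ke kmin; first by rewrite (le_trans e_small)// /rho expr1 mul1r.
  by rewrite leNgt; apply/negP => /kmin; rewrite ltnn.
have H1 := holder_rep_close k cx; have H2 := holder_rep_close k cy.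
have r2 : rho k / 2 <= rho k <= rho k by have := rho_gt0 k; move=> ?; rewrite lexx andbT; lra.
have H3 := avg_close cx cy (fun i => le_trans (xe i) ek) (rho_gt0 k) r2 (rho_le k).
have HK : `|holder_rep x - holder_rep y| <= K * rho k `^ alpha.
  have -> : holder_rep x - holder_rep y = - (A (rho k) x - holder_rep x) + (A (rho k) x - A (rho k) y)
     + (A (rho k) y - holder_rep y) by ring.
  apply: le_trans (ler_normD _ _) _; apply: le_trans (lerD (ler_normD _ _) H2) _.
  rewrite normrN; apply: le_trans (lerD (lerD H1 H3) (lexx _)) _.
  by rewrite /Bk /K le_eqVlt; apply/orP; left; apply/eqP; ring.
apply: le_trans HK _; rewrite [leRHS]mulrDl; apply: ler_wpDl; first by rewrite !mulr_ge0.
rewrite -[leRHS]mulrA; apply: ler_wpM2l => //; rewrite -powRM//.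
apply: ge0_powR_le; last exact: ltW.
rewrite ltW//=; move: ke; rewrite rhoS => ke; lra.
Qed.

(** After exchanging the integrals, each fixed [y] leaves the L^1 norm of an increment of size at
    most [rho k]; this gives convergence of the averages to [T] in L^1. The power term comes with a
    surplus r^N, dropped since r <= 1. *)
Lemma mean_difference k : (\int[row]_(x in cube) \int[row]_(y in Q (rho k)) (`|T x - T (y + x)|)%:E <=
  (((2 * pi) ^+ N + C) * rho k `^ alpha * rho k ^+ N)%:E)%E.
Proof.
have r0 := rho_gt0 k; have r1 : rho k <= 1 by have := rho_le k; lra.
set r := rho k in r0 r1 *.
pose f (z : 'rV[R]_N * 'rV[R]_N) := (`|T z.1 - T (z.2 + z.1)|)%:E.
have mf : measurable_fun [set: 'rV[R]_N * 'rV[R]_N] f.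
  apply/measurable_EFinP; apply: measurableT_comp => //; apply: measurable_funB.
    exact: (measurableT_comp mT measurable_fst).
  by apply: (measurableT_comp mT); apply: maddrow; [exact: measurable_snd|exact: measurable_fst].
have f0 z : (0 <= f z)%E by rewrite lee_fin.
rewrite (@tonelli_rect _ _ _ _ _ row row cube (Q r) f mC (mQ r) mf f0).
apply: (@le_trans _ _ (\int[row]_(y in Q r) (((2 * pi) ^+ N + C) * r `^ alpha)%:E)%E); last first.
  by rewrite integral_cst//= lebesgue_row_Q// -EFinM.
have g1 : measurable_fun [set: 'rV[R]_N] (fun y => \int[row]_(x in cube) f (x, y))%E.
  exact: (@measurable_int_row _ _ _ _ _ row cube f mC mf f0).
apply: (ge0_le_integral row (mQ r)).
- by move=> y _; apply: integral_ge0 => x _; exact: f0.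
- exact: measurable_funTS.
- exact: measurable_cst.
move=> y Qy; have hr i : `|y ord0 i| <= r.
  have := Qy i; rewrite /= in_itv/= => /andP[y0 yr].
  by rewrite ger0_norm.
have r01 : 0 < r <= 1 by rewrite r0.
have mD := measurable_bdiff y 1 mT.
have ra0 : 0 < r `^ alpha by exact: powR_gt0.
apply: (@le_trans _ _ ((r `^ alpha)%:E * \In_x 1 + ((r `^ alpha) `^ (1 - q))%:E * \In_x (`|bdiff y 1 T x| `^ q))%E).
  apply: int_lin_le => //; try exact: powR_ge0.
  - apply: measurable_funTS; apply: measurableT_comp => //; apply: measurable_funB => //.
    exact: (measurableT_comp mT (maddrow (measurable_cst y) (@measurable_id _ _ _))).
  - by apply: measurable_powR_norm; exact: measurable_funTS.
  move=> x _; rewrite normr_ge0/= mulr1.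
  rewrite distrC (_ : T (y + x) - T x = bdiff y 1 T x); last by rewrite /bdiff mul1r mulN1r [y + x]addrC.
  exact: le_addpowR.
have H1 := @int_cst R N 1; rewrite mul1r in H1; rewrite H1.
rewrite (_ : (_ + C) * _ = (2 * pi) ^+ N * r `^ alpha + C * r `^ alpha); last by ring.
rewrite [X in (_ <= X)%E]EFinD.
apply: leeD; first by rewrite -EFinM mulrC.
apply: le_trans (lee_wpmul2l _ (decay r01 hr)) _; first by rewrite lee_fin powR_ge0.
rewrite -EFinM lee_fin mulrCA; apply: ler_wpM2l; first exact: ltW.
rewrite -powRrM -powRD ?(gt_eqF r0) ?implybT//.
have -> : alpha * (1 - q) + a = alpha + N%:R by field; rewrite gt_eqF.
rewrite powRD ?(gt_eqF r0) ?implybT// powR_mulrn ?(ltW r0)//.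
by rewrite ler_piMr ?powR_ge0// exprn_ile1// ltW.
Qed.

Lemma small_rho (K eta : R) : 0 < K -> 0 < eta -> exists k, K * rho k `^ alpha <= eta.
Proof.
move=> K0 eta0; pose e := (eta / K) `^ alpha^-1.
have e0 : 0 < e by rewrite powR_gt0// divr_gt0.
have [k kP] := unbounded_expn e^-1 (ltr1n R 2).
exists k; rewrite mulrC -ler_pdivlMr//.
have -> : eta / K = e `^ alpha by rewrite /e -powRrM mulVf ?lt0r_neq0// powRr1// divr_ge0// ltW.
apply: ge0_powR_le; last exact: ltW.
rewrite (ltW (rho_gt0 k))/= /rho -[leRHS]invrK lef_pV2 ?posrE ?invr_gt0 ?exprn_gt0//.
by apply: le_trans kP _; rewrite ler_eXn2l ?ltr1n.
Qed.

(** In place of Lebesgue's differentiation theorem: every [G k] majorises |T - holder_rep| and the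
    integrals of [G k] tend to 0, so the infimum [L] over [k] vanishes almost everywhere.
    Measurability is checked on [L], not on [holder_rep]. *)
Lemma holder_rep_ae : {ae row, forall x, cube x -> T x = holder_rep x}.
Proof.
pose w k x := (((rho k ^+ N)^-1)%:E * \int[row]_(y in Q (rho k)) (`|T x - T (y + x)|)%:E)%E.
pose G k x := (w k x + (Bk k)%:E)%E.
have r1 k : rho k <= 1 by have := rho_le k; lra.
have rN k : 0 < rho k ^+ N by rewrite exprn_gt0.
pose f (z : 'rV[R]_N * 'rV[R]_N) := (`|T z.1 - T (z.2 + z.1)|)%:E.
have mf : measurable_fun [set: 'rV[R]_N * 'rV[R]_N] f.
  apply/measurable_EFinP; apply: measurableT_comp => //; apply: measurable_funB.
    exact: (measurableT_comp mT measurable_fst).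
  by apply: (measurableT_comp mT); apply: maddrow; [exact: measurable_snd|exact: measurable_fst].
have f0 z : (0 <= f z)%E by rewrite lee_fin.
have mV k : measurable_fun [set: 'rV[R]_N] (fun x => \int[row]_(y in Q (rho k)) f (x, y))%E.
  exact: (@measurable_int_line _ _ _ _ _ row (Q (rho k)) f (mQ _) mf f0).
have V0 k x : (0 <= \int[row]_(y in Q (rho k)) f (x, y))%E by apply: integral_ge0 => y _; exact: f0.
have inv0 k : 0 <= (rho k ^+ N)^-1 by rewrite invr_ge0 ltW.
have w0 k x : (0 <= w k x)%E by apply: mule_ge0; [rewrite lee_fin|exact: V0].
have mw k : measurable_fun [set: 'rV[R]_N] (w k) by apply: measurable_funeM; exact: mV.
have mG k : measurable_fun [set: 'rV[R]_N] (G k) by apply: emeasurable_funD => //; exact: measurable_cst.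
have G0 k x : (0 <= G k x)%E by apply: adde_ge0 => //; rewrite lee_fin ltW.
pose L x := einfs (G^~ x) 0%N.
have mL : measurable_fun [set: 'rV[R]_N] L by exact: measurable_fun_einfs.
have L0 x : (0 <= L x)%E by apply: le_ereal_inf_tmp => _ [k _ <-]; exact: G0.
have LG k x : (L x <= G k x)%E by apply: ereal_inf_lbound; exists k.
pose K := ((2 * pi) ^+ N + C) + (1 + C1) / (1 - theta) * (2 * pi) ^+ N.
have /andP[th0 th1] := theta01.
have pin : 0 <= (2 * pi) ^+ N :> R by rewrite exprn_ge0// mulr_ge0// pi_ge0.
have K0 : 0 < K.
  rewrite ltr_wpDr//; last by rewrite ltr_wpDl.
  by rewrite mulr_ge0// divr_ge0 ?subr_ge0 ?(ltW th1)// addr_ge0.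
have IG k : (\int[row]_(x in cube) L x <= (K * rho k `^ alpha)%:E)%E.
  apply: (@le_trans _ _ (\int[row]_(x in cube) G k x)%E).
    apply: (ge0_le_integral row mC) => //.
    - exact: measurable_funTS.
    - exact: measurable_funTS.
  have B0 x : cube x -> (0 <= (Bk k)%:E :> \bar R)%E by move=> _; rewrite lee_fin ltW.
  rewrite (ge0_integralD row mC (fun x _ => w0 k x) (measurable_funTS (mw k)) B0 (measurable_cst _)).
  rewrite (ge0_integralZl row mC (measurable_funTS (mV k)) (fun x _ => V0 k x)); last by rewrite lee_fin.
  rewrite (@int_cst R N (Bk k)).
  apply: le_trans (leeD (lee_wpmul2l _ (mean_difference k)) (lexx _)) _; first by rewrite lee_fin.
  rewrite -EFinM -EFinD lee_fin /K /Bk le_eqVlt; apply/orP; left; apply/eqP.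
  by field; rewrite !gt_eqF// ?subr_gt0//.
have IL : (\int[row]_(x in cube) L x = 0)%E.
  apply/eqP; rewrite eq_le integral_ge0// andbT; apply/lee_addgt0Pr => eta eta0.
  have [k kP] := small_rho K0 eta0.
  by rewrite add0e; apply: le_trans (IG k) _; rewrite lee_fin.
have /ae_eq_integral_abs : (\int[row]_(x in cube) `|L x| = 0)%E.
  by rewrite -IL; apply: eq_integral => x _; rewrite gee0_abs.
move=> /(_ mC (measurable_funTS mL)) H; apply: filterS H => x Lx cx.
have ccx : closed_cube x by move=> i; have /andP[? ?] := cx i; rewrite !ltW.
apply/eqP; rewrite -subr_eq0 -normr_le0 -lee_fin.
have Lx0 : L x = 0%E := Lx cx.
apply: (@le_trans _ _ (L x)); last by rewrite Lx0.
apply: le_ereal_inf_tmp => _ [k _ <-].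
apply: (@le_trans _ _ ((`|T x - A (rho k) x|)%:E + (`|A (rho k) x - holder_rep x|)%:E)%E).
  rewrite -EFinD lee_fin -[X in `|X| <= _](subrKA (A (rho k) x)); exact: ler_normD.
apply: leeD; last by rewrite lee_fin holder_rep_close.
exact: avg_dist (integrable_Q ccx (r1 k)).
Qed.

End averages.

(** * Periodic extension and the theorem *)

Section periodic_extension.
Context {R : realType} {N : nat}.
Local Notation cube := (@open_cube R N).
Implicit Types (x : 'rV[R]_N) (t : R).

Definition wrapr t : R := t - 2 * pi * (Num.floor ((t + pi) / (2 * pi)))%:~R.

Definition wrap x : 'rV[R]_N := \row_i wrapr (x ord0 i).

Let pi20 : 0 < 2 * pi :> R. Proof. by rewrite mulr_gt0// pi_gt0. Qed.

Lemma wrapr_itv t : - pi <= wrapr t <= pi.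
Proof.
have /andP[f1 f2] := floor_itv ((t + pi) / (2 * pi)).
rewrite ler_pdivlMr// in f1; rewrite ltr_pdivrMr// intrD in f2.
by rewrite /wrapr; set z := (Num.floor _)%:~R in f1 f2 *; apply/andP; split; lra.
Qed.

Lemma wrapr_period t : wrapr (t + 2 * pi) = wrapr t.
Proof.
rewrite /wrapr (_ : (t + 2 * pi + pi) / (2 * pi) = (t + pi) / (2 * pi) + 1); last first.
  by rewrite addrAC mulrDl divff ?gt_eqF.
by rewrite floorDrz ?rpred1// floor1 intrD; ring.
Qed.

Lemma wrapr_id t : - pi < t < pi -> wrapr t = t.
Proof.
move=> /andP[t1 t2]; rewrite /wrapr (floor_def (m := 0)) ?mulr0 ?subr0//.
rewrite divr_ge0 ?(ltW pi20)//=; last by lra.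
by rewrite add0r ltr_pdivrMr// mul1r; lra.
Qed.

Lemma measurable_wrapr : measurable_fun [set: R] wrapr.
Proof.
apply: measurable_funB => //; apply: measurable_funM => //.
apply: nondecreasing_measurable => // t u tu; rewrite ler_int floor_ge_int; apply: le_trans (floor_le _) _.
by rewrite ler_pM2r ?invr_gt0// lerD2r.
Qed.

Lemma closed_cube_wrap x : closed_cube (wrap x).
Proof. by move=> i; rewrite mxE wrapr_itv. Qed.

Lemma wrap_period i x : wrap (x + period i) = wrap x.
Proof.
apply/rowP => j; rewrite !mxE eqxx/=.
by case: (j == i); rewrite ?mulr1 ?mulr0 ?addr0// wrapr_period.
Qed.

Lemma wrap_id x : cube x -> wrap x = x.
Proof. by move=> cx; apply/rowP => i; rewrite mxE wrapr_id//; exact: cx. Qed.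

Lemma measurable_wrap : measurable_fun [set: 'rV[R]_N] wrap.
Proof.
apply: measurable_to_mx => i j; under eq_fun do rewrite mxE.
exact: (measurableT_comp measurable_wrapr (measurable_mx_coord _ _)).
Qed.

End periodic_extension.

(** Near 0 smallness with [eps = 1] gives the linear term. For |t| >= d two constants 1 occur, one
    from the growth condition and one from raising the exponent [p'] to [p]; together they are at
    most (2/d) |t|. *)
Lemma growth_bound {R : realType} (T : Type) (f : T -> R -> R) (C p' p : R) : 2 < p' -> p' <= p -> 0 < C ->
  (forall eps : R, 0 < eps -> \forall t \near (0 : R), forall x, `|f x t| <= eps * `|t|) ->
  (forall x t, `|f x t| <= C * (1 + `|t| `^ (p' - 1))) ->
  exists2 K : R, 0 < K & forall x t, `|f x t| <= K * (`|t| + `|t| `^ (p - 1)).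
Proof.
move=> p'2 p'p C0 small growth.
have [d /= d0 dP] := small 1 ltr01.
exists (1 + C * (2 / d + 1)); first by rewrite ltr_wpDr// mulr_ge0 ?addr_ge0 ?divr_ge0 ?ltW.
move=> x t; have t0 : 0 <= `|t| by [].
have tp : 0 <= `|t| `^ (p - 1) by exact: powR_ge0.
have c0 : 0 <= C * (2 / d + 1) by rewrite mulr_ge0 ?addr_ge0 ?divr_ge0 ?ltW.
have [td|td] := ltP `|t| d.
  have := dP t; rewrite /= sub0r normrN => /(_ td x); rewrite mul1r => /le_trans; apply.
  apply: (@le_trans _ _ (1 * (`|t| + `|t| `^ (p - 1)))); first by rewrite mul1r lerDl.
  by apply: ler_wpM2r; [exact: addr_ge0|rewrite lerDl].
apply: le_trans (growth x t) _.
apply: (@le_trans _ _ (C * (2 / d + 1) * (`|t| + `|t| `^ (p - 1)))); last first.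
  by apply: ler_wpM2r; [exact: addr_ge0|rewrite lerDr].
rewrite -mulrA; apply: ler_wpM2l; first exact: ltW.
have H : `|t| `^ (p' - 1) <= 1 + `|t| `^ (p - 1).
  by apply: powR_mono_add => //; apply/andP; split; lra.
have H1 : 2 <= 2 / d * `|t| by rewrite mulrAC ler_pdivlMr// ler_pM2l.
have H2 : 0 <= 2 / d * `|t| `^ (p - 1) by rewrite mulr_ge0// divr_ge0// ltW.
by rewrite mulrDr !mulrDl !mul1r; lra.
Qed.

Section assembly.
Context {R : realType} {N : nat} (s m : R).
Local Notation p := (crit_exp N s).
Local Notation row := (lebesgue_row N).
Local Notation cube := (@open_cube R N).
Local Notation cyl := (@lebesgue_cyl R N).
Local Notation HC := (@half_cylinder R N).
Local Notation "'\In_' x F" := (\int[row]_(x in cube) (F%R)%:E)%E (at level 36, x name, F at level 36).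
Let mC := @measurable_open_cube R N.

Lemma crit_exp_gt2 : 0 < s -> 2 * s < N%:R -> 2 < p.
Proof.
move=> s0 sN; have d0 : 0 < N%:R - 2 * s by rewrite subr_gt0.
rewrite /crit_exp ltr_pdivlMr//; lra.
Qed.

(** Being a trace concerns values on the open cube only. Outside it the representative is redefined
    by periodicity, with value 0 on the faces, so that increments make sense everywhere. *)
Lemma periodic_trace (v : @Xspace R N s m) (T0 : 'rV[R]_N -> R) : is_trace v T0 ->
  let T := (T0 \_ cube) \o wrap in
  [/\ is_trace v T, measurable_fun [set: 'rV[R]_N] T, periodic_row T & forall x, cube x -> T x = T0 x].
Proof.
move=> [mT0 cT0] T.
have TE x : cube x -> T x = T0 x by move=> cx; rewrite /T /= wrap_id// /patch mem_set.
have mT : measurable_fun [set: 'rV[R]_N] T.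
  apply: (measurableT_comp _ measurable_wrap).
  exact: (iffLR (measurable_restrictT _ mC)).
have pT : periodic_row T by move=> i x; rewrite /T /= wrap_period.
split; [|exact: mT|exact: pT|exact: TE].
split; first exact: measurable_funTS.
move=> u_ au.
have E n : (\In_x (`|u_ n (x, 0) - T x| `^ p) = \In_x (`|u_ n (x, 0) - T0 x| `^ p))%E.
  by apply: eq_integral => x /set_mem cx; rewrite TE.
rewrite (eq_cvg _ _ E); exact: cT0.
Qed.

Lemma weak_trace_holder (v : @Xspace R N s m) (T g : 'rV[R]_N -> R) (kap Cg : R) :
  0 < s < 1 -> 2 < p -> is_trace v T ->
  measurable_fun [set: 'rV[R]_N] T -> periodic_row T ->
  measurable_fun [set: 'rV[R]_N] g -> periodic_row g -> 0 < Cg ->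
  (forall x, `|g x| <= Cg * (`|T x| + `|T x| `^ (p - 1))) ->
  (forall phi, test_function s m phi ->
    \int[cyl]_(z in HC) bil s m (Xfun v) (Xgrad v) phi (gradient phi) z =
    kap * \int[row]_(x in cube) (g x * phi (x, 0))) ->
  exists2 alpha : R, 0 < alpha < 1 & holder_class alpha T.
Proof.
move=> s01 p2 trv mT pT mg pg Cg0 gT weak.
have p1 : 1 < p by apply: lt_trans p2; rewrite ltr1n.
have p0 : 0 < p by exact: lt_trans p1.
have finT := fin_T p1 trv mT.
have q0 : 0 < p / (p - 1) by rewrite divr_gt0 ?subr_gt0.
(* For this conjugate exponent q one has (p - 1) q = p, so the critical growth of [g] asks exactly
   for the moment of order [p] of [T]. *)
have fin_g : (\In_x (`|g x| `^ (p / (p - 1))) < +oo)%E.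
  apply: (growth_moment p2 mT mg Cg0 gT q0).
    apply: fin_mono finT; first exact: measurable_funTS.
    by rewrite q0/= ler_pdivrMr ?subr_gt0// ler_peMr ?ltW//; lra.
  by rewrite mulrC divfK// gt_eqF// subr_gt0.
have key b := @key_estimate _ _ _ _ v T g kap p1 trv mT pT mg pg fin_g weak b.
have [/andP[s0 _] mom1] := (s01, moments p2 mT mg Cg0 gT finT key ltr01).
have start := trace_diff_decay s01 p1 trv mT pT.
have [a' aa' [q [C [q1 C0 dec]]]] := diff_decay_large p2 mT pT mg pg Cg0 gT finT key (N%:R + 1 / 2) s0 start.
(* Decay at the rate [a' >= a] implies decay at the rate [a] because r <= 1. With this [a] the
   Hoelder exponent is 1/(2q), which lies in (0, 1) since q >= 1. *)
pose a : R := N%:R + 1 / 2.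
have decay (r : R) (h : 'rV[R]_N) : 0 < r <= 1 -> (forall i, `|h ord0 i| <= r) ->
    (\In_x (`|bdiff h 1 T x| `^ q) <= (C * r `^ a)%:E)%E.
  move=> r01 hr; apply: le_trans (dec r h r01 hr) _.
  by rewrite lee_fin; apply: ler_wpM2l; [exact: ltW|exact: ger_powR].
have aN : N%:R < a by rewrite /a ltrDl divr_gt0.
have fin1 : (\In_x (`|T x|) < +oo)%E.
  by move: mom1; under eq_integral do rewrite powRr1//.
have [C2 HC2] := holder_rep_holder q1 C0 mT pT fin1 decay aN.
have hae := holder_rep_ae q1 C0 mT pT fin1 decay aN.
exists ((a - N%:R) / q); last by exists (holder_rep q C a T); split => //; exists C2.
have q0' : 0 < q by exact: lt_le_trans q1.
rewrite /a addrAC subrr add0r divr_gt0//= ltr_pdivrMr// !mul1r.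
by apply: lt_le_trans q1; lra.
Qed.

End assembly.

Theorem lemma5p1 (R : realType) (s : R) (N : nat) (m : R)
    (W : 'rV[R]_N -> R) (f : 'rV[R]_N -> R -> R)
    (p C mu : R) (A : set 'rV[R]_N) (fbar : R -> R)
    (s_gt0 : 0 < s) (s_lt1 : s < 1)
    (N_ge1 : (1 <= N)%N) (N_ge4s : 4 * s <= N%:R)
    (m_gt0 : 0 < m)
    (W_cont : continuous W)
    (W_per : forall i x, W (x + period i) = W x)
    (W_min : exists x0, [/\ closed_cube x0,
       (forall x, closed_cube x -> W x0 <= W x) & 0 < W x0])
    (W_max : forall x, closed_cube x -> W x <= W 0)
    (W_flat : (fun x => W x - W 0) =O_ (0 : 'rV[R]_N)
       (fun x => enorm x `^ (2 * s)))
    (f_cont : continuous (fun z : 'rV[R]_N * R => f z.1 z.2))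
    (f_per : forall i x t, f (x + period i) t = f x t)
    (f_small : forall eps : R, 0 < eps ->
       \forall t \near (0 : R), forall x, `|f x t| <= eps * `|t|)
    (p_gt2 : 2 < p) (p_lt : p < crit_exp N s) (C_gt0 : 0 < C)
    (f_growth : forall x t, `|f x t| <= C * (1 + `|t| `^ (p - 1)))
    (mu_gt2 : 2 < mu)
    (f_AR : forall x t, t != 0 ->
       0 < mu * primitive0 (f x) t <= t * f x t)
    (A_open : exists2 U : set 'rV[R]_N, open U & A = U `&` closed_cube)
    (A_neq0 : A !=set0)
    (fbar_int : forall b : R, 0 <= b ->
       lebesgue_measure.-integrable `[0, b] (EFin \o fbar))
    (f_ge_fbar : {ae lebesgue_row N, forall x, A x ->
       forall t, 0 <= t -> fbar t <= f x t})
    (fbar_lim : (eps `^ Num.min ((N%:R + 2 * s) / 2) (p * (N%:R - 2 * s) / 2) *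
         \int[lebesgue_measure]_(t in `[0, eps^-1])
           (primitive0 fbar
              ((eps^-1 / (1 + t ^+ 2)) `^ ((N%:R - 2 * s) / 2)) *
            t ^+ N.-1)) @[eps --> 0^'+] --> +oo)
    (v : @Xspace R N s m)
    (v_sol : weak_solution W f v) :
  exists alpha : R, 0 < alpha < 1 /\ holder_class alpha (Tr v).

Proof.
have N2s : 2 * s < N%:R by apply: lt_le_trans N_ge4s; rewrite ltr_pM2r// ltr_nat.
have P2 := crit_exp_gt2 s_gt0 N2s.
set P := crit_exp N s in P2.
have s01 : 0 < s < 1 by rewrite s_gt0.
have [[T0 trT0]|noT] := pselect (exists T, is_trace v T); last first.
  have -> : Tr v = cst 0 by apply: xgetPN => T trT; apply: noT; exists T.
  exists (1 / 2); split; first by apply/andP; split; lra.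
  exists (cst 0); split; last exact: aeW.
  by exists 0 => x y _ _; rewrite subrr normr0 mul0r.
have trTr : is_trace v (Tr v) by exact: (xgetPex _ (ex_intro _ _ trT0)).
have [trT mT pT TE] := periodic_trace trTr.
set T := _ \o wrap in trT mT pT TE.
pose T' := Tr v \_ open_cube.
(* Composing the nonlinearity with [wrap] makes it periodic by construction and evaluates [W] only
   on the closed cube, where it is between positive bounds; on the open cube it is the integrand of
   the weak equation. *)
pose g x := m `^ (2 * s) * T' (wrap x) + W (wrap x) * `|T' (wrap x)| `^ (P - 2) * T' (wrap x)
  + f (wrap x) (T' (wrap x)).
have mT' : measurable_fun [set: 'rV[R]_N] T'.
  by apply: (iffLR (measurable_restrictT _ (@measurable_open_cube R N))); case: trTr.
have mg : measurable_fun [set: 'rV[R]_N] g.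
  suff mG : measurable_fun [set: 'rV[R]_N] (fun y => m `^ (2 * s) * T' y + W y * `|T' y| `^ (P - 2) * T' y
      + f y (T' y)) by exact: (measurableT_comp mG (@measurable_wrap R N)).
  apply: measurable_funD; last first.
    have mf : measurable_fun [set: 'rV[R]_N * measurableTypeR R] (fun z => f z.1 z.2).
      apply: (open_continuous_measurable_row_line openT) => z _; exact: f_cont.
    have mp : measurable_fun [set: 'rV[R]_N] (fun y => (y, T' y) : 'rV[R]_N * measurableTypeR R).
      by apply/measurable_fun_pair.
    exact: (measurableT_comp mf mp).
  apply: measurable_funD; first by apply: measurable_funM.
  apply: measurable_funM => //; apply: measurable_funM; first exact: continuous_measurable_row.
  exact: measurable_powR_norm.
have pg : periodic_row g by move=> i x; rewrite /g wrap_period.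
have W0 : 0 < W 0.
  by have [x0 [cx0 _ Wx0]] := W_min; exact: lt_le_trans Wx0 (W_max _ cx0).
have [K K0 KP] := growth_bound p_gt2 (ltW p_lt) C_gt0 f_small f_growth.
have ms0 : 0 <= m `^ (2 * s) by exact: powR_ge0.
have Cg0 : 0 < m `^ (2 * s) + W 0 + K by rewrite addr_gt0// ltr_wpDl.
have gT x : `|g x| <= (m `^ (2 * s) + W 0 + K) * (`|T x| + `|T x| `^ (P - 1)).
  rewrite /g -[T x]/(T' (wrap x)); set t := T' (wrap x).
  have tP : 0 <= `|t| `^ (P - 1) by exact: powR_ge0.
  have t0 : 0 <= `|t| by [].
  have Wx : `|W (wrap x)| <= W 0.
    have cw := closed_cube_wrap x; have [x0 [_ Wmin Wx0]] := W_min.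
    by rewrite ger0_norm ?W_max//; apply: le_trans (ltW Wx0) (Wmin _ cw).
  rewrite [leRHS]mulrDl [X in _ <= X + _]mulrDl.
  apply: le_trans (ler_normD _ _) _; apply: lerD; last exact: KP.
  apply: le_trans (ler_normD _ _) _; apply: lerD.
    by rewrite normrM ger0_norm//; apply: ler_wpM2l => //; rewrite lerDl.
  rewrite !normrM (ger0_norm (powR_ge0 _ _)) -mulrA; apply: ler_pM => //.
  have -> : `|t| `^ (P - 2) * `|t| = `|t| `^ (P - 1).
    rewrite -{2}(powRr1 t0) -powRD; first by congr (_ `^ _); ring.
    by apply/implyP => /eqP; lra.
  by rewrite lerDr.
have weak phi : test_function s m phi ->
    \int[lebesgue_cyl]_(z in half_cylinder) bil s m (Xfun v) (Xgrad v) phi (gradient phi) z =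
    kappa s * \int[lebesgue_row N]_(x in open_cube) (g x * phi (x, 0)).
  (* The weak equation is used at the element of the completion given by [phi]; its chosen trace
     equals [phi (x, 0)] almost everywhere, which is enough under the integral. *)
  move=> tphi; have P1 : 1 <= P by rewrite ltW// (lt_trans _ P2)// ltr1n.
  have [mTr aeTr] := Tr_test P1 tphi trTr.
  have := v_sol (Xspace_of_test tphi); rewrite /= => E.
  transitivity (kappa s * \int[lebesgue_row N]_(x in open_cube) (g x * Tr (Xspace_of_test tphi) x)).
    apply: etrans (etrans E _); first by apply: eq_Rintegral => z _.
    congr (_ * _); apply: eq_Rintegral => x /set_mem cx.
    by rewrite /g wrap_id// /T' /patch mem_set.
  congr (_ * _); apply: (congr1 fine); apply: ae_eq_integral.
  - exact: measurable_open_cube.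
  - by apply/measurable_EFinP; apply: measurable_funM => //; exact: measurable_funTS.
  - apply/measurable_EFinP; apply: measurable_funM; first exact: measurable_funTS.
    exact: test_boundary_measurable tphi.
  - by apply: filterS aeTr => x H cx; rewrite /= H.
have [alpha alpha01 [rep [rep_holder rep_ae]]] := weak_trace_holder s01 P2 trT mT pT mg pg Cg0 gT weak.
exists alpha; split => //; exists rep; split => //.
by apply: filterS rep_ae => x H cx; rewrite -TE// H.
Qed.
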